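(* Let $J,\tilde J$ be pairwise interactions and $h,\tilde h$ external fields on $\mathbb{Z}^d$ as in the context, so that in particular $J(i,j)\le\tilde J(i,j)$, $h_i\le\tilde h_i$ and $\sum_j[\tilde J(i,j)-J(i,j)]\le\tilde h_i-h_i$ for all $i,j$. Suppose that $$\sup_{i\in\mathbb{Z}^d}\sum_{k}|V_i(k)|\Big(\sum_{j:\|j-i\|=k}\tilde J(i,j)\Big)<\infty$$ and that $0<\beta<\beta_c$, where $\beta_c$ is the solution of $$2\beta\,\sup_{i\in\mathbb{Z}^d}\sum_{k\ge1}\Big(|V_i(k)|\sum_{j:\|j-i\|=k}\tilde J(i,j)\Big)=1.$$ Let $\mu$ and $\tilde\mu$ be the Gibbs measures on $\{-1,1\}^{\mathbb{Z}^d}$ at parameter $\beta$ relative to $(J,h)$ and $(\tilde J,\tilde h)$ respectively. Then the invariant distribution $\nu$ of the coupled Glauber dynamics $(\sigma_t,\tilde\sigma_t)$ (defined in the context) on the space $\mathcal{S}$ of ordered pairs of configurations is a coupling of $\mu$ and $\tilde\mu$ concentrated on pairs with $\sigma\le\tilde\sigma$, and it attains Ornstein's $\bar d$-distance: $$\sup_{i\in\mathbb{Z}^d}\nu\big(\sigma(i)\ne\tilde\sigma(i)\big)=\bar d(\mu,\tilde\mu):=\inf\Big\{\sup_{i\in\mathbb{Z}^d}\mathbb{P}\big(\sigma(i)\ne\tilde\sigma(i)\big):(\sigma,\tilde\sigma)\text{ is a coupling of }\mu\text{ and }\tilde\mu\Big\}.$$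
   Context: For $i\in\mathbb{Z}^d$, $\|i\|=\sum_m|i_m|$ and $V_i(k)=\{j\in\mathbb{Z}^d:\|j-i\|\le k\}$ for $k\ge0$. Interactions and fields: $J=\{J(i,j)\}$ and $\tilde J=\{\tilde J(i,j)\}$ are collections of positive reals indexed by $i\ne j$ in $\mathbb{Z}^d$, symmetric, with $J(i,i)=\tilde J(i,i)=0$, $\sup_i\sum_jJ(i,j)<\infty$, $\sup_i\sum_j\tilde J(i,j)<\infty$, and $J(i,j)\le\tilde J(i,j)$. $\{h_i\}$, $\{\tilde h_i\}$ are collections of positive reals with $h_i\le\tilde h_i$ and $\sup_i\tilde h_i<\infty$. Moreover $\sum_j[\tilde J(i,j)-J(i,j)]\le\tilde h_i-h_i$ for all $i$. Gibbs measure: a probability $\mu$ on $\{-1,1\}^{\mathbb{Z}^d}$ is a Gibbs measure relative to $(J,h)$ if for all $i$ and $\zeta$ a version of the conditional probability is $$\mu(\sigma(i)=\zeta(i)\mid\sigma(j)=\zeta(j)\ \forall j\ne i)=\frac{1}{1+\exp(-2\beta[\sum_jJ(i,j)\zeta(i)\zeta(j)+h_i\zeta(i)])};$$ similarly for $(\tilde J,\tilde h)$. Coupled dynamics: write $\sigma\le\tilde\sigma$ if $\sigma(i)\le\tilde\sigma(i)$ for all $i$, and $\mathcal{S}=\{(\sigma,\tilde\sigma):\sigma\le\tilde\sigma\}=\{(-1,-1),(-1,+1),(+1,+1)\}^{\mathbb{Z}^d}$. Let $c_i(\sigma)=\exp(-\beta[\sum_jJ(i,j)\sigma(i)\sigma(j)+h_i\sigma(i)])$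 and define $\tilde c_i$ in the same way from $(\tilde J,\tilde h)$. Let $M_i=2e^{\beta[\sum_j\tilde J(i,j)+\tilde h_i]}$. Put $p_i(-\sigma(i)\mid\sigma)=c_i(\sigma)/M_i$ and $p_i(\sigma(i)\mid\sigma)=1-c_i(\sigma)/M_i$; define $\tilde p_i$ likewise with $\tilde c_i$ (and the same $M_i$). For $(\sigma,\tilde\sigma)\in\mathcal{S}$, $$P_i((+1,+1)\mid(\sigma,\tilde\sigma))=p_i(+1\mid\sigma),\quad P_i((-1,-1)\mid(\sigma,\tilde\sigma))=\tilde p_i(-1\mid\tilde\sigma),\quad P_i((-1,+1)\mid(\sigma,\tilde\sigma))=p_i(-1\mid\sigma)-\tilde p_i(-1\mid\tilde\sigma).$$ The coupled Glauber dynamics $(\sigma_t,\tilde\sigma_t)$ on $\mathcal{S}$: sites carry independent Poisson clocks, of rate $M_i$ at site $i$; when the clock at $i$ rings, the pair at site $i$ is replaced by a pair drawn from $P_i(\cdot\mid(\sigma_t,\tilde\sigma_t))$. *)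

(* Defs.v *)
From HB Require Import structures.
From mathcomp Require Import all_boot all_order all_algebra finmap.
From mathcomp Require Import all_classical all_reals all_analysis measurable_realfun.

Set Implicit Arguments.
Unset Strict Implicit.
Unset Printing Implicit Defensive.
Import Order.TTheory GRing.Theory Num.Theory.
Import numFieldNormedType.Exports.
Local Open Scope classical_set_scope.
Local Open Scope ring_scope.

Definition site (d : nat) := 'rV[int]_d.

Definition site_norm (d : nat) (i : site d) : nat :=
  (\sum_(m < d) absz (i ord0 m))%N.

Definition site_ball (d : nat) (i : site d) (k : nat) : set (site d) :=
  [set j | (site_norm (j - i)%R <= k)%N].

Definition site_shell (d : nat) (i : site d) (k : nat) : set (site d) :=
  [set j | site_norm (j - i)%R = k].

(* Spins are booleans, [true] standing for +1 and [false] for -1; the order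
   [false <= true] of [bool] is the order -1 <= +1 of spins. *)
Definition spin (R : realType) (b : bool) : R := if b then 1 else -1.

Definition cylinders (d : nat) (D : set (site d)) : set (set (site d -> bool)) :=
  [set A | exists i b, D i /\ A = [set s : site d -> bool | s i = b]].

(* {-1,+1}^(Z^d) with its product sigma-algebra. *)
Definition config (d : nat) := g_sigma_algebraType (@cylinders d setT).

Definition set_spin (d : nat) (s : config d) (i : site d) (b : bool) : config d :=
  fun j => if j == i then b else s j.

Definition ordered (d : nat) : set (config d * config d) :=
  [set x | forall i, (x.1 i <= x.2 i)%O].

Definition pair_at (d : nat) (x : config d * config d) (i : site d) : bool * bool :=
  (x.1 i, x.2 i).

(* [\esum] is meant for nonnegative terms; this is the sum of an absolutely
   summable real family (of no significance for other families). *)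
Definition rsum (R : realType) (T : choiceType) (f : T -> R) : R :=
  fine (\esum_(j in [set: T]) (f^\+ j)%:E)
  - fine (\esum_(j in [set: T]) (f^\- j)%:E).

Definition interaction (R : realType) (d : nat) (J : site d -> site d -> R) :=
  [/\ forall i j, i != j -> 0 < J i j,
      forall i, J i i = 0,
      forall i j, J i j = J j i
    & (ereal_sup (range (fun i => \esum_(j in [set: site d]) (J i j)%:E)) < +oo)%E].

Definition shell_weight (R : realType) (d : nat) (J : site d -> site d -> R)
    (i : site d) (k : nat) : \bar R :=
  ((#|` fset_set (site_ball i k)|)%:R%:E *
   \esum_(j in site_shell i k) (J i j)%:E)%E.

Definition energy (R : realType) (d : nat) (J : site d -> site d -> R)
    (h : site d -> R) (i : site d) (s : config d) : R :=
  rsum (fun j => J i j * spin R (s i) * spin R (s j)) + h i * spin R (s i).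

Definition cond_prob_version (R : realType) (dT : measure_display)
    (T : measurableType dT) (P : probability T R) (E : set T)
    (G : set (set T)) (g : T -> R) : Prop :=
  (forall B : set R, measurable B -> G (g @^-1` B)) /\
  (forall A, G A -> P (E `&` A) = (\int[P]_(x in A) (g x)%:E)%E).

Definition gibbs (R : realType) (d : nat) (beta : R) (J : site d -> site d -> R)
    (h : site d -> R) (mu : probability (config d) R) : Prop :=
  forall (i : site d) (b : bool),
    cond_prob_version mu [set s : config d | s i = b]
      (<<s cylinders [set~ i] >>)
      (fun s => (1 + expR (- (2 * beta * energy J h i (set_spin s i b))))^-1).

Definition flip_rate (R : realType) (d : nat) (beta : R)
    (J : site d -> site d -> R) (h : site d -> R) (i : site d) (s : config d) : R :=
  expR (- (beta * energy J h i s)).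

Definition clock_rate (R : realType) (d : nat) (beta : R)
    (J' : site d -> site d -> R) (h' : site d -> R) (i : site d) : R :=
  2 * expR (beta * (rsum (J' i) + h' i)).

Definition update_prob (R : realType) (d : nat) (c : site d -> config d -> R)
    (M : site d -> R) (i : site d) (b : bool) (s : config d) : R :=
  if b == s i then 1 - c i s / M i else c i s / M i.

Definition coupled_prob (R : realType) (d : nat) (c c' : site d -> config d -> R)
    (M : site d -> R) (i : site d) (x : config d * config d)
    (b : bool * bool) : R :=
  match b with
  | (true, true) => update_prob c M i true x.1
  | (false, false) => update_prob c' M i false x.2
  | (false, true) => update_prob c M i false x.1 - update_prob c' M i false x.2
  | (true, false) => 0
  end.

(* If [u] is uniform on [0, 1] and [q] is a probability mass function that
   vanishes at (+1,-1), then [draw q u] has law [q]. *)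
Definition draw (R : realType) (q : bool * bool -> R) (u : R) : bool * bool :=
  if u < q (true, true) then (true, true)
  else if u < q (true, true) + q (false, true) then (false, true)
  else (false, false).

Definition mutually_independent (R : realType) (dO : measure_display)
    (Omega : measurableType dO) (P : probability Omega R) (I : choiceType)
    (G : I -> set (set Omega)) : Prop :=
  forall (r : seq I) (A : I -> set Omega), uniq r ->
    (forall i, i \in r -> G i (A i)) ->
    P (\bigcap_(i in [set` r]) A i) = (\prod_(i <- r) P (A i))%E.

Definition count_events (R : realType) (dO : measure_display)
    (Omega : measurableType dO) (N : R -> Omega -> nat) (D : set R) :
    set (set Omega) :=
  [set A | exists t k, D t /\ A = N t @^-1` [set k]].

(* Counting process of a Poisson clock.  The law of the increments is required
   for s < t only: the library sets [poisson_pmf 0 k = 1] for every [k]. *)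
Definition poisson_clock (R : realType) (dO : measure_display)
    (Omega : measurableType dO) (P : probability Omega R) (rate : R)
    (N : R -> {RV P >-> nat}) : Prop :=
  [/\ forall w, N 0 w = 0%N,
      forall w (s t : R), 0 <= s -> s <= t -> (N s w <= N t w)%N,
      forall w (t : R), 0 <= t -> \forall s \near t^'+, N s w = N t w,
      forall (s t : R) k, 0 <= s -> s < t ->
        P [set w | (N t w - N s w)%N = k]
        = (poisson_pmf (rate * (t - s)) k)%:E
    & forall (s t : R) k A, 0 <= s -> s < t ->
        <<s count_events (fun r => N r : Omega -> nat) `[0, s] >> A ->
        P (A `&` [set w | (N t w - N s w)%N = k])
        = (P A * P [set w | (N t w - N s w)%N = k])%E].

(* The clocks of the sites and the marks are independent; the mark [U i n] is
   the uniform variable used for the n-th ring (n >= 1) of the clock at [i]. *)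
Definition marked_clocks (R : realType) (d : nat) (dO : measure_display)
    (Omega : measurableType dO) (P : probability Omega R) (M : site d -> R)
    (N : site d -> R -> {RV P >-> nat}) (U : site d -> nat -> {RV P >-> R}) : Prop :=
  [/\ forall i, poisson_clock (M i) (N i),
      forall i n (B : set R), measurable B ->
        P (U i n @^-1` B) = uniform_prob (@ltr01 R) B
    & mutually_independent P
        (fun a : site d + site d * nat =>
           match a with
           | inl i => <<s count_events (fun r => N i r : Omega -> nat) `[0, +oo[ >>
           | inr (i, n) => preimage_set_system setT (U i n) measurable
           end)].

Definition rings (R : realType) (dO : measure_display)
    (Omega : measurableType dO) (N : R -> Omega -> nat) (t : R) (w : Omega) : Prop :=
  0 < t /\ forall s : R, 0 <= s -> s < t -> (N s w < N t w)%N.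

(* Events observable up to time [t]: the clocks up to [t] and the marks of the
   rings that have occurred by time [t]. *)
Definition history (R : realType) (d : nat) (dO : measure_display)
    (Omega : measurableType dO) (N : site d -> R -> Omega -> nat)
    (U : site d -> nat -> Omega -> R) (t : R) : set (set Omega) :=
  <<s [set A | (exists i, count_events (N i) `[0, t] A) \/
       (exists i n (B : set R), measurable B /\
          A = [set w | (0 < n <= N i t w)%N /\ B (U i n w)])] >>.

Definition left_limit (R : realType) (d : nat) (Y : R -> config d * config d)
    (t : R) (y : config d * config d) : Prop :=
  forall i, \forall s \near t^'-, pair_at (Y s) i = pair_at y i.

Definition glauber_path (R : realType) (d : nat) (dO : measure_display)
    (Omega : measurableType dO)
    (q : site d -> config d * config d -> bool * bool -> R)
    (N : site d -> R -> Omega -> nat) (U : site d -> nat -> Omega -> R)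
    (x : config d * config d) (Y : R -> Omega -> config d * config d)
    (w : Omega) : Prop :=
  [/\ Y 0 w = x,
      forall i (s t : R), 0 <= s -> s <= t -> N i s w = N i t w ->
        pair_at (Y t w) i = pair_at (Y s w) i
    & forall i (t : R) y, rings (N i) t w -> left_limit (fun s => Y s w) t y ->
        pair_at (Y t w) i = draw (q i y) (U i (N i t w) w)].

(* [X x t] is the state at time [t >= 0] of the dynamics started from the
   ordered pair [x].  Sites are refreshed according to [q] at the rings of
   independent Poisson clocks of rates [M], without anticipating the future. *)
Definition glauber_dynamics (R : realType) (d : nat) (dO : measure_display)
    (Omega : measurableType dO) (P : probability Omega R)
    (q : site d -> config d * config d -> bool * bool -> R) (M : site d -> R)
    (N : site d -> R -> {RV P >-> nat}) (U : site d -> nat -> {RV P >-> R})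
    (X : config d * config d -> R -> Omega -> config d * config d) : Prop :=
  [/\ marked_clocks M N U,
      forall x, ordered x ->
        \forall w \ae P, glauber_path q (fun i t => N i t : Omega -> nat)
                           (fun i n => U i n : Omega -> R) x (X x) w,
      forall x (t : R) (A : set (config d * config d)), ordered x -> 0 <= t ->
        measurable A ->
        history (fun i t => N i t : Omega -> nat)
          (fun i n => U i n : Omega -> R) t (X x t @^-1` A)
    & forall (t : R) (A : set (config d * config d)), 0 <= t -> measurable A ->
        measurable_fun (@ordered d) (fun x => P (X x t @^-1` A))].

Definition invariant_law (R : realType) (d : nat) (dO : measure_display)
    (Omega : measurableType dO) (P : probability Omega R)
    (X : config d * config d -> R -> Omega -> config d * config d)
    (nu : probability (config d * config d)%type R) : Prop :=
  nu (@ordered d) = 1%E /\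
  forall (t : R) (A : set (config d * config d)), 0 <= t -> measurable A ->
    (\int[nu]_(x in @ordered d) P (X x t @^-1` A))%E = nu A.

Definition coupling (R : realType) (d : nat) (mu mu' : probability (config d) R)
    (nu : probability (config d * config d)%type R) : Prop :=
  forall A : set (config d), measurable A ->
    nu (fst @^-1` A) = mu A /\ nu (snd @^-1` A) = mu' A.

Definition sup_disagreement (R : realType) (d : nat)
    (nu : probability (config d * config d)%type R) : \bar R :=
  ereal_sup (range (fun i : site d =>
    nu [set x : config d * config d | x.1 i != x.2 i])).

Definition dbar (R : realType) (d : nat) (mu mu' : probability (config d) R) :
    \bar R :=
  ereal_inf [set sup_disagreement nu | nu in [set nu | coupling mu mu' nu]].

(* Main.v *)
Require Import Defs.
From HB Require Import structures.
From mathcomp Require Import all_boot all_order all_algebra finmap.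
From mathcomp Require Import all_classical all_reals all_analysis measurable_realfun.
From mathcomp Require Import ring lra zify.
Set Implicit Arguments.
Unset Strict Implicit.
Unset Printing Implicit Defensive.
Import Order.TTheory GRing.Theory Num.Theory.
Import numFieldNormedType.Exports.
Local Open Scope classical_set_scope.
Local Open Scope ring_scope.

(** The idea is to sandwich the infinite dynamics between finite chains. Freeze
    all the spins outside a finite set [L] at +1, or at -1. The generator [G] of
    the pair dynamics in [L] with such a boundary is monotone, and over a short
    time [h] an increasing function [f] of the spins in [L] satisfies
    [E f(X_{t+h}) <= E (f + h G f)(X_t) + O(h^2)] for the boundary +1, and the
    reverse inequality for the boundary -1: up to an event of probability
    [O(h^2)] at most one clock of [L] rings, and then the true configuration
    outside [L] lies between the two frozen ones. Hence a law [nu] of ordered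
    pairs is invariant if and only if [0 <= nu(G f)] for the boundary +1 and
    [nu(G f) <= 0] for the boundary -1, for all [L] and all increasing [f].

    Each marginal of such a law, and each Gibbs measure, lies between the
    finite-volume Gibbs measures with boundary +1 and -1. The difference [gap i]
    of their probabilities of a + at [i] is at most
    [4 beta sum_j J(i,j) gap j], up to the interaction of [i] with the outside
    of [L]; since [|V_i(k)| >= 2] for [k >= 1], the condition [beta < betac]
    makes this a contraction, and the gap vanishes as [L] grows. This yields
    uniqueness of the invariant law and identifies its marginals. Existence
    comes from time averages along an ultrafilter. Finally, an ordered coupling
    disagrees at [i] with probability [mu'(s i = +) - mu(s i = +)], which bounds
    the probability of disagreement of any coupling from below. *)

(** * Absolutely summable families and local fields *)

(** Infinitely many clocks ring in every interval, so there is no first ring to condition on, and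
    the dynamics seen in a finite set is not Markov. What a path does allow is to follow finitely
    many sites over a short time. The unknown spins around them enter only through monotonicity,
    which is why the estimates are one-sided and stated for increasing functions. Nothing is lost: a
    bounded cylindric function becomes increasing once a large multiple of the number of + spins is
    added.

    The equilibrium of a finite pair chain has no explicit formula; only its marginals are
    finite-volume Gibbs measures. Estimates for pairs are therefore reduced to single coordinates
    ([width_bound]).

    The factor [4 * beta] arises as follows: given the other spins, the spin at a site is + with a
    probability that is the logistic function of [2 * beta] times the local field, the logistic
    function is 1-Lipschitz, and raising one spin moves the field by twice the coupling.

    The ultrafilter limit is only a functional on cylindric functions. It becomes a law by coding a
    pair as a sequence of bits and reading these bits off a uniform variable. *)

Section Rsum.
Variables (R : realType) (T : choiceType).
Implicit Types (f g : T -> R) (L : seq T).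

Definition rsummable f := summable [set: T] (EFin \o f).

Lemma rsummable_ge0 f : (forall j, 0 <= f j) ->
  rsummable f = (\esum_(j in [set: T]) (f j)%:E < +oo)%E.
Proof.
move=> f0; rewrite /rsummable /summable; congr (_ < _)%E.
by apply: eq_esum => j _ /=; rewrite ger0_norm.
Qed.

Lemma le_rsummable f g : (forall j, `|f j| <= g j) -> rsummable g -> rsummable f.
Proof.
move=> fg; apply: le_lt_trans; apply: le_esum => j _ /=.
by rewrite lee_fin (le_trans (fg j))// ler_norm.
Qed.

Lemma rsummable_fin f : (forall j, 0 <= f j) -> rsummable f ->
  \esum_(j in [set: T]) (f j)%:E \is a fin_num.
Proof.
move=> f0; rewrite rsummable_ge0// ge0_fin_numE//.
by apply: esum_ge0 => j _; rewrite lee_fin.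
Qed.

(** Any decomposition into nonnegative summable parts computes [rsum], not only the positive and
    negative parts of its definition. Additivity rests on this freedom. *)
Lemma rsumB f g : (forall j, 0 <= f j) -> (forall j, 0 <= g j) ->
  rsummable f -> rsummable g ->
  rsum (fun j => f j - g j) =
  fine (\esum_(j in [set: T]) (f j)%:E) - fine (\esum_(j in [set: T]) (g j)%:E).
Proof.
move=> f0 g0 sf sg.
have sfg : rsummable (fun j => f j - g j).
  by have := summableB sf sg; rewrite /rsummable; congr (summable _ _).
have P (u : T -> R) : (fun j => (u^\+ j)%:E) = (EFin \o u)^\+%E.
  by apply/funext => j; rewrite funeposE /= EFin_max.
have N (u : T -> R) : (fun j => (u^\- j)%:E) = (EFin \o u)^\-%E.
  by apply/funext => j; rewrite funenegE /= EFin_max.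
have f0' (j : T) : [set: T] j -> (0 <= (EFin \o f) j)%E by rewrite lee_fin.
have g0' (j : T) : [set: T] j -> (0 <= (EFin \o g) j)%E by rewrite lee_fin.
have := esumB sf sg f0' g0'.
move=> /(congr1 fine).
rewrite [in X in _ = X -> _]fineB ?rsummable_fin// => <-.
rewrite /rsum fineB.
- by rewrite P N.
- rewrite -(P (fun j => f j - g j)) rsummable_fin//.
  rewrite rsummable_ge0//.
  rewrite P; apply: le_lt_trans (summable_funepos sfg).
  by apply: le_esum => j _; rewrite lee_abs.
- rewrite -(N (fun j => f j - g j)) rsummable_fin//.
  rewrite rsummable_ge0//.
  rewrite N; apply: le_lt_trans (summable_funeneg sfg).
  by apply: le_esum => j _; rewrite lee_abs.
Qed.

Lemma rsum_ge0E f : (forall j, 0 <= f j) -> rsummable f ->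
  rsum f = fine (\esum_(j in [set: T]) (f j)%:E).
Proof.
move=> f0 sf; have s0 : rsummable (fun _ : T => 0 : R).
  by rewrite rsummable_ge0// esum1// ltry.
have := rsumB f0 (fun=> lexx 0) sf s0.
under eq_fun do rewrite subr0.
by move=> ->; rewrite (esum1 (a := fun=> 0%:E))//= subr0.
Qed.

Lemma rsum_ge0 f : (forall j, 0 <= f j) -> rsummable f -> 0 <= rsum f.
Proof.
by move=> f0 sf; rewrite rsum_ge0E// fine_ge0// esum_ge0// => j _; rewrite lee_fin.
Qed.

Lemma rsummableD f g : rsummable f -> rsummable g -> rsummable (fun j => f j + g j).
Proof. by move=> sf sg; have := summableD sf sg; congr (summable _ _). Qed.

Lemma rsummableN f : rsummable f -> rsummable (fun j => - f j).
Proof. by rewrite /rsummable summableN; congr (summable _ _). Qed.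

Lemma rsummable_norm f : rsummable f -> rsummable (fun j => `|f j|).
Proof.
by apply: le_lt_trans; apply: le_esum => j _ /=; rewrite normr_id.
Qed.

Lemma rsumD f g : rsummable f -> rsummable g ->
  rsum (fun j => f j + g j) = rsum f + rsum g.
Proof.
(* Write [f = F - |f|] with both parts nonnegative. Such decompositions add up, unlike positive and
   negative parts. *)
move=> sf sg; pose F j := f j + `|f j|; pose G j := g j + `|g j|.
have nf := rsummable_norm sf; have ng := rsummable_norm sg.
have na (r : R) : 0 <= r + `|r| by have := ler_norm (- r); rewrite normrN; lra.
have F0 j : 0 <= F j by exact: na.
have G0 j : 0 <= G j by exact: na.
have sF : rsummable F by exact: rsummableD.
have sG : rsummable G by exact: rsummableD.
have E (u v : T -> R) : (forall j, 0 <= u j) -> (forall j, 0 <= v j) ->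
   rsummable u -> rsummable v -> fine (\esum_(j in [set: T]) (u j + v j)%:E) =
   fine (\esum_(j in [set: T]) (u j)%:E) + fine (\esum_(j in [set: T]) (v j)%:E).
  move=> u0 v0 su sv; rewrite -fineD ?rsummable_fin// -esumD//.
  - by move=> j _; rewrite lee_fin.
  - by move=> j _; rewrite lee_fin.
have e1 : rsum f = fine (\esum_(j in [set: T]) (F j)%:E) -
    fine (\esum_(j in [set: T]) `|f j|%:E).
  by rewrite -rsumB//; congr rsum; apply/funext => j; rewrite /F addrK.
have e2 : rsum g = fine (\esum_(j in [set: T]) (G j)%:E) -
    fine (\esum_(j in [set: T]) `|g j|%:E).
  by rewrite -rsumB//; congr rsum; apply/funext => j; rewrite /G addrK.
rewrite e1 e2 addrACA -opprD -!E// -rsumB//.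
- by congr rsum; apply/funext => j; rewrite /F /G; ring.
- by move=> j; rewrite addr_ge0.
- exact: rsummableD.
- exact: rsummableD.
Qed.

Lemma rsum0 : rsum (fun _ : T => 0 : R) = 0.
Proof.
have s0 : rsummable (fun _ : T => 0 : R).
  by rewrite rsummable_ge0// esum1// ltry.
by rewrite rsum_ge0E// esum1.
Qed.

Lemma rsumN f : rsummable f -> rsum (fun j => - f j) = - rsum f.
Proof.
move=> sf; apply/eqP; rewrite -subr_eq0 opprK -rsumD//; last exact: rsummableN.
by under eq_fun do rewrite addNr; rewrite rsum0.
Qed.

Lemma ler_rsum f g : rsummable f -> rsummable g -> (forall j, f j <= g j) ->
  rsum f <= rsum g.
Proof.
move=> sf sg fg; rewrite -subr_ge0 -rsumN// -rsumD//; last exact: rsummableN.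
apply: rsum_ge0; last by apply: rsummableD => //; exact: rsummableN.
by move=> j; rewrite subr_ge0.
Qed.

Lemma rsummable0 : rsummable (fun _ : T => 0 : R).
Proof. by rewrite rsummable_ge0// esum1// ltry. Qed.

Let delta_esum i (c : R) : 0 <= c ->
  \esum_(j in [set: T]) (if j == i then c else 0)%:E = c%:E.
Proof.
move=> c0; rewrite -[RHS](@esum_set1 _ _ i (fun=> c%:E)) ?lee_fin//.
rewrite [RHS]esum_mkcond; apply: eq_esum => j _.
by case: eqP => [->|ji]; [rewrite mem_set|rewrite memNset].
Qed.

Lemma rsum_delta i (c : R) : rsummable (fun j => if j == i then c else 0) /\
  rsum (fun j => if j == i then c else 0) = c.
Proof.
have H (e : R) : 0 <= e -> rsummable (fun j => if j == i then e else 0) /\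
    rsum (fun j => if j == i then e else 0) = e.
  move=> e0; have p j : 0 <= (if j == i then e else 0) by case: ifP.
  have sj : rsummable (fun j => if j == i then e else 0).
    by rewrite rsummable_ge0// delta_esum// ltry.
  by split=> //; rewrite rsum_ge0E// delta_esum.
have [/H//|c0] := leP 0 c.
have [s1 s2] : rsummable (fun j => if j == i then - c else 0) /\
    rsum (fun j => if j == i then - c else 0) = - c by apply: H; lra.
have -> : (fun j => if j == i then c else 0) =
          (fun j => - (if j == i then - c else 0)).
  by apply/funext => j; case: ifP; rewrite ?opprK ?oppr0.
by split; [exact: rsummableN | rewrite rsumN// s2 opprK].
Qed.

Lemma rsum_seq L f : uniq L -> (forall j, j \notin L -> f j = 0) ->
  rsummable f /\ rsum f = \sum_(j <- L) f j.
Proof.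
elim: L f => [|i L IH] f /=.
  move=> _ f0; have -> : f = fun=> 0 by apply/funext => j; exact: f0.
  by rewrite big_nil; split; [exact: rsummable0|exact: rsum0].
move=> /andP[iL uL] f0.
have [s1 e1] := rsum_delta i (f i).
have [|s2 e2] := IH (fun j => if j == i then 0 else f j) uL.
  move=> j jL; case: eqP => // /eqP ji; apply: f0.
  by rewrite inE negb_or ji.
have fE : f = fun j => (if j == i then f i else 0) + (if j == i then 0 else f j).
  by apply/funext => j; case: eqP => [->|_]; rewrite ?addr0 ?add0r.
rewrite {1 2}fE; split; first exact: rsummableD.
rewrite rsumD// e1 e2 big_cons; congr (_ + _).
apply: eq_big_seq => j jL; case: eqP => // ji.
by move: iL; rewrite -ji jL.
Qed.

Lemma rsum_cut L f : rsummable f -> uniq L ->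
  rsummable (fun j => if j \in L then 0 else f j) /\
  rsum f = \sum_(j <- L) f j + rsum (fun j => if j \in L then 0 else f j).
Proof.
move=> sf uL.
have [s1 e1] : rsummable (fun j => if j \in L then f j else 0) /\
    rsum (fun j => if j \in L then f j else 0) = \sum_(j <- L) f j.
  have [|s1 e1] := @rsum_seq L (fun j => if j \in L then f j else 0) uL.
    by move=> j /negbTE ->.
  by split=> //; rewrite e1; apply: eq_big_seq => j ->.
have s2 : rsummable (fun j => if j \in L then 0 else f j).
  apply: le_rsummable (rsummable_norm sf) => j.
  by case: ifP => // _; rewrite normr0.
split=> //; rewrite -e1 -rsumD//; congr rsum; apply/funext => j.
by case: ifP; rewrite ?addr0 ?add0r.
Qed.

Lemma ler_sum_rsum L f : (forall j, 0 <= f j) -> rsummable f -> uniq L ->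
  \sum_(j <- L) f j <= rsum f.
Proof.
move=> f0 sf uL; have [s ->] := rsum_cut sf uL.
by rewrite lerDl rsum_ge0// => j; case: ifP.
Qed.

Lemma ler_sum_subseq L L' f : (forall j, 0 <= f j) -> uniq L -> uniq L' ->
  {subset L <= L'} -> \sum_(j <- L) f j <= \sum_(j <- L') f j.
Proof.
move=> f0 uL uL' sL.
have [|s1 e1] := @rsum_seq L' (fun j => if j \in L' then f j else 0) uL'.
  by move=> j /negbTE ->.
have -> : \sum_(j <- L') f j = \sum_(j <- L') (if j \in L' then f j else 0).
  by apply: eq_big_seq => j ->.
have -> : \sum_(j <- L) f j = \sum_(j <- L) (if j \in L' then f j else 0).
  by apply: eq_big_seq => j /sL ->.
by rewrite -e1; apply: ler_sum_rsum => // j; case: ifP.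
Qed.

Lemma rsum_tail f (e : R) : (forall j, 0 <= f j) -> rsummable f -> 0 < e ->
  exists2 L : seq T, uniq L & forall L', uniq L' -> {subset L <= L'} ->
    rsum f - \sum_(j <- L') f j <= e.
Proof.
move=> f0 sf e0; have fs := rsummable_fin f0 sf.
have [_ [A [finA _] <-]] := ub_ereal_sup_adherent e0 fs.
rewrite fsbig_finite//= sumEFin => H.
exists (fset_set A) => // L' uL' sL.
have := ler_sum_subseq f0 (fset_uniq (fset_set A)) uL' sL.
move: H; rewrite -/(esum _ _) -(fineK fs) -rsum_ge0E// -EFinB lte_fin; lra.
Qed.

Lemma rsum_le_esum f (c : R) : (forall j, 0 <= f j) ->
  (\esum_(j in [set: T]) (f j)%:E <= c%:E)%E -> rsummable f /\ rsum f <= c.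
Proof.
move=> f0 fc; have sf : rsummable f.
  by rewrite rsummable_ge0// (le_lt_trans fc)// ltry.
by split=> //; rewrite rsum_ge0E// -lee_fin fineK// rsummable_fin.
Qed.

End Rsum.

(** * Local fields and refresh probabilities *)

Section LocalField.
Variables (R : realType) (d : nat).
Implicit Types (J : site d -> site d -> R) (h : site d -> R) (s t : config d).

Definition config_le s t := forall i, (s i <= t i)%O.

Definition local_field J h i s : R := rsum (fun j => J i j * spin R (s j)) + h i.

Lemma normr_spin b : `|spin R b| = 1.
Proof. by case: b; rewrite /= ?normrN normr1. Qed.

Lemma ler_spin b c : (b <= c)%O -> spin R b <= spin R c.
Proof. by case: b; case: c => //= _; lra. Qed.

Section Interaction.
Variables (J : site d -> site d -> R) (h : site d -> R).
Hypothesis JI : interaction J.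

Lemma interaction_ge0 i j : 0 <= J i j.
Proof.
case: JI => Jp J0 _ _; have [->|ij] := eqVneq i j; first by rewrite J0.
exact/ltW/Jp.
Qed.

Lemma interaction_summable i : rsummable (J i).
Proof.
case: JI => _ _ _ Js; rewrite rsummable_ge0; last exact: interaction_ge0.
by apply: le_lt_trans Js; apply: ereal_sup_ubound; exists i.
Qed.

Lemma spin_summable i s : rsummable (fun j => J i j * spin R (s j)).
Proof.
apply: le_rsummable (interaction_summable i) => j.
by rewrite normrM normr_spin mulr1 ger0_norm// interaction_ge0.
Qed.

Lemma local_field_le i s t : config_le s t ->
  local_field J h i s <= local_field J h i t.
Proof.
move=> st; rewrite lerD2r; apply: ler_rsum; [exact: spin_summable..|] => j.
by rewrite ler_wpM2l ?interaction_ge0 ?ler_spin.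
Qed.

Lemma local_field_bound i s :
  `|local_field J h i s - h i| <= rsum (J i).
Proof.
rewrite addrK ler_norml -rsumN; last exact: interaction_summable.
have := interaction_summable i => sJ; apply/andP; split.
  apply: ler_rsum; [exact: rsummableN|exact: spin_summable|] => j.
  have := interaction_ge0 i j; case: (s j) => /=; lra.
apply: ler_rsum; [exact: spin_summable|exact: sJ|] => j.
have := interaction_ge0 i j; case: (s j) => /=; lra.
Qed.

Lemma local_field_set_spin i s b :
  local_field J h i (set_spin s i b) = local_field J h i s.
Proof.
congr (rsum _ + _); apply/funext => j; rewrite /set_spin.
by case: eqP => // ->; case: JI => _ -> _ _; rewrite !mul0r.
Qed.

Lemma energyE i s : energy J h i s = spin R (s i) * local_field J h i s.
Proof.
rewrite /energy /local_field mulrDr [h i * _]mulrC; congr (_ + _).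
case: (s i) => /=.
  by rewrite mul1r; congr rsum; apply/funext => j; rewrite mulr1.
rewrite mulN1r -rsumN; last exact: spin_summable.
by congr rsum; apply/funext => j; rewrite mulrN1 mulNr.
Qed.

(* The boundary spins contribute to the field only through the total
   interaction with the complement of [L]. *)
Lemma local_field_cut i s (c : bool) (L : seq (site d)) : uniq L ->
  (forall j, j \notin L -> s j = c) ->
  local_field J h i s = \sum_(j <- L) J i j * spin R (s j)
    + (spin R c * (rsum (J i) - \sum_(j <- L) J i j) + h i).
Proof.
move=> uL sc; rewrite /local_field addrA; congr (_ + _).
have [sa ->] := rsum_cut (spin_summable i s) uL; congr (_ + _).
have sJ := interaction_summable i.
have [sb ->] := rsum_cut sJ uL; rewrite [X in _ * X]addrC addKr.
have [cE|cE] : spin R c = 1 \/ spin R c = -1 by case: (c); [left|right].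
  rewrite cE mul1r; congr rsum; apply/funext => j; case: ifPn => // jL.
  by rewrite sc// cE mulr1.
rewrite cE mulN1r -rsumN//; congr rsum; apply/funext => j; case: ifPn => [|jL].
  by rewrite oppr0.
by rewrite sc// cE mulrN1.
Qed.

End Interaction.

Section Rates.
Variables (beta : R) (J : site d -> site d -> R) (h M : site d -> R).
Hypothesis JI : interaction J.
Hypothesis beta_gt0 : 0 < beta.
Hypothesis M_large : forall i, 2 * expR (beta * (rsum (J i) + `|h i|)) <= M i.

Definition up_prob i s : R := update_prob (flip_rate beta J h) M i true s.

Lemma up_probE i s : up_prob i s =
  if s i then 1 - expR (- (beta * local_field J h i s)) / M i
  else expR (beta * local_field J h i s) / M i.
Proof.
rewrite /up_prob /update_prob /flip_rate energyE//.
by case: (s i) => /=; rewrite ?mul1r ?mulN1r ?mulrN ?opprK.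
Qed.

Lemma M_gt0 i : 0 < M i.
Proof. by apply: lt_le_trans (M_large i); rewrite mulr_gt0// expR_gt0. Qed.

(** A lower bound for the probability of either spin value at a refresh, whatever the configuration.
    This ellipticity makes the finite chains forget their starting point. *)
Definition min_prob i : R := expR (- (beta * (rsum (J i) + `|h i|))) / M i.

Lemma min_prob_gt0 i : 0 < min_prob i.
Proof. by rewrite divr_gt0 ?expR_gt0 ?M_gt0. Qed.

Let field_abs i s : `|local_field J h i s| <= rsum (J i) + `|h i|.
Proof.
have := local_field_bound h JI i s.
have := ler_normD (local_field J h i s - h i) (h i); rewrite subrK; lra.
Qed.

Lemma flip_prob_bounds i s (e : R) : `|e| = 1 ->
  min_prob i <= expR (e * (beta * local_field J h i s)) / M i <= 2^-1.
Proof.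
move=> e1; have Mi := M_gt0 i.
have : `|e * (beta * local_field J h i s)| <= beta * (rsum (J i) + `|h i|).
  by rewrite normrM e1 mul1r normrM gtr0_norm// ler_pM2l.
rewrite ler_norml => /andP[l u]; apply/andP; split.
  by rewrite /min_prob ler_pM2r ?invr_gt0// ler_expR.
rewrite ler_pdivrMr//; move: u; rewrite -ler_expR => u.
by have := M_large i; lra.
Qed.

Lemma up_prob_bounds i s : min_prob i <= up_prob i s <= 1 - min_prob i.
Proof.
rewrite up_probE.
have := @flip_prob_bounds i s 1 (normr1 _).
have := @flip_prob_bounds i s (-1) (eq_trans (normrN _) (normr1 _)).
rewrite mulN1r mul1r => /andP[? ?] /andP[? ?].
by case: (s i); apply/andP; split; lra.
Qed.

End Rates.

(** The delicate case is a - spin below a + spin: the lower spin flips up, the upper one does not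
    flip down. The factor 2 in the clock rate keeps both flip probabilities at most 1/2, and
    [p <= 1/2 <= 1 - p'] closes the case. *)
Lemma up_prob_le beta J h J' h' M i s t :
  interaction J -> interaction J' -> 0 < beta ->
  (forall i, 2 * expR (beta * (rsum (J i) + `|h i|)) <= M i) ->
  (forall i, 2 * expR (beta * (rsum (J' i) + `|h' i|)) <= M i) ->
  local_field J h i s <= local_field J' h' i t -> (s i <= t i)%O ->
  up_prob beta J h M i s <= up_prob beta J' h' M i t.
Proof.
move=> JI JI' b0 Ml Ml' fst st; rewrite !up_probE//.
have M0 := M_gt0 Ml i.
have /andP[_ u1] := flip_prob_bounds JI b0 Ml i s (normr1 _).
have /andP[_ u2] := flip_prob_bounds JI' b0 Ml' i t
  (eq_trans (normrN _) (normr1 _)).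
move: u1 u2 st; rewrite mulN1r mul1r.
case: (s i); case: (t i) => // u1 u2 _.
- by rewrite lerB// ler_pM2r ?invr_gt0// ler_expR lerN2 ler_pM2l.
- lra.
- by rewrite ler_pM2r ?invr_gt0// ler_expR ler_pM2l.
Qed.

End LocalField.

(** * Finite chains with frozen boundary *)

Section Configurations.
Variables (R : realType) (d : nat).
Local Notation pair := (config d * config d)%type.
Implicit Types (s t : config d) (x y : pair) (L : seq (site d)) (i j : site d).

Definition set_pair x i (b : bool * bool) : pair :=
  (set_spin x.1 i b.1, set_spin x.2 i b.2).

Definition extend L (c : bool) s : config d := fun j => if j \in L then s j else c.

Definition pair_le x y := config_le x.1 y.1 /\ config_le x.2 y.2.

Definition agree L x y := all (fun i => pair_at x i == pair_at y i) L.

Definition cylindric L (f : pair -> R) := forall x y, agree L x y -> f x = f y.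

Definition nondecr (f : pair -> R) :=
  forall x y, ordered x -> ordered y -> pair_le x y -> f x <= f y.

Definition nondecr1 (f : config d -> R) := forall s t, config_le s t -> f s <= f t.

Definition cylindric1 L (f : config d -> R) :=
  forall s t, {in L, s =1 t} -> f s = f t.

Lemma agreeP L x y :
  reflect (forall i, i \in L -> x.1 i = y.1 i /\ x.2 i = y.2 i) (agree L x y).
Proof.
apply: (iffP allP) => H i iL; first by have /eqP[-> ->] := H i iL.
by have [e1 e2] := H i iL; rewrite /pair_at e1 e2.
Qed.

Lemma agree_sub L L' x y : {subset L <= L'} -> agree L' x y -> agree L x y.
Proof. by move=> sL /agreeP H; apply/agreeP => i /sL /H. Qed.

Lemma cylindric_sub L L' f : {subset L <= L'} -> cylindric L f -> cylindric L' f.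
Proof. by move=> sL cf x y /(agree_sub sL) /cf. Qed.

Lemma config_le_refl s : config_le s s.
Proof. by move=> i. Qed.

Lemma pair_le_refl x : pair_le x x.
Proof. by split; exact: config_le_refl. Qed.

Lemma set_spin_le s t i (b c : bool) : config_le s t -> (b <= c)%O ->
  config_le (set_spin s i b) (set_spin t i c).
Proof. by move=> st bc j; rewrite /set_spin; case: eqP. Qed.

Lemma extend_le L c s t : config_le s t -> config_le (extend L c s) (extend L c t).
Proof. by move=> st j; rewrite /extend; case: ifP. Qed.

Lemma set_pair_le x y i (b c : bool * bool) : pair_le x y ->
  (b.1 <= c.1)%O -> (b.2 <= c.2)%O -> pair_le (set_pair x i b) (set_pair y i c).
Proof. by move=> [xy1 xy2] bc1 bc2; split; exact: set_spin_le. Qed.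

Lemma ordered_set_pair x i (b : bool * bool) : ordered x -> (b.1 <= b.2)%O ->
  ordered (set_pair x i b).
Proof. by move=> ox bb; exact: (@set_spin_le x.1 x.2). Qed.

Lemma ordered_extend L c x : ordered x -> ordered (extend L c x.1, extend L c x.2).
Proof. exact: extend_le. Qed.

Lemma extend_eq L c s t : {in L, s =1 t} -> extend L c s = extend L c t.
Proof. by move=> st; apply/funext => j; rewrite /extend; case: ifPn => // /st. Qed.

Lemma agree_set_pair L x y i b : agree L x y -> agree L (set_pair x i b) (set_pair y i b).
Proof.
move=> /agreeP xy; apply/agreeP => j jL; rewrite /set_pair /set_spin /=.
by case: eqP => // _; exact: xy.
Qed.

Definition top : config d := fun=> true.
Definition bot : config d := fun=> false.

Lemma le_top s : config_le s top. Proof. by move=> i; exact: lex1. Qed.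
Lemma bot_le s : config_le bot s. Proof. by move=> i; exact: le0x. Qed.

Lemma nondecr_fst f : nondecr1 f -> nondecr (f \o fst).
Proof. by move=> nf x y _ _ [xy _]; exact: nf. Qed.

Lemma nondecr_snd f : nondecr1 f -> nondecr (f \o snd).
Proof. by move=> nf x y _ _ [_ xy]; exact: nf. Qed.

Lemma cylindric_fst L f : cylindric1 L f -> cylindric L (f \o fst).
Proof. by move=> cf x y /agreeP xy; apply: cf => i /xy[]. Qed.

Lemma cylindric_snd L f : cylindric1 L f -> cylindric L (f \o snd).
Proof. by move=> cf x y /agreeP xy; apply: cf => i /xy[]. Qed.

Definition up i s : R := (s i)%:R.

Lemma nondecr_up i : nondecr1 (up i).
Proof. by move=> s t /(_ i); rewrite /up ler_nat; case: (s i); case: (t i). Qed.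

Lemma cylindric_up L i : i \in L -> cylindric1 L (up i).
Proof. by move=> iL s t st; rewrite /up st. Qed.

Lemma up_bound i s : 0 <= up i s <= 1.
Proof. by rewrite /up; case: (s i); rewrite ?lexx ler01. Qed.

(** A large multiple of this count turns any bounded cylindric function into an increasing one, so
    that equalities for increasing functions extend to all cylindric functions. *)
Definition spin_count L x : R := \sum_(i <- L) (up i x.1 + up i x.2).

Lemma nondecr_spin_count L : nondecr (spin_count L).
Proof.
move=> x y _ _ [xy1 xy2]; apply: ler_sum => i _.
by apply: lerD; exact: nondecr_up.
Qed.

Lemma cylindric_spin_count L : cylindric L (spin_count L).
Proof.
move=> x y /agreeP xy; apply: eq_big_seq => i /xy[e1 e2].
by rewrite /up e1 e2.
Qed.

(* The counts of two comparable pairs that disagree somewhere in [L] differ by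
   at least one. *)
Lemma nondecr_addcount L f (B : R) : cylindric L f -> (forall x, `|f x| <= B) ->
  nondecr (fun x => f x + 2 * B * spin_count L x).
Proof.
move=> cf fB x y ox oy xy.
have [/cf ->|] := boolP (agree L x y); first by
  rewrite lerD2l ler_wpM2l ?nondecr_spin_count// mulr_ge0// (le_trans _ (fB x)).
rewrite -has_predC => /hasP[i iL /= ni].
have B0 : 0 <= B by apply: le_trans (fB x).
have c1 : spin_count L x + 1 <= spin_count L y.
  rewrite /spin_count !(big_rem i iL)/= -addrA addrCA [X in _ <= X]addrC.
  case: xy => xy1 xy2.
  apply: lerD.
    by apply: ler_sum => j _; apply: lerD; exact: nondecr_up.
  move: ni (xy1 i) (xy2 i); rewrite /pair_at /up.
  by case: (x.1 i) (x.2 i) (y.1 i) (y.2 i) => [] [] [] [] //= _ _ _;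
    rewrite ?addr0 ?add0r//; lra.
have : 2 * B * (spin_count L x + 1) <= 2 * B * spin_count L y.
  by rewrite ler_wpM2l// mulr_ge0.
have := fB x; have := fB y; rewrite !ler_norml => /andP[? ?] /andP[? ?]; lra.
Qed.

Lemma nondecr1_addup L f (B : R) : cylindric1 L f -> (forall s, `|f s| <= B) ->
  nondecr1 (fun s => f s + 2 * B * \sum_(i <- L) up i s).
Proof.
move=> cf fB s t st.
have c0 : \sum_(i <- L) up i s <= \sum_(i <- L) up i t.
  by apply: ler_sum => i _; exact: nondecr_up.
have B0 : 0 <= B by apply: le_trans (fB s).
have [/allP H|] := boolP (all (fun i => s i == t i) L).
  rewrite (cf s t); last by move=> i /H /eqP.
  by rewrite lerD2l ler_wpM2l// mulr_ge0.
rewrite -has_predC => /hasP[i iL /= ni].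
have c1 : \sum_(i <- L) up i s + 1 <= \sum_(i <- L) up i t.
  rewrite !(big_rem i iL)/= addrAC addrC [X in _ <= X]addrC.
  apply: lerD; first by apply: ler_sum => j _; exact: nondecr_up.
  by move: ni (st i); rewrite /up; case: (s i) (t i) => [] []//= _ _; lra.
have : 2 * B * (\sum_(i <- L) up i s + 1) <= 2 * B * \sum_(i <- L) up i t.
  by rewrite ler_wpM2l// mulr_ge0.
have := fB s; have := fB t; rewrite !ler_norml => /andP[? ?] /andP[? ?]; lra.
Qed.

End Configurations.

(** * Generators with frozen boundary and their Euler steps *)

Section Generators.
Variables (R : realType) (d : nat).
Local Notation pair := (config d * config d)%type.
Implicit Types (s t : config d) (x y : pair) (L : seq (site d)) (i j : site d).
Variables (a b : site d -> config d -> R) (M : site d -> R).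

(** The expectation of [f] after site [i] receives the pair [(u < al, u < be)] with [u] uniform and
    [al <= be]: one mark drives both spins. *)
Definition pair_update i (al be : R) (f : pair -> R) x : R :=
  al * f (set_pair x i (true, true)) + (be - al) * f (set_pair x i (false, true))
  + (1 - be) * f (set_pair x i (false, false)).

Definition pair_gen L c (f : pair -> R) x : R :=
  \sum_(i <- L) M i * (pair_update i (a i (extend L c x.1)) (b i (extend L c x.2)) f x
                       - f x).

(** One Euler step of the generator. As long as [h] times the total rate of [L] is at most 1 it is a
    Markov kernel, hence preserves bounds and, by attractiveness, monotonicity. *)
Definition pair_ker L c (h : R) (f : pair -> R) x : R := f x + h * pair_gen L c f x.

Definition spin_update (p : site d -> config d -> R) L c i (f : config d -> R) s : R :=
  p i (extend L c s) * f (set_spin s i true)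
  + (1 - p i (extend L c s)) * f (set_spin s i false).

Definition spin_gen p L c (f : config d -> R) s : R :=
  \sum_(i <- L) M i * (spin_update p L c i f s - f s).

Definition spin_ker p L c (h : R) (f : config d -> R) s : R :=
  f s + h * spin_gen p L c f s.

Definition attractive (p : site d -> config d -> R) :=
  (forall i s, 0 <= p i s <= 1) /\
  (forall i s t, config_le s t -> p i s <= p i t).

Definition dominated := forall i x, ordered x -> a i x.1 <= b i x.2.

Lemma pair_gen_fst L c f : pair_gen L c (f \o fst) = spin_gen a L c f \o fst.
Proof.
apply/funext => x; apply: eq_bigr => i _ /=.
by rewrite /pair_update /spin_update /=; ring.
Qed.

Lemma pair_gen_snd L c f : pair_gen L c (f \o snd) = spin_gen b L c f \o snd.
Proof.
apply/funext => x; apply: eq_bigr => i _ /=.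
by rewrite /pair_update /spin_update /=; ring.
Qed.

Lemma iter_pair_ker_fst L c h n f :
  iter n (pair_ker L c h) (f \o fst) = iter n (spin_ker a L c h) f \o fst.
Proof.
by elim: n => //= n ->; apply/funext => x; rewrite /pair_ker pair_gen_fst.
Qed.

Lemma iter_pair_ker_snd L c h n f :
  iter n (pair_ker L c h) (f \o snd) = iter n (spin_ker b L c h) f \o snd.
Proof.
by elim: n => //= n ->; apply/funext => x; rewrite /pair_ker pair_gen_snd.
Qed.

Lemma pair_genD L c f g x :
  pair_gen L c (fun y => f y + g y) x = pair_gen L c f x + pair_gen L c g x.
Proof.
rewrite -big_split/=; apply: eq_bigr => i _.
by rewrite /pair_update; ring.
Qed.

Lemma pair_genZ L c k f x :
  pair_gen L c (fun y => k * f y) x = k * pair_gen L c f x.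
Proof.
by rewrite mulr_sumr; apply: eq_bigr => i _; rewrite /pair_update; ring.
Qed.

Lemma iter_pair_kerD L c h n f g x :
  iter n (pair_ker L c h) (fun y => f y + g y) x =
  iter n (pair_ker L c h) f x + iter n (pair_ker L c h) g x.
Proof.
elim: n x => //= n IH x; rewrite /pair_ker.
have -> : iter n (fun f x => f x + h * pair_gen L c f x) (fun y => f y + g y) =
    fun y => iter n (pair_ker L c h) f y + iter n (pair_ker L c h) g y.
  by apply/funext => y; exact: IH.
by rewrite pair_genD; ring.
Qed.

Lemma iter_pair_kerZ L c h n k f x :
  iter n (pair_ker L c h) (fun y => k * f y) x = k * iter n (pair_ker L c h) f x.
Proof.
elim: n x => //= n IH x; rewrite /pair_ker.
have -> : iter n (fun f x => f x + h * pair_gen L c f x) (fun y => k * f y) =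
    fun y => k * iter n (pair_ker L c h) f y.
  by apply/funext => y; exact: IH.
by rewrite pair_genZ; ring.
Qed.

Lemma cylindric_pair_gen L c f : cylindric L f -> cylindric L (pair_gen L c f).
Proof.
move=> cf x y xy; have e1 : extend L c x.1 = extend L c y.1.
  by apply: extend_eq => i iL; case: (agreeP _ _ _ xy i iL).
have e2 : extend L c x.2 = extend L c y.2.
  by apply: extend_eq => i iL; case: (agreeP _ _ _ xy i iL).
apply: eq_bigr => i _; rewrite /pair_update e1 e2 (cf _ _ xy).
by do 3 rewrite (cf _ _ (agree_set_pair i _ xy)).
Qed.

Lemma cylindric_pair_ker L c h f : cylindric L f -> cylindric L (pair_ker L c h f).
Proof.
by move=> cf x y xy; rewrite /pair_ker (cylindric_pair_gen c cf xy) (cf _ _ xy).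
Qed.

Lemma cylindric_iter_pair_ker L c h n f :
  cylindric L f -> cylindric L (iter n (pair_ker L c h) f).
Proof. by move=> cf; elim: n => //= n; exact: cylindric_pair_ker. Qed.

Lemma spin_kerE p L c h f s : spin_ker p L c h f s =
  (1 - h * \sum_(i <- L) M i) * f s + h * \sum_(i <- L) M i * spin_update p L c i f s.
Proof.
rewrite /spin_ker /spin_gen.
under eq_bigr do rewrite mulrBr.
by rewrite sumrB -mulr_suml; ring.
Qed.

Hypotheses (aA : attractive a) (bA : attractive b) (ab : dominated).

Section Monotone.
Variables (L : seq (site d)) (c : bool) (h : R).
Hypotheses (M0 : forall i, 0 <= M i) (h0 : 0 <= h) (hM : h * \sum_(i <- L) M i <= 1).

Lemma pair_ker_split f x : pair_ker L c h f x =
  (1 - h * \sum_(i <- L) M i) * f x + h * \sum_(i <- L)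
    M i * pair_update i (a i (extend L c x.1)) (b i (extend L c x.2)) f x.
Proof.
rewrite /pair_ker /pair_gen.
under eq_bigr do rewrite mulrBr.
by rewrite sumrB -mulr_suml; ring.
Qed.

Lemma nondecr_pair_ker f : nondecr f -> nondecr (pair_ker L c h f).
Proof.
move=> nf x y ox oy xy; rewrite !pair_ker_split; apply: lerD.
  by rewrite ler_wpM2l ?nf// subr_ge0.
apply: ler_wpM2l => //; apply: ler_sum => i _; apply: ler_wpM2l => //.
have ex := ordered_extend L c ox; have ey := ordered_extend L c oy.
have [xy1 xy2] := xy.
have a1 := aA.2 i _ _ (extend_le L c xy1).
have b1 := bA.2 i _ _ (extend_le L c xy2).
have ab1 := ab i ey; rewrite /= in ab1.
have /andP[a0 _] := aA.1 i (extend L c y.1).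
have /andP[_ b2] := bA.1 i (extend L c y.2).
rewrite /pair_update.
move: (a i _) (a i _) (b i _) (b i _) a1 b1 ab1 a0 b2 => al al' be be' a1 b1 ab1 a0 b2.
(* With [F] the value of [f] after the update, [pair_update] equals [F(-,-) + be (F(-,+) - F(-,-)) +
   al (F(+,+) - F(-,+))]. The last two inequalities make it increasing in [al] and [be]; the first
   three then compare [x] with [y] at equal weights. *)
have ff := nf _ _ (@ordered_set_pair _ _ i (false, false) ox erefl) (@ordered_set_pair _ _ i (false, false) oy erefl) (@set_pair_le _ _ _ i _ (false, false) xy (lexx _) (lexx _)).
have ft := nf _ _ (@ordered_set_pair _ _ i (false, true) ox erefl) (@ordered_set_pair _ _ i (false, true) oy erefl) (@set_pair_le _ _ _ i _ (false, true) xy (lexx _) (lexx _)).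
have tt := nf _ _ (@ordered_set_pair _ _ i (true, true) ox erefl) (@ordered_set_pair _ _ i (true, true) oy erefl) (@set_pair_le _ _ _ i _ (true, true) xy (lexx _) (lexx _)).
have fft := nf _ _ (@ordered_set_pair _ _ i (false, false) ox erefl) (@ordered_set_pair _ _ i (false, true) ox erefl) (@set_pair_le _ _ _ i (false, false) (false, true) (pair_le_refl x) (lexx _) erefl).
have ftt := nf _ _ (@ordered_set_pair _ _ i (false, true) ox erefl) (@ordered_set_pair _ _ i (true, true) ox erefl) (@set_pair_le _ _ _ i (false, true) (true, true) (pair_le_refl x) erefl (lexx _)).
nra.
Qed.

Lemma pair_ker_bounds f (l u : R) : (forall x, ordered x -> l <= f x <= u) ->
  forall x, ordered x -> l <= pair_ker L c h f x <= u.
Proof.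
move=> H x ox; rewrite pair_ker_split.
have hM' : 0 <= 1 - h * \sum_(i <- L) M i by rewrite subr_ge0.
have /andP[fl fu] := H _ ox.
have U i : l <= pair_update i (a i (extend L c x.1)) (b i (extend L c x.2)) f x <= u.
  have := ab i (ordered_extend L c ox) => /= ab1.
  have /andP[a0 _] := aA.1 i (extend L c x.1).
  have /andP[_ b2] := bA.1 i (extend L c x.2).
  rewrite /pair_update.
  move: (a i _) (b i _) ab1 a0 b2 => al be ab1 a0 b2.
  have /andP[? ?] := H _ (@ordered_set_pair _ _ i (false, false) ox erefl).
  have /andP[? ?] := H _ (@ordered_set_pair _ _ i (false, true) ox erefl).
  have /andP[? ?] := H _ (@ordered_set_pair _ _ i (true, true) ox erefl).
  by apply/andP; split; nra.
have Ul : (\sum_(i <- L) M i) * l <= \sum_(i <- L)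
    M i * pair_update i (a i (extend L c x.1)) (b i (extend L c x.2)) f x.
  by rewrite mulr_suml; apply: ler_sum => i _; apply: ler_wpM2l => //; case/andP: (U i).
have Uu : \sum_(i <- L)
    M i * pair_update i (a i (extend L c x.1)) (b i (extend L c x.2)) f x <=
  (\sum_(i <- L) M i) * u.
  by rewrite mulr_suml; apply: ler_sum => i _; apply: ler_wpM2l => //; case/andP: (U i).
have := ler_wpM2l h0 Ul; have := ler_wpM2l h0 Uu.
have := ler_wpM2l hM' fl; have := ler_wpM2l hM' fu.
move: (\sum_(i <- L) M i) (\sum_(i <- L) _) => S Q ? ? ? ?.
by apply/andP; split; lra.
Qed.

Lemma nondecr_iter_pair_ker n f : nondecr f -> nondecr (iter n (pair_ker L c h) f).
Proof. by move=> nf; elim: n => //= n; exact: nondecr_pair_ker. Qed.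

Lemma iter_pair_ker_bounds n f (l u : R) : (forall x, ordered x -> l <= f x <= u) ->
  forall x, ordered x -> l <= iter n (pair_ker L c h) f x <= u.
Proof. by move=> H; elim: n => //= n; exact: pair_ker_bounds. Qed.

End Monotone.
End Generators.

Lemma cylindric1_iter_spin_ker (R : realType) (d : nat) M p L c (h : R) n
    (f : config d -> R) :
  cylindric1 L f -> cylindric1 L (iter n (spin_ker M p L c h) f).
Proof.
move=> cf; elim: n => //= n; move: (iter n _ f) => g cg s t st.
rewrite /spin_ker /spin_gen (cg _ _ st); congr (_ + _ * _).
apply: eq_bigr => i _; rewrite /spin_update (extend_eq _ st).
have E b : g (set_spin s i b) = g (set_spin t i b).
  by apply: cg => j jL; rewrite /set_spin; case: eqP => // _; exact: st.
by rewrite !E.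
Qed.

Definition oscillation (R : realType) (d : nat) (f : config d -> R) : R :=
  f (@top d) - f (@bot d).

(** * Ergodicity of the one-spin chain *)

Section SpinChain.
Variables (R : realType) (d : nat).
Implicit Types (s t : config d) (L : seq (site d)) (i j : site d).
Variables (p : site d -> config d -> R) (M : site d -> R).
Variables (L : seq (site d)) (c : bool) (h : R).
Hypothesis pA : attractive p.

Lemma attractive_dominated : dominated p p.
Proof. by move=> i x ox; exact: pA.2. Qed.

(** The one-spin chain is a marginal of the pair chain built from [p] twice, and so inherits its
    monotonicity and its bounds. *)
Lemma spin_ker_pair f n s :
  iter n (spin_ker M p L c h) f s = iter n (pair_ker p p M L c h) (f \o fst) (s, s).
Proof. by rewrite iter_pair_ker_fst. Qed.

Hypotheses (M0 : forall i, 0 < M i) (h0 : 0 < h) (hM : h * \sum_(i <- L) M i <= 1).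

Let M0' i : 0 <= M i. Proof. exact: ltW. Qed.

Lemma nondecr_iter_spin_ker n f : nondecr1 f -> nondecr1 (iter n (spin_ker M p L c h) f).
Proof.
move=> nf s t st; rewrite !spin_ker_pair.
apply: nondecr_iter_pair_ker => //; first exact: attractive_dominated.
- exact: ltW.
- exact: nondecr_fst.
Qed.

Lemma iter_spin_ker_bounds n f (l u : R) : (forall s, l <= f s <= u) ->
  forall s, l <= iter n (spin_ker M p L c h) f s <= u.
Proof.
move=> H s; rewrite spin_ker_pair; apply: iter_pair_ker_bounds => //.
- exact: attractive_dominated.
- exact: ltW.
- by move=> x _; exact: H.
Qed.

Variable e : site d -> R.
Hypotheses (e0 : forall i, 0 < e i) (pe : forall i s, e i <= p i s <= 1 - e i).

(** With probability at least [h * M i * e i] the step refreshes site [i] to -; in all other cases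
    the value of [f] is at most the one at [top]. *)
Lemma spin_ker_minorization i f s : i \in L -> nondecr1 f ->
  spin_ker M p L c h f s <=
  (1 - h * M i * e i) * f (@top d) + h * M i * e i * f (set_spin s i false).
Proof.
move=> iL nf; set T := f (@top d).
have fT t : f t <= T by apply: nf; exact: le_top.
rewrite -(lerD2r (- T)).
have -> : spin_ker M p L c h f s - T = (1 - h * \sum_(j <- L) M j) * (f s - T) +
    h * \sum_(j <- L) M j * (spin_update p L c j f s - T).
  rewrite /spin_ker /spin_gen.
  have E u : \sum_(j <- L) M j * (spin_update p L c j f s - u) =
      \sum_(j <- L) M j * spin_update p L c j f s - (\sum_(j <- L) M j) * u.
    by under eq_bigr do rewrite mulrBr; rewrite sumrB -mulr_suml.
  by rewrite !E; ring.
have U j : spin_update p L c j f s - T <= e j * (f (set_spin s j false) - T).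
  rewrite /spin_update; have /andP[] := pe j (extend L c s).
  have := fT (set_spin s j false); have := fT (set_spin s j true); have := e0 j.
  move: (p j _) (f _) (f _) (e j) => q u v ej; nra.
have H : \sum_(j <- L) M j * (spin_update p L c j f s - T) <=
    M i * (e i * (f (set_spin s i false) - T)).
  rewrite (big_rem i iL)/= -[X in _ <= X]addr0; apply: lerD.
    by rewrite ler_wpM2l.
  apply: sumr_le0 => j _; rewrite mulr_ge0_le0//.
  apply: le_trans (U j) _; rewrite mulr_ge0_le0//; first exact: ltW.
  by rewrite subr_le0.
have A : (1 - h * \sum_(j <- L) M j) * (f s - T) <= 0.
  by rewrite mulr_ge0_le0 ?subr_ge0 ?subr_le0.
have := ler_wpM2l (ltW h0) H; move: A; lra.
Qed.

Let lower (r : seq (site d)) s : config d := foldr (fun i t => set_spin t i false) s r.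

(** A Doeblin condition: the sites of [r] are forced down one per step, and [q] is the product of
    the probabilities of these steps. *)
Let lower_minorization r : {subset r <= L} -> exists2 q : R, 0 < q <= 1 &
  forall f s, nondecr1 f -> iter (size r) (spin_ker M p L c h) f s <=
    (1 - q) * f (@top d) + q * f (lower r s).
Proof.
elim: r => [_|i r IH sr].
  by exists 1; [rewrite ltr01 lexx|move=> f s _ /=; lra].
have [|q /andP[q0 q1] H] := IH; first by move=> j jr; apply: sr; rewrite inE jr orbT.
have iL : i \in L by apply: sr; rewrite inE eqxx.
have hme : 0 < h * M i * e i by rewrite !mulr_gt0.
have hme1 : h * M i * e i <= 1.
  have : M i <= \sum_(j <- L) M j.
    by rewrite (big_rem i iL)/= lerDl sumr_ge0.
  move=> /(ler_wpM2l (ltW h0)) hm.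
  have /andP[? ?] := pe i (@top d).
  have hm1 : h * M i <= 1 := le_trans hm hM.
  have ei := e0 i.
  by rewrite mulr_ile1 ?(ltW ei) ?mulr_ge0 ?(ltW h0) ?(ltW (M0 i))//; lra.
exists (q * (h * M i * e i)) => [|f s nf].
  by apply/andP; split; [exact: mulr_gt0|rewrite mulr_ile1// ltW].
rewrite [size _]/= iterSr.
have n1 : nondecr1 (spin_ker M p L c h f) := @nondecr_iter_spin_ker 1%N f nf.
apply: le_trans (H _ s n1) _.
have T1 : spin_ker M p L c h f (@top d) <= f (@top d).
  have := spin_ker_minorization (@top d) iL nf.
  have : f (set_spin (@top d) i false) <= f (@top d) by apply: nf; exact: le_top.
  move: (f _) (f _) (spin_ker _ _ _ _ _ _ _) (h * M i * e i) hme hme1 => u v w z ? ? ? ?.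
  nra.
have T2 := spin_ker_minorization (lower r s) iL nf.
have := ler_wpM2l (ltW q0) T2; have : 0 <= 1 - q by rewrite subr_ge0.
move=> /(ler_wpM2l)/(_ _ _ T1); rewrite /lower/= -/(lower r s).
move: (f _) (f _) (spin_ker _ _ _ _ _ _ _) (spin_ker _ _ _ _ _ _ _) (h * M i * e i).
by move=> *; lra.
Qed.

(** Started from [top], after [size L] steps the chain has with probability at least [q] visited a
    state that is - on all of [L], where [f] takes its least value [f bot]. Started from [bot], the
    expected value is never below [f bot]. The oscillation thus loses a proportion [q]. *)
Lemma spin_ker_contraction : exists2 q : R, 0 <= q < 1 &
  forall f, nondecr1 f -> cylindric1 L f ->
    oscillation (iter (size L) (spin_ker M p L c h) f) <= q * oscillation f.
Proof.
have [q /andP[q0 q1] H] := @lower_minorization L (fun _ => id).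
exists (1 - q); first by apply/andP; split; lra.
move=> f nf cf.
have lowE r s : {in r, lower r s =1 @bot d}.
  elim: r => //= j r IH k; rewrite inE /set_spin.
  by case: eqP => //= _ /IH.
have := H f (@top d) nf; rewrite (cf _ _ (lowE _ _)).
have /andP[lb _] : f (@bot d) <= iter (size L) (spin_ker M p L c h) f (@bot d) <= f (@top d).
  apply: iter_spin_ker_bounds => s; apply/andP.
  by split; apply: nf; [exact: bot_le|exact: le_top].
rewrite /oscillation; move: lb; lra.
Qed.

Lemma spin_ker_ergodic f (eps : R) : 0 < eps -> nondecr1 f -> cylindric1 L f ->
  exists N, forall n, (N <= n)%N -> oscillation (iter n (spin_ker M p L c h) f) <= eps.
Proof.
move=> eps0 nf cf; have [q /andP[q0 q1] Hq] := spin_ker_contraction.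
have nk k := @nondecr_iter_spin_ker k f nf.
have ck k := @cylindric1_iter_spin_ker _ _ M p L c h k f cf.
have osc0 k : 0 <= oscillation (iter k (spin_ker M p L c h) f).
  by rewrite subr_ge0; apply: nk; exact: bot_le.
have pw k : oscillation (iter (k * size L) (spin_ker M p L c h) f) <= q ^+ k * oscillation f.
  elim: k => [|k IH]; first by rewrite mul0n expr0 mul1r.
  rewrite mulSn iterD; apply: le_trans (Hq _ (nk _) (ck _)) _.
  by rewrite exprS -mulrA ler_wpM2l.
(* Between multiples of [size L] the oscillation does not grow, since further steps only average
   values between those at [bot] and [top]. *)
have dec n m : oscillation (iter (n + m) (spin_ker M p L c h) f) <=
    oscillation (iter m (spin_ker M p L c h) f).
  rewrite iterD /oscillation.
  have B s : iter m (spin_ker M p L c h) f (@bot d) <=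
      iter m (spin_ker M p L c h) f s <= iter m (spin_ker M p L c h) f (@top d).
    by apply/andP; split; apply: nk; [exact: bot_le|exact: le_top].
  have /andP[_ ?] := @iter_spin_ker_bounds n _ _ _ B (@top d).
  have /andP[? _] := @iter_spin_ker_bounds n _ _ _ B (@bot d).
  lra.
have cq : (fun k => q ^+ k * oscillation f) @ \oo --> (0 : R).
  rewrite -[X in _ --> X](mul0r (oscillation f)); apply: cvgMl.
  by apply: cvg_expr; rewrite ger0_norm.
move/cvgrPdist_le : cq => /(_ _ eps0) [k _ /(_ _ (leqnn _))] /=.
rewrite sub0r normrN => Hk; exists (k * size L)%N => n kn.
rewrite -(subnK kn); apply: le_trans (dec _ _) _; apply: le_trans (pw k) _.
exact: le_trans (ler_norm _) Hk.
Qed.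

End SpinChain.

(** * Finite-volume Gibbs measures *)

Section SpinSum.
Variables (R : realType) (d : nat).
Implicit Types (s t : config d) (L : seq (site d)) (i j : site d) (F G : config d -> R).

Definition spin_sum i F : config d -> R :=
  fun s => F (set_spin s i true) + F (set_spin s i false).

(** For duplicate-free [L], the sum over all configurations that agree with the argument off [L].
    Summing site by site keeps everything on the full configuration space. *)
Definition lattice_sum L F : config d -> R := foldr spin_sum F L.

Definition off L s t := forall j, j \notin L -> t j = s j.

Lemma set_spin_set i s b c : set_spin (set_spin s i b) i c = set_spin s i c.
Proof. by apply/funext => j; rewrite /set_spin; case: eqP. Qed.

Lemma set_spinC i j s b c : i != j ->
  set_spin (set_spin s i b) j c = set_spin (set_spin s j c) i b.
Proof.
move=> ij; apply/funext => k; rewrite /set_spin.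
by case: (k =P j) => // ->; rewrite eq_sym (negbTE ij).
Qed.

Lemma spin_sumC i j F : spin_sum i (spin_sum j F) = spin_sum j (spin_sum i F).
Proof.
have [->//|ij] := eqVneq i j; apply/funext => s; rewrite /spin_sum.
by rewrite !(set_spinC s _ _ ij) addrACA.
Qed.

Lemma lattice_sum_spin_sum i L F :
  spin_sum i (lattice_sum L F) = lattice_sum L (spin_sum i F).
Proof. by elim: L => //= j L IH; rewrite spin_sumC IH. Qed.

Lemma le_lattice_sum L F G s : (forall t, off L s t -> F t <= G t) ->
  lattice_sum L F s <= lattice_sum L G s.
Proof.
elim: L s => [|i L IH] s H /=; first by apply: H.
apply: lerD; apply: IH => t ot; apply: H => j; rewrite inE negb_or => /andP[ji jL].
  by rewrite ot// /set_spin (negbTE ji).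
by rewrite ot// /set_spin (negbTE ji).
Qed.

Lemma eq_lattice_sum L F G s : (forall t, off L s t -> F t = G t) ->
  lattice_sum L F s = lattice_sum L G s.
Proof.
move=> H; apply/eqP; rewrite eq_le; apply/andP.
by split; apply: le_lattice_sum => t /H ->.
Qed.

Lemma lattice_sumD L F G s :
  lattice_sum L (fun t => F t + G t) s = lattice_sum L F s + lattice_sum L G s.
Proof.
elim: L s => //= i L IH s; rewrite /spin_sum !IH.
by rewrite addrACA.
Qed.

Lemma lattice_sumZ L k F s :
  lattice_sum L (fun t => k * F t) s = k * lattice_sum L F s.
Proof. by elim: L s => //= i L IH s; rewrite /spin_sum !IH mulrDr. Qed.

Lemma lattice_sum0 L s : lattice_sum L (fun=> 0) s = 0.
Proof. by elim: L s => //= i L IH s; rewrite /spin_sum !IH addr0. Qed.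

Lemma lattice_sum_sum L (I : Type) (r : seq I) (F : I -> config d -> R) s :
  lattice_sum L (fun t => \sum_(k <- r) F k t) s =
  \sum_(k <- r) lattice_sum L (F k) s.
Proof.
elim: r => [|k r IH].
  by rewrite big_nil -[RHS](lattice_sum0 L s); apply: eq_lattice_sum => t _; rewrite big_nil.
by rewrite big_cons -IH -lattice_sumD; apply: eq_lattice_sum => t _; rewrite big_cons.
Qed.

Lemma lattice_sum_gt0 L F s : (forall t, 0 < F t) -> 0 < lattice_sum L F s.
Proof. by move=> F0; elim: L s => //= i L IH s; rewrite addr_gt0. Qed.

(** The sums over the sites commute, so the one over [i] may be performed first. This is how
    detailed balance at one site yields identities between means. *)
Lemma lattice_sum_eq0 i L F c : i \in L ->
  (forall t, off L (fun=> c) t -> spin_sum i F t = 0) ->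
  lattice_sum L F (fun=> c) = 0.
Proof.
(* The cancellation is assumed only for configurations equal to [c] off [L]. Reading [F] through
   [extend] makes it an identity between functions, which can be rewritten under the sums. *)
move=> iL H; pose F' t := F (extend L c t).
have E t : off L (fun=> c) t -> extend L c t = t.
  by move=> ot; apply/funext => j; rewrite /extend; case: ifPn => // /ot.
have -> : lattice_sum L F (fun=> c) = lattice_sum L F' (fun=> c).
  by apply: eq_lattice_sum => t /E; rewrite /F' => ->.
have F'0 : spin_sum i F' = fun=> 0.
  apply/funext => t; rewrite -[RHS](H (extend L c t)).
    rewrite /spin_sum /F'; congr (F _ + F _); apply/funext => j;
    by rewrite /extend /set_spin; case: eqP => // ->; rewrite iL.
  by move=> j jL; rewrite /extend (negbTE jL).
move: F' F'0 {H E} => F' F'0.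
elim: L (fun=> c) iL => // j L IH s; rewrite inE => /orP[/eqP <-|iL] /=.
  by rewrite lattice_sum_spin_sum F'0 lattice_sum0.
by rewrite /spin_sum !IH ?addr0.
Qed.

End SpinSum.

(** Arithmetic of [gap_step]: [s0], [s1] stand for weighted sums of spins, [u0], [u1] for those of
    [up], [x0], [x1] for logistic values, [w] for the boundary and external field. *)
Lemma logistic_gap_arith (R : realType) (b s0 s1 u0 u1 x0 x1 w : R) :
  s1 - s0 = 2 * (u1 - u0) -> x1 - x0 <= 2 * (b * (s1 + w)) - 2 * (b * (s0 + w)) ->
  4 * b * u0 + -1 * x0 <= 4 * b * u1 + -1 * x1.
Proof.
move=> e; have -> : s1 = s0 + 2 * (u1 - u0) by lra.
lra.
Qed.

Lemma mean_gap_arith (R : realType) (x1 y0 y1 s0 s1 b t : R) :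
  x1 <= y1 + 4 * b * t -> 4 * b * s0 + -1 * y0 <= 4 * b * s1 + -1 * y1 ->
  x1 - y0 <= 4 * b * (s1 - s0 + t).
Proof. lra. Qed.

Section FiniteVolume.
Variables (R : realType) (d : nat) (beta : R) (J : site d -> site d -> R).
Variables (h M : site d -> R).
Hypothesis JI : interaction J.
Hypothesis beta_gt0 : 0 < beta.
Hypothesis M_large : forall i, 2 * expR (beta * (rsum (J i) + `|h i|)) <= M i.
Variables (L : seq (site d)).
Hypothesis uL : uniq L.
Implicit Types (s t : config d) (i j : site d) (c : bool) (f g : config d -> R).

Let p := up_prob beta J h M.
Let M0 := M_gt0 M_large.

Definition boundary_field c i : R :=
  spin R c * (rsum (J i) - \sum_(j <- L) J i j) + h i.

(** Minus the Hamiltonian in [L] with boundary spins [c]. The factor 1/2 is there because the double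
    sum meets every pair of sites twice. *)
Definition volume_energy c s : R := \sum_(i <- L)
  spin R (s i) * (2^-1 * \sum_(j <- L) J i j * spin R (s j) + boundary_field c i).

Definition weight c s : R := expR (beta * volume_energy c s).

Definition volume_mean c f : R :=
  lattice_sum L (fun t => weight c t * f t) (fun=> c) /
  lattice_sum L (weight c) (fun=> c).

Let Z_gt0 c : 0 < lattice_sum L (weight c) (fun=> c).
Proof. by apply: lattice_sum_gt0 => t; exact: expR_gt0. Qed.

Lemma volume_energy_diff c i s : i \in L -> off L (fun=> c) s ->
  volume_energy c (set_spin s i true) - volume_energy c (set_spin s i false) =
  2 * local_field J h i s.
Proof.
move=> iL oL; set u := set_spin s i true; set v := set_spin s i false.
have [_ Jii Jsym _] := JI.
have uv j : spin R (u j) - spin R (v j) = if j == i then 2 else 0.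
  by rewrite /u /v /set_spin; case: eqP => _ /=; lra.
have D (F : site d -> R) : \sum_(j <- L) (spin R (u j) - spin R (v j)) * F j = 2 * F i.
  rewrite (big_rem i iL)/= uv eqxx big1_seq ?addr0// => j /= jL.
  rewrite uv; case: eqP => [ji|_]; last by rewrite mul0r.
  by move: jL; rewrite ji mem_rem_uniqF.
have Js j (b : bool) : J i j * spin R (set_spin s i b j) = J i j * spin R (s j).
  by rewrite /set_spin; case: eqP => // ->; rewrite Jii !mul0r.
rewrite (local_field_cut h JI i uL oL) -/(boundary_field c i).
(* The product rule for differences. Spin [i] enters once as the outer and once as the inner index;
   by symmetry of [J] the two halves add up to the full interaction. *)
have -> : volume_energy c u - volume_energy c v =
   \sum_(m <- L) (spin R (u m) - spin R (v m)) *
      (2^-1 * (\sum_(j <- L) J m j * spin R (u j)) + boundary_field c m) +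
   \sum_(m <- L) 2^-1 * (spin R (v m) *
      \sum_(j <- L) (spin R (u j) - spin R (v j)) * J m j).
  rewrite /volume_energy -sumrB -big_split/=; apply: eq_bigr => m _.
  have -> : \sum_(j <- L) (spin R (u j) - spin R (v j)) * J m j =
     \sum_(j <- L) J m j * spin R (u j) - \sum_(j <- L) J m j * spin R (v j).
    by rewrite -sumrB; apply: eq_bigr => j _; ring.
  ring.
rewrite D; under [X in _ + X]eq_bigr do rewrite D.
have -> : \sum_(j <- L) J i j * spin R (u j) = \sum_(j <- L) J i j * spin R (s j).
  by apply: eq_bigr => j _; rewrite Js.
have -> : \sum_(m <- L) 2^-1 * (spin R (v m) * (2 * J m i)) =
    \sum_(j <- L) J i j * spin R (s j).
  apply: eq_bigr => j _; by rewrite -(Js j false) Jsym -/v; lra.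
lra.
Qed.

Lemma weight_true c i s : i \in L -> off L (fun=> c) s ->
  weight c (set_spin s i true) =
  weight c (set_spin s i false) * expR (2 * (beta * local_field J h i s)).
Proof.
move=> iL oL; rewrite /weight -expRD; congr expR.
by rewrite [2 * _]mulrCA -(volume_energy_diff iL oL); ring.
Qed.

Lemma volume_meanD c f g :
  volume_mean c (fun s => f s + g s) = volume_mean c f + volume_mean c g.
Proof.
rewrite /volume_mean -mulrDl -lattice_sumD; congr (_ / _).
by apply: eq_lattice_sum => t _; rewrite mulrDr.
Qed.

Lemma volume_meanZ c k f : volume_mean c (fun s => k * f s) = k * volume_mean c f.
Proof.
rewrite /volume_mean mulrA -lattice_sumZ; congr (_ / _).
by apply: eq_lattice_sum => t _; rewrite mulrCA.
Qed.

Lemma volume_mean_sum c (I : Type) (r : seq I) (F : I -> config d -> R) :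
  volume_mean c (fun s => \sum_(k <- r) F k s) = \sum_(k <- r) volume_mean c (F k).
Proof.
rewrite /volume_mean -mulr_suml -lattice_sum_sum; congr (_ / _).
by apply: eq_lattice_sum => t _; rewrite mulr_sumr.
Qed.

Lemma volume_mean_cst c k : volume_mean c (fun=> k) = k.
Proof.
rewrite /volume_mean.
have -> : lattice_sum L (fun t => weight c t * k) (fun=> c) =
          k * lattice_sum L (weight c) (fun=> c).
  by rewrite -lattice_sumZ; apply: eq_lattice_sum => t _; rewrite mulrC.
by rewrite mulfK// gt_eqF.
Qed.

Lemma le_volume_mean c f g : (forall s, f s <= g s) ->
  volume_mean c f <= volume_mean c g.
Proof.
move=> fg; rewrite /volume_mean ler_pM2r ?invr_gt0//.
by apply: le_lattice_sum => t _; rewrite ler_wpM2l// expR_ge0.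
Qed.

Lemma extend_off c s : off L (fun=> c) s -> extend L c s = s.
Proof. by move=> oL; apply/funext => j; rewrite /extend; case: ifPn => // /oL. Qed.

(** Detailed balance: flipping spin [i] up multiplies the weight by [expR (2 * (beta * H))], with
    [H] the local field, which is exactly the ratio of the rates of flipping up and down. *)
Lemma volume_mean_update c i f : i \in L ->
  volume_mean c (fun s => spin_update p L c i f s - f s) = 0.
Proof.
move=> iL; rewrite /volume_mean (lattice_sum_eq0 iL) ?mul0r// => s oL.
rewrite /spin_sum (weight_true iL oL) /spin_update !set_spin_set.
have oL' b : off L (fun=> c) (set_spin s i b).
  by move=> j jL; rewrite /set_spin; case: eqP => [ji|_]; [rewrite -ji (negbTE jL) in iL|exact: oL].
have si b : set_spin s i b i = b by rewrite /set_spin eqxx.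
rewrite !extend_off// /p !up_probE// !local_field_set_spin// !si.
have -> : expR (2 * (beta * local_field J h i s)) =
  expR (beta * local_field J h i s) * expR (beta * local_field J h i s).
  by rewrite -expRD; congr expR; ring.
have := expR_gt0 (beta * local_field J h i s).
rewrite expRN; move: (expR (beta * _)) => E E0.
have MiN : M i != 0 by rewrite gt_eqF.
have EN : E != 0 by rewrite gt_eqF.
by field; rewrite EN MiN.
Qed.

Lemma volume_mean_ker c k f n : volume_mean c (iter n (spin_ker M p L c k) f) = volume_mean c f.
Proof.
elim: n => //= n; move: (iter n _ f) => g <-.
rewrite /spin_ker volume_meanD volume_meanZ /spin_gen volume_mean_sum big1_seq ?mulr0 ?addr0//.
by move=> i /= iL; rewrite volume_meanZ volume_mean_update ?mulr0.
Qed.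

Lemma attractive_up_prob : attractive p.
Proof.
split=> [i s|i s t st].
  have := min_prob_gt0 M_large i.
  have /andP[] := up_prob_bounds JI beta_gt0 M_large i s.
  by rewrite -/p => ? ? ?; apply/andP; split; lra.
by apply: up_prob_le => //; exact: local_field_le.
Qed.

(** A mesh for which the Euler step is a Markov kernel; the summand 1 covers the empty [L]. *)
Let k : R := (1 + \sum_(i <- L) M i)^-1.

Let S_ge0 : 0 <= \sum_(i <- L) M i.
Proof. by rewrite sumr_ge0// => i _; exact: ltW. Qed.

Lemma mesh_gt0 : 0 < k. Proof. by rewrite /k invr_gt0 ltr_pwDl. Qed.

Lemma mesh_le1 : k * \sum_(i <- L) M i <= 1.
Proof. by rewrite /k mulrC ler_pdivrMr ?ltr_pwDl// mul1r lerDr. Qed.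

Lemma volume_mean_between c f n : nondecr1 f ->
  iter n (spin_ker M p L c k) f (@bot d) <= volume_mean c f <=
  iter n (spin_ker M p L c k) f (@top d).
Proof.
move=> nf; rewrite -(volume_mean_ker c k f n).
have nK := nondecr_iter_spin_ker c attractive_up_prob M0 mesh_gt0 mesh_le1 n nf.
move: (iter n _ f) nK => g ng; apply/andP; split.
  by rewrite -[g _](volume_mean_cst c); apply: le_volume_mean => s; apply: ng; exact: bot_le.
by rewrite -[g (@top d)](volume_mean_cst c); apply: le_volume_mean => s; apply: ng; exact: le_top.
Qed.

Let spin_ker_boundary f s : nondecr1 f ->
  spin_ker M p L false k f s <= spin_ker M p L true k f s.
Proof.
move=> nf; rewrite /spin_ker lerD2l ler_wpM2l ?(ltW mesh_gt0)//.
apply: ler_sum => i _; rewrite ler_wpM2l ?(ltW (M0 i))// lerD2r /spin_update.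
have P : p i (extend L false s) <= p i (extend L true s).
  apply: attractive_up_prob.2 => j; rewrite /extend; case: ifP => // _.
have F : f (set_spin s i false) <= f (set_spin s i true).
  by apply: nf; apply: set_spin_le => //; exact: config_le_refl.
nra.
Qed.

(** A dynamical proof of the comparison between boundary conditions: started from the same state the
    two chains stay ordered at all times, and each one converges to its own finite-volume mean. *)
Lemma volume_mean_mono f : nondecr1 f -> cylindric1 L f ->
  volume_mean false f <= volume_mean true f.
Proof.
move=> nf cf; apply/ler_addgt0Pr => eps eps0.
have [n /(_ n (leqnn n))] := spin_ker_ergodic false attractive_up_prob M0
  mesh_gt0 mesh_le1 (min_prob_gt0 M_large) (up_prob_bounds JI beta_gt0 M_large) eps0 nf cf.
have nK c m := nondecr_iter_spin_ker c attractive_up_prob M0 mesh_gt0 mesh_le1 m nf.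
have H1 g0 g1 : nondecr1 g1 -> (forall s, g0 s <= g1 s) ->
    forall s, spin_ker M p L false k g0 s <= spin_ker M p L true k g1 s.
  move=> n1 g01 s; apply: le_trans (spin_ker_boundary s n1).
  rewrite !spin_kerE; apply: lerD.
    by rewrite ler_wpM2l// subr_ge0 mesh_le1.
  rewrite ler_wpM2l ?(ltW mesh_gt0)//; apply: ler_sum => i _.
  rewrite ler_wpM2l ?(ltW (M0 i))// /spin_update.
  have /andP[q0 q1] := attractive_up_prob.1 i (extend L false s).
  by apply: lerD; rewrite ler_wpM2l ?g01// subr_ge0.
have H m : forall s, iter m (spin_ker M p L false k) f s <= iter m (spin_ker M p L true k) f s.
  by elim: m => [s|m IH]; [exact: lexx|exact: (H1 _ _ (nK true m) IH)].
have /andP[_ B1] := volume_mean_between false n nf.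
have /andP[B2 _] := volume_mean_between true n nf.
have := H n (@bot d); rewrite /oscillation; lra.
Qed.

Definition logistic (z : R) : R := (1 + expR (- z))^-1.

(** The sharp Lipschitz constant is 1/4; the constant 1 gives the factor [4 * beta] of [gap_step],
    which the bound on [beta] controls. *)
Lemma logistic_lip x y : x <= y -> 0 <= logistic y - logistic x <= y - x.
Proof.
move=> xy; rewrite /logistic.
have := expR_gt0 (- x); have := expR_gt0 (- y).
have e1 : expR (- y) = expR (- x) * expR (- (y - x)) by rewrite -expRD; congr expR; ring.
have := expR_ge1Dx (- (y - x)).
have : expR (- (y - x)) <= 1 by rewrite -expR0 ler_expR; lra.
rewrite e1; move: (expR (- x)) (expR _) => A B B1 B2 AB A0.
have B0 : 0 < B by move: AB; rewrite pmulr_rgt0.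
have -> : (1 + A * B)^-1 - (1 + A)^-1 = A * (1 - B) / ((1 + A * B) * (1 + A)).
  by field; rewrite !gt_eqF//; lra.
have D0 : 0 < (1 + A * B) * (1 + A) by rewrite mulr_gt0//; lra.
apply/andP; split; first by rewrite divr_ge0// ?(ltW D0)// mulr_ge0; lra.
rewrite ler_pdivrMr//.
have w0 : 0 <= y - x by lra.
have w1 : 1 - B <= y - x by lra.
apply: le_trans (ler_wpM2l (ltW A0) w1) _; rewrite mulrC ler_wpM2l//; nra.
Qed.

(** The one-site conditional probability in finite volume: the difference of the two integrands
    cancels between the two values of spin [i]. *)
Lemma volume_mean_up c i : i \in L -> volume_mean c (up R i) =
  volume_mean c (fun s => logistic (2 * (beta * local_field J h i (extend L c s)))).
Proof.
move=> iL; set g := fun s => _.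
suff : volume_mean c (fun s => up R i s + -1 * g s) = 0.
  by rewrite volume_meanD volume_meanZ; lra.
rewrite /volume_mean (lattice_sum_eq0 iL) ?mul0r// => s oL.
rewrite /spin_sum (weight_true iL oL) /g.
have oL' b : off L (fun=> c) (set_spin s i b).
  by move=> j jL; rewrite /set_spin; case: eqP => [ji|_]; [rewrite -ji (negbTE jL) in iL|exact: oL].
have si b : set_spin s i b i = b by rewrite /set_spin eqxx.
rewrite !extend_off// !local_field_set_spin// /up !si /=.
have := expR_gt0 (2 * (beta * local_field J h i s)).
rewrite /logistic expRN; move: (expR (2 * _)) => E E0.
by field; rewrite !gt_eqF//; lra.
Qed.

Definition gap i : R := volume_mean true (up R i) - volume_mean false (up R i).

Lemma gap_bounds i : i \in L -> 0 <= gap i <= 1.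
Proof.
move=> iL; have := volume_mean_mono (nondecr_up R i) (cylindric_up R iL).
have := @le_volume_mean true _ _ (fun s => (andP (up_bound R i s)).2).
have := @le_volume_mean false _ _ (fun s => (andP (up_bound R i s)).1).
by rewrite /gap !volume_mean_cst => ? ? ?; apply/andP; split; lra.
Qed.

(** The gap at [i] is a difference of means of the logistic function of the local field. Changing
    the boundary inside this function costs the interaction with the outside; changing the measure
    is controlled by the gaps at the other sites, thanks to the increasing function [g] below. *)
Lemma gap_step i : i \in L -> gap i <=
  4 * beta * (\sum_(j <- L) J i j * gap j + (rsum (J i) - \sum_(j <- L) J i j)).
Proof.
move=> iL; rewrite /gap !(volume_mean_up _ iL).
set tail := rsum (J i) - \sum_(j <- L) J i j.
have tail0 : 0 <= tail.
  by rewrite subr_ge0 ler_sum_rsum//; [move=> j; exact: interaction_ge0|exact: interaction_summable].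
pose psi c s := logistic (2 * (beta * local_field J h i (extend L c s))).
have fE c s : local_field J h i (extend L c s) =
    \sum_(j <- L) J i j * spin R (s j) + (spin R c * tail + h i).
  rewrite (local_field_cut h JI i (s := extend L c s) (c := c) uL).
    congr (_ + _); apply: eq_big_seq => j jL; by rewrite /extend jL.
  by move=> j jL; rewrite /extend (negbTE jL).
have spinE s t : \sum_(j <- L) J i j * spin R (t j) - \sum_(j <- L) J i j * spin R (s j) =
    2 * (\sum_(j <- L) J i j * up R j t - \sum_(j <- L) J i j * up R j s).
  rewrite -!sumrB mulr_sumr; apply: eq_bigr => j _.
  by rewrite /up; case: (s j); case: (t j) => /=; lra.
have b2 : 0 <= 2 * beta by rewrite mulr_ge0// ltW.
(* The two boundaries shift the field by [2 * tail], hence the argument of the logistic function by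
   [4 * beta * tail]. *)
have A : volume_mean true (psi true) <= volume_mean true (psi false) + 4 * beta * tail.
  rewrite -[4 * beta * tail](volume_mean_cst true) -volume_meanD.
  apply: le_volume_mean => s; rewrite /psi !fE /=.
  set F := \sum_(j <- L) _.
  have bt : 0 <= beta * tail by rewrite mulr_ge0// ltW.
  have : 2 * (beta * (F + (-1 * tail + h i))) <= 2 * (beta * (F + (1 * tail + h i))) by lra.
  by move=> /logistic_lip/andP[_]; lra.
(* Raising the spin at [j] changes [psi] by at most [4 * beta * J i j], so [g] is increasing. The
   comparison of its two means bounds the gap of [psi] by the weighted gaps of the [up R j]. *)
pose g s := \sum_(j <- L) 4 * beta * J i j * up R j s + -1 * psi false s.
have ng : nondecr1 g.
  move=> s t st; rewrite /g.
  have := local_field_le h JI i (extend_le L false st).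
  move=> /(ler_wpM2l b2); rewrite -!mulrA => /logistic_lip/andP[_].
  have := spinE s t; rewrite -/(psi _ _) -/(psi _ _) !fE.
  have E u : \sum_(j <- L) 4 * beta * J i j * up R j u =
     4 * beta * \sum_(j <- L) J i j * up R j u.
    by rewrite mulr_sumr; apply: eq_bigr => j _; rewrite mulrA.
  by rewrite !E; exact: logistic_gap_arith.
have cg : cylindric1 L g.
  move=> s t st; rewrite /g /psi (extend_eq _ st); congr (_ + _).
  by apply: eq_big_seq => j jL; rewrite /up st.
have := volume_mean_mono ng cg.
rewrite /g !volume_meanD !volume_mean_sum !volume_meanZ.
have E c : \sum_(j <- L) volume_mean c (fun s => 4 * beta * J i j * up R j s) =
    4 * beta * \sum_(j <- L) J i j * volume_mean c (up R j).
  by rewrite mulr_sumr; apply: eq_bigr => j _; rewrite volume_meanZ mulrA.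
rewrite !E; move: A.
have -> : \sum_(j <- L) J i j * (volume_mean true (up R j) - volume_mean false (up R j)) =
  \sum_(j <- L) J i j * volume_mean true (up R j) - \sum_(j <- L) J i j * volume_mean false (up R j).
  by rewrite -sumrB; apply: eq_bigr => j _; rewrite mulrBr.
exact: mean_gap_arith.
Qed.

End FiniteVolume.

(** * The gap vanishes in infinite volume *)

Section InfiniteVolume.
Variables (R : realType) (d : nat) (beta : R) (J : site d -> site d -> R).
Variables (h M : site d -> R) (theta : R).
Hypothesis JI : interaction J.
Hypothesis beta_gt0 : 0 < beta.
Hypothesis M_large : forall i, 2 * expR (beta * (rsum (J i) + `|h i|)) <= M i.
Hypothesis theta_lt1 : theta < 1.
Hypothesis J_small : forall i, 4 * beta * rsum (J i) <= theta.
Implicit Types (L D : seq (site d)).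

Let theta_ge0 : 0 <= theta.
Proof.
apply: le_trans (J_small 0); rewrite !mulr_ge0 ?(ltW beta_gt0)//.
by apply: rsum_ge0; [exact: interaction_ge0|exact: interaction_summable].
Qed.

(** Each use of [gap_step] gains a factor [theta] but involves sites further away; [n] uses stay
    within a finite set up to an arbitrarily small interaction. The start is the trivial bound 1. *)
Let gap_iter n D (eps : R) : 0 < eps ->
  exists2 L0, uniq L0 & forall L, uniq L -> {subset L0 <= L} -> {subset D <= L} ->
    {in D, forall i, gap beta J h L i <= theta ^+ n + eps}.
Proof.
elim: n D eps => [|n IH] D eps e0.
  exists [::] => // L uL _ sD i /sD iL.
  have /andP[_] := gap_bounds JI beta_gt0 M_large uL iL.
  by rewrite expr0; lra.
have e2 : 0 < eps / 2 by lra.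
(* [F] carries the interaction of all sites of [D] up to [eps / 2]; the induction hypothesis is then
   applied with [F] in place of [D]. *)
have [F uF HF] : exists2 F, uniq F &
    {in D, forall i, 4 * beta * (rsum (J i) - \sum_(j <- F) J i j) <= eps / 2}.
  elim: D => [|i D [F uF HF]]; first by exists [::].
  have b4 : 0 < 4 * beta by rewrite mulr_gt0.
  have [F' uF' HF'] := rsum_tail (interaction_ge0 JI i) (interaction_summable JI i) (divr_gt0 e2 b4).
  exists (undup (F' ++ F)); first exact: undup_uniq.
  move=> j; rewrite inE => /orP[/eqP ->|jD].
    rewrite mulrC -ler_pdivlMr//; apply: HF'; first exact: undup_uniq.
    by move=> m; rewrite mem_undup mem_cat => ->.
  apply: le_trans (HF j jD); rewrite ler_pM2l// lerD2l lerN2.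
  apply: ler_sum_subseq => //; [exact: interaction_ge0|exact: undup_uniq|].
  by move=> m; rewrite mem_undup mem_cat orbC => ->.
have [L0 uL0 HL0] := IH F (eps / 2) e2.
exists (undup (L0 ++ F)); first exact: undup_uniq.
move=> L uL sL sD i iD.
have sF : {subset F <= L} by move=> j jF; apply: sL; rewrite mem_undup mem_cat jF orbT.
have gF := HL0 L uL (fun j jL => sL j (etrans (mem_undup _ _) (etrans (mem_cat _ _ _) (introT orP (or_introl jL))))) sF.
have iL := sD i iD; have gL j (jL : j \in L) := andP (gap_bounds JI beta_gt0 M_large uL jL).
apply: le_trans (gap_step JI beta_gt0 M_large uL iL) _.
have J0 := interaction_ge0 JI i.
(* Since gaps are at most 1, a site of [L] outside [F] contributes at most its full coupling, which
   [HF] makes small. *)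
have S1 : \sum_(j <- F) J i j * (1 - gap beta J h L j) <=
          \sum_(j <- L) J i j * (1 - gap beta J h L j).
  have := @ler_sum_subseq _ _ F L (fun j => if j \in L then J i j * (1 - gap beta J h L j) else 0) _ uF uL sF.
  rewrite (eq_big_seq (fun j => J i j * (1 - gap beta J h L j))); last by move=> j /sF ->.
  rewrite [X in _ -> _ <= X](eq_big_seq (fun j => if j \in L then J i j * (1 - gap beta J h L j) else 0)); last by move=> j ->.
  apply=> j; case: ifP => // /gL[_ ?]; rewrite mulr_ge0//; lra.
have E (r : seq (site d)) : \sum_(j <- r) J i j * (1 - gap beta J h L j) =
    \sum_(j <- r) J i j - \sum_(j <- r) J i j * gap beta J h L j.
  by rewrite -sumrB; apply: eq_bigr => j _; rewrite mulrBr mulr1.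
have S2 : \sum_(j <- F) J i j * gap beta J h L j <= (\sum_(j <- F) J i j) * (theta ^+ n + eps / 2).
  by rewrite mulr_suml big_seq [X in _ <= X]big_seq; apply: ler_sum => j jF; rewrite ler_wpM2l// gF.
have S3 : \sum_(j <- F) J i j <= rsum (J i) by exact: ler_sum_rsum (interaction_summable JI i) uF.
have t0 : 0 <= theta ^+ n + eps / 2 by rewrite addr_ge0 ?exprn_ge0// ltW.
have b4 : 0 <= 4 * beta by rewrite mulr_ge0// ltW.
have S4 : 4 * beta * ((\sum_(j <- F) J i j) * (theta ^+ n + eps / 2)) <= theta * (theta ^+ n + eps / 2).
  rewrite mulrA ler_wpM2r//; apply: le_trans (J_small i).
  by rewrite ler_wpM2l.
have S5 := HF i iD.
have S6 : theta * (eps / 2) <= eps / 2 by rewrite ler_piMl// ltW.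
have := ler_wpM2l b4 S1; have := ler_wpM2l b4 S2; rewrite !E exprS; lra.
Qed.

Lemma gap_small D (eps : R) : 0 < eps ->
  exists2 L0, uniq L0 & forall L, uniq L -> {subset L0 <= L} -> {subset D <= L} ->
    {in D, forall i, gap beta J h L i <= eps}.
Proof.
move=> e0; have e2 : 0 < eps / 2 by lra.
have cq : (fun k => theta ^+ k) @ \oo --> (0 : R).
  by apply: cvg_expr; rewrite ger0_norm.
move/cvgrPdist_le : cq => /(_ _ e2) [n _ /(_ _ (leqnn _))] /=.
rewrite sub0r normrN ger0_norm ?exprn_ge0// => Hn.
have [L0 uL0 H] := gap_iter n D e2.
by exists L0 => // L uL sL sD i iD; have := H L uL sL sD i iD; lra.
Qed.

End InfiniteVolume.

(** * Expectations and cylinder functions *)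

Section Mean.
Variables (R : realType) (dT : measure_display) (T : measurableType dT).
Implicit Types (f g : T -> R) (A : set T).

Definition bounded_measurable f :=
  measurable_fun setT f /\ exists B, forall x, `|f x| <= B.

Lemma bounded_measurableD f g : bounded_measurable f -> bounded_measurable g ->
  bounded_measurable (fun x => f x + g x).
Proof.
move=> [mf [A fA]] [mg [B gB]]; split; first exact: measurable_funD.
by exists (A + B) => x; rewrite (le_trans (ler_normD _ _))// lerD.
Qed.

Lemma bounded_measurableM f g : bounded_measurable f -> bounded_measurable g ->
  bounded_measurable (fun x => f x * g x).
Proof.
move=> [mf [A fA]] [mg [B gB]]; split; first exact: measurable_funM.
by exists (A * B) => x; rewrite normrM ler_pM.
Qed.

Lemma bounded_measurable_cst (k : R) : bounded_measurable (fun _ : T => k).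
Proof. by split; [exact: measurable_cst|exists `|k|]. Qed.

Lemma bounded_measurableZ k f : bounded_measurable f ->
  bounded_measurable (fun x => k * f x).
Proof. by apply: bounded_measurableM; exact: bounded_measurable_cst. Qed.

Lemma bounded_measurableB f g : bounded_measurable f -> bounded_measurable g ->
  bounded_measurable (fun x => f x - g x).
Proof.
move=> bf bg; under [X in bounded_measurable X]funext => x do rewrite -mulN1r.
by apply: bounded_measurableD => //; exact: bounded_measurableZ.
Qed.

Lemma bounded_measurable_sum (I : Type) (r : seq I) (Q : pred I) (F : I -> T -> R) :
  (forall i, bounded_measurable (F i)) ->
  bounded_measurable (fun x => \sum_(i <- r | Q i) F i x).
Proof.
move=> H; elim: r => [|i r IH].
  under [X in bounded_measurable X]funext => x do rewrite big_nil.
  exact: bounded_measurable_cst.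
under [X in bounded_measurable X]funext => x do rewrite big_cons.
by case: (Q i) => //; exact: bounded_measurableD.
Qed.

Lemma bounded_measurable_indic A : measurable A ->
  bounded_measurable (\1_A : T -> R).
Proof.
move=> mA; split; first exact: measurable_indic.
by exists 1 => x; rewrite indicE; case: (_ \in _); rewrite ?normr1 ?normr0.
Qed.

Variable P : probability T R.

Definition mean f : R := Rintegral P setT f.

Lemma bounded_measurable_integrable f :
  bounded_measurable f -> P.-integrable setT (EFin \o f).
Proof.
move=> [mf [B fB]]; apply: measurable_bounded_integrable => //.
  by rewrite (le_lt_trans (probability_le1 P _))// ltry.
exists B; split; first exact: num_real.
by move=> M BM x _; apply: le_trans (fB x) (ltW BM).
Qed.

Lemma meanD f g : bounded_measurable f -> bounded_measurable g ->
  mean (fun x => f x + g x) = mean f + mean g.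
Proof. by move=> mf mg; apply: RintegralD => //; exact: bounded_measurable_integrable. Qed.

Lemma meanZ k f : bounded_measurable f -> mean (fun x => k * f x) = k * mean f.
Proof. by move=> mf; apply: RintegralZl => //; exact: bounded_measurable_integrable. Qed.

Lemma mean_cst k : mean (fun=> k) = k.
Proof.
rewrite /mean Rintegral_cst//.

have -> : fine (P setT) = 1 by rewrite (probability_setT P).
exact: mulr1.
Qed.

Lemma meanB f g : bounded_measurable f -> bounded_measurable g ->
  mean (fun x => f x - g x) = mean f - mean g.
Proof. by move=> mf mg; apply: RintegralB => //; exact: bounded_measurable_integrable. Qed.

Lemma mean_indic A : measurable A -> mean \1_A = fine (P A).
Proof. by move=> mA; rewrite /mean /Rintegral integral_indic// setIT. Qed.

Lemma mean_sum (I : Type) (r : seq I) (Q : pred I) (F : I -> T -> R) :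
  (forall i, bounded_measurable (F i)) ->
  mean (fun x => \sum_(i <- r | Q i) F i x) = \sum_(i <- r | Q i) mean (F i).
Proof.
move=> H; elim: r => [|i r IH].
  under [X in mean X]funext => x do rewrite big_nil.
  by rewrite big_nil mean_cst.
under [X in mean X]funext => x do rewrite big_cons.
rewrite big_cons -IH; case: (Q i) => //.
by rewrite meanD//; exact: bounded_measurable_sum.
Qed.

Lemma le_mean f g : bounded_measurable f -> bounded_measurable g ->
  (forall x, f x <= g x) -> mean f <= mean g.
Proof.
by move=> mf mg fg; apply: le_Rintegral => //; exact: bounded_measurable_integrable.
Qed.

Lemma le_mean_on f g A : measurable A -> P A = 1%E ->
  bounded_measurable f -> bounded_measurable g ->
  (forall x, A x -> f x <= g x) -> mean f <= mean g.
Proof.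
move=> mA PA mf mg fg; rewrite -subr_ge0 -meanB//.
have [_ [B fB]] := mf; have [_ [C gC]] := mg.
have BC x : - (B + C) <= g x - f x.
  by have := fB x; have := gC x; rewrite !ler_norml => /andP[? ?] /andP[? ?]; lra.
have mAC : measurable (~` A) by exact: measurableC.
(* Compare with a function of mean zero that lies below [g - f] everywhere: it vanishes on [A] and
   equals [- (B + C)] on the null set off [A]. *)
have -> : 0 = mean (fun x => - (B + C) * \1_(~` A) x).
  rewrite meanZ; last exact: bounded_measurable_indic.
  by rewrite mean_indic// probability_setC// PA subee// mulr0.
apply: le_mean.
- by apply: bounded_measurableZ; exact: bounded_measurable_indic.
- exact: bounded_measurableB.
- move=> x; rewrite indicE; have [Ax|Ax] := pselect (A x).
    by rewrite memNset ?mulr0 ?subr_ge0 ?fg//= => /(_ Ax).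
  by rewrite mem_set// mulr1.
Qed.

Lemma eq_mean_on f g A : measurable A -> P A = 1%E ->
  bounded_measurable f -> bounded_measurable g ->
  (forall x, A x -> f x = g x) -> mean f = mean g.
Proof.
move=> mA PA mf mg fg; apply/eqP; rewrite eq_le.
by apply/andP; split; apply: (le_mean_on mA PA) => // x /fg ->.
Qed.

End Mean.

(** * Cylinder functions and cylinder events on pairs *)

Section Cylinders.
Variables (R : realType) (d : nat).
Local Notation pair := (config d * config d)%type.
Implicit Types (x y q : pair) (L : seq (site d)) (i : site d) (A : set pair).

Definition spin_pairs := [:: (false, false); (false, true); (true, false); (true, true)].

(** One representative for each pattern of pairs on a duplicate-free [L], with - spins elsewhere.
    The pattern [(true, false)] is included, so that functions are decomposed on all pairs and not
    only on ordered ones. *)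
Definition patterns L : seq pair :=
  foldr (fun i ps => flatten [seq [seq set_pair q i b | b <- spin_pairs] | q <- ps])
    [:: (@bot d, @bot d)] L.

(** Writes a cylindric function as a finite combination of indicators of events. Measurability,
    boundedness and every passage from probabilities of events to means of functions go through
    it. *)
Lemma patterns_sum L (F : pair -> R) x : uniq L -> cylindric L F ->
  F x = \sum_(q <- patterns L) (agree L x q)%:R * F q.
Proof.
elim: L F => [|i L IH] F /= => [_ cF|/andP[iL uL] cF].
  by rewrite big_seq1 mul1r; apply: cF.
set b0 := pair_at x i.
have Fx : F x = F (set_pair x i b0).
  apply: cF; apply/agreeP => j _; rewrite /set_pair /= /set_spin.
  by case: eqP => [->|].
have cFb : cylindric L (fun y => F (set_pair y i b0)).
  move=> y z yz; apply: cF; apply/agreeP => j; rewrite inE /set_pair /= /set_spin.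
  by case: eqP => //= ji jL; exact: (agreeP _ _ _ yz).
rewrite Fx (IH _ uL cFb) big_flatten/= big_map; apply: eq_bigr => q _.
have A b : agree L x (set_pair q i b) = agree L x q.
  apply/agreeP/agreeP => H j jL; have := H j jL; rewrite /set_pair/= /set_spin;
  by case: eqP => // ji; move: iL; rewrite -ji jL.
have E b : (pair_at x i == pair_at (set_pair q i b) i) = (b0 == b).
  by rewrite /pair_at /set_pair /set_spin /= eqxx; case: b.
rewrite /spin_pairs !big_cons big_nil /= !E -!/(agree L _ _) !A.
by case: b0 {Fx cFb E} => -[] [] /=; rewrite ?mul0r ?add0r ?addr0.
Qed.

Lemma measurable_spin1 i b : measurable [set x : pair | x.1 i = b].
Proof.
have -> : [set x : pair | x.1 i = b] = setT `&` fst @^-1` [set s : config d | s i = b].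
  by rewrite setTI.
apply: (@measurable_fst _ _ (config d) (config d)) => //.
by apply: sub_sigma_algebra; exists i, b.
Qed.

Lemma measurable_spin2 i b : measurable [set x : pair | x.2 i = b].
Proof.
have -> : [set x : pair | x.2 i = b] = setT `&` snd @^-1` [set s : config d | s i = b].
  by rewrite setTI.
apply: (@measurable_snd _ _ (config d) (config d)) => //.
by apply: sub_sigma_algebra; exists i, b.
Qed.

Lemma measurable_agree L q : measurable [set x : pair | agree L x q].
Proof.
elim: L => [|i L IH] /=; first by rewrite (_ : [set _ | _] = setT)//; apply/seteqP.
have -> : [set x : pair | (pair_at x i == pair_at q i) && agree L x q] =
   [set x : pair | x.1 i = q.1 i] `&` [set x : pair | x.2 i = q.2 i] `&`
   [set x : pair | agree L x q].
  apply/seteqP; split => [x /= /andP[/eqP[-> ->]]|x /= [[e1 e2] ->]] //.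
  by rewrite /pair_at e1 e2 eqxx.
by apply: measurableI => //; apply: measurableI;
  [exact: measurable_spin1|exact: measurable_spin2].
Qed.

Lemma cylindric_uniq L (f : pair -> R) : cylindric L f -> cylindric (undup L) f.
Proof. by apply: cylindric_sub => i; rewrite mem_undup. Qed.

Lemma cylindric_measurable L (f : pair -> R) : cylindric L f -> measurable_fun setT f.
Proof.
move=> /cylindric_uniq cf; have uL := undup_uniq L.
have -> : f = fun x => \sum_(q <- patterns (undup L))
    \1_[set x : pair | agree (undup L) x q] x * f q.
  apply/funext => x; rewrite (patterns_sum x uL cf).
  by apply: eq_bigr => q _; rewrite indicE mem_setE.
apply: measurable_sum => q; apply: measurable_funM => //.
by apply: measurable_indic; exact: measurable_agree.
Qed.

Lemma cylindric_bounded L (f : pair -> R) : cylindric L f ->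
  exists B, forall x, `|f x| <= B.
Proof.
move=> /cylindric_uniq cf; exists (\sum_(q <- patterns (undup L)) `|f q|) => x.
rewrite {1}(patterns_sum x (undup_uniq L) cf); apply: le_trans (ler_norm_sum _ _ _) _.
apply: ler_sum => q _; rewrite normrM; case: agree; rewrite ?normr1 ?normr0 ?mul1r ?mul0r//.
Qed.

Lemma cylindric_bounded_measurable L (f : pair -> R) :
  cylindric L f -> bounded_measurable f.
Proof.
by move=> cf; split; [exact: cylindric_measurable cf|exact: cylindric_bounded cf].
Qed.

Definition cylinder_set : set (set pair) :=
  [set A | exists L, forall x y, agree L x y -> A x -> A y].

Lemma agree_sym L x y : agree L x y = agree L y x.
Proof. by rewrite /agree; apply: eq_all => i; rewrite eq_sym. Qed.

Lemma cylinder_setI : setI_closed cylinder_set.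
Proof.
move=> A B [L HA] [L' HB]; exists (L ++ L') => x y; rewrite /agree all_cat.
by move=> /andP[a b] [Ax Bx]; split; [exact: HA a Ax|exact: HB b Bx].
Qed.

Lemma cylinder_indic A : cylinder_set A -> exists L, cylindric L (\1_A : pair -> R).
Proof.
move=> [L HL]; exists L => x y xy; rewrite !indicE; congr (nat_of_bool _)%:R.
by apply/idP/idP; rewrite !inE; apply: HL => //; rewrite agree_sym.
Qed.

Lemma cylinder_measurable A : cylinder_set A -> measurable A.
Proof.
move=> /cylinder_indic[L cL]; have := cylindric_measurable cL.
move=> /(_ measurableT [set 1] (measurable_set1 _)); rewrite setTI.
by congr measurable; apply/seteqP; split => x /=; rewrite indicE; have [xA|xA] := boolP (x \in A);
  move: xA; rewrite ?notin_setE ?inE//= => Ax /eqP; rewrite eq_sym oner_eq0.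
Qed.

(** Presents the product sigma-algebra as generated by a class closed under intersections, so that
    laws need only be compared on cylinder events. *)
Lemma pair_measurableE : @measurable _ pair = <<s cylinder_set >>.
Proof.
apply/seteqP; split => [A mA|]; last first.
  by apply: smallest_sub; [exact: sigma_algebra_measurable|exact: cylinder_measurable].
move: A mA; rewrite measurable_prod_measurableType; apply: smallest_sub.
  exact: smallest_sigma_algebra.
have S1 (B : set (config d)) : measurable B -> <<s cylinder_set >> (fst @^-1` B).
  move: B; apply: smallest_sub.
    split => [|B mB|F mF].
    - by rewrite preimage_set0; have [] := smallest_sigma_algebra setT cylinder_set.
    - have [_ H _] := smallest_sigma_algebra setT cylinder_set.
      by have := H _ mB; rewrite !setTD.
    - have [_ _ H] := smallest_sigma_algebra setT cylinder_set.
      by rewrite preimage_bigcup; apply: H.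
  move=> _ [i [b [_ ->]]]; apply: sub_sigma_algebra; exists [:: i] => x y /agreeP xy /= <-.
  by have [|-> _] := xy i; rewrite ?inE.
have S2 (B : set (config d)) : measurable B -> <<s cylinder_set >> (snd @^-1` B).
  move: B; apply: smallest_sub.
    split => [|B mB|F mF].
    - by rewrite preimage_set0; have [] := smallest_sigma_algebra setT cylinder_set.
    - have [_ H _] := smallest_sigma_algebra setT cylinder_set.
      by have := H _ mB; rewrite !setTD.
    - have [_ _ H] := smallest_sigma_algebra setT cylinder_set.
      by rewrite preimage_bigcup; apply: H.
  move=> _ [i [b [_ ->]]]; apply: sub_sigma_algebra; exists [:: i] => x y /agreeP xy /= <-.
  by have [|_ ->] := xy i; rewrite ?inE.
move=> _ [A mA [B mB <-]].
have -> : A `*` B = (fst @^-1` A) `&` (snd @^-1` B) by [].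
pose T' := g_sigma_algebraType cylinder_set.
exact: (@measurableI _ T' _ _ (S1 A mA) (S2 B mB)).
Qed.

Lemma measurable_ordered : measurable (@ordered d).
Proof.
pose S i := [set x : pair | x.1 i = false] `|` [set x : pair | x.2 i = true].
have -> : @ordered d = ~` \bigcup_i ~` S i.
  rewrite setC_bigcup; apply/seteqP; split => [x ox i _ /=|x H i].
    apply; have := ox i.
    by case E1: (x.1 i); case E2: (x.2 i) => //= _; [right|left|left].
  by have /notP[->|->] := H i I; [exact: le0x|exact: lex1].
apply: measurableC; apply: countable_bigcupT_measurable => [|i].
  exact: (countableP [set: 'rV[int]_d]).
by apply: measurableC; apply: measurableU; [exact: measurable_spin1|exact: measurable_spin2].
Qed.

End Cylinders.

Lemma fine_eq (R : realType) (x y : \bar R) :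
  x \is a fin_num -> y \is a fin_num -> fine x = fine y -> x = y.
Proof. by move=> fx fy; rewrite -{2}(fineK fx) -{2}(fineK fy) => ->. Qed.

Section Uniqueness.
Variables (R : realType) (d : nat).
Local Notation pair := (config d * config d)%type.

Lemma probability_cylinder_unique (nu nu' : probability pair R) :
  (forall B, cylinder_set B -> nu B = nu' B) ->
  forall A : set pair, measurable A -> nu A = nu' A.
Proof.
move=> H A mA; apply: (measure_unique (cylinder_set (d := d)) (fun=> setT)) => //.
- exact: pair_measurableE.
- exact: cylinder_setI.
- by move=> _; exists [::].
- by rewrite bigcup_const//; exists 0%N.
- by move=> _; apply: le_lt_trans (probability_le1 nu measurableT) (ltry _).
Qed.

Lemma probability_pair_unique (nu nu' : probability pair R) :
  (forall L (f : pair -> R), cylindric L f -> mean nu f = mean nu' f) ->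
  forall A : set pair, measurable A -> nu A = nu' A.
Proof.
move=> H; apply: probability_cylinder_unique => B cB.
have [L cL] := cylinder_indic R cB; have mB := cylinder_measurable R cB.
have := H L _ cL; rewrite !mean_indic//.
by apply: fine_eq; exact: fin_num_measure.
Qed.

End Uniqueness.

(** * Marked Poisson clocks *)

Section Independence.
Variables (R : realType) (dO : measure_display) (Omega : measurableType dO).
Variable P : probability Omega R.

(** The events independent of [E] form a Dynkin system. *)
Lemma indep_generated (G : set (set Omega)) (E : set Omega) :
  setI_closed G -> G `<=` measurable -> measurable E ->
  (forall A, G A -> P (A `&` E) = (P A * P E)%E) ->
  forall A, <<s G >> A -> P (A `&` E) = (P A * P E)%E.
Proof.
move=> GI Gm mE H.
have sGm : <<s G >> `<=` measurable.
  by apply: smallest_sub; [exact: sigma_algebra_measurable|].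
suff : <<s G >> `<=` [set A | measurable A /\ P (A `&` E) = (P A * P E)%E].
  by move=> sub A /sub[].
apply: lambda_system_subset => //; last by move=> A GA; split; [exact: Gm|exact: H].
apply/dynkin_lambda_system; split => /=.
- by rewrite setTI probability_setT mul1e.
- move=> S [mS PS]; split; first exact: measurableC.
  rewrite probability_setC// setIC -setDE measureD//; last first.
    by rewrite (le_lt_trans (probability_le1 P _))// ltry.
  rewrite (setIC E S) [X in (_ - X)%E]PS muleBl ?mul1e// ?fin_num_measure//.
- move=> F tF mF; have mF1 n : measurable (F n) by have [] := mF n.
  split; first exact: bigcupT_measurable.
  rewrite setI_bigcupl measure_bigcup//=; last 2 first.
  - by move=> k _; apply: measurableI.
  - exact: trivIset_setIr.
  rewrite [in RHS]measure_bigcup//= muleC -(fineK (fin_num_measure P E mE)) -nneseriesZl//=.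
  by apply: eq_eseriesr => k _; rewrite fineK ?fin_num_measure// muleC; have [] := mF k.
Qed.

Section Intersections.
Variables (I : choiceType) (G : I -> set (set Omega)).

(** A generating class for the join of the families [G a], closed under intersections when each
    [G a] is, and of the form to which mutual independence applies. *)
Definition finite_meets : set (set Omega) :=
  [set B | exists r (A : I -> set Omega), [/\ uniq r, forall a, G a (A a) &
     B = \bigcap_(a in [set` r]) A a]].

Lemma finite_meetsI : (forall a, setI_closed (G a)) -> (forall a, G a setT) ->
  setI_closed finite_meets.
Proof.
move=> GI GT _ _ [r [A [ur GA ->]]] [r' [A' [ur' GA' ->]]].
exists (undup (r ++ r')), (fun a => (if a \in r then A a else setT) `&`
                                    (if a \in r' then A' a else setT)).
split; first exact: undup_uniq.
  by move=> a; apply: GI; case: ifP.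
apply/seteqP; split => [w [Aw A'w] a _|w H]; first by
  split; case: ifP => // ar; [exact: Aw|exact: A'w].
split => a ar; have := H a; rewrite /= mem_undup mem_cat.
  by rewrite (_ : a \in r)// => -[].
by rewrite (_ : a \in r')// orbT => -[].
Qed.

Lemma finite_meets1 a B : (forall a, G a setT) -> G a B -> finite_meets B.
Proof.
move=> GT GB; exists [:: a], (fun a' => if a' == a then B else setT); split=> //.
  by move=> a'; case: eqP => // ->.
apply/seteqP; split => [w Bw a' /=|w /(_ a)]; first by case: eqP.
by rewrite /= inE eqxx => /(_ erefl).
Qed.

End Intersections.
End Independence.

Section Clocks.
Variables (R : realType) (d : nat) (dO : measure_display) (Omega : measurableType dO).
Variables (P : probability Omega R) (M : site d -> R).
Variables (N : site d -> R -> {RV P >-> nat}) (U : site d -> nat -> {RV P >-> R}).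
Hypothesis mc : marked_clocks M N U.
Hypothesis M0 : forall i, 0 < M i.
Local Notation index := (site d + site d * nat)%type.
Implicit Types (i j : site d) (n m k : nat) (s t : R).

Definition clock_events i (D : set R) : set (set Omega) :=
  <<s count_events (fun r => N i r : Omega -> nat) D >>.

Definition noise (a : index) : set (set Omega) :=
  match a with
  | inl i => clock_events i `[0, +oo[
  | inr (i, n) => preimage_set_system setT (U i n) measurable
  end.

Lemma clock_events_pair i (D : set R) s t (K : nat -> nat -> Prop) : D s -> D t ->
  clock_events i D [set w | K (N i s w) (N i t w)].
Proof.
move=> Ds Dt; pose C := count_events (fun r => N i r : Omega -> nat) D.
have -> : [set w | K (N i s w) (N i t w)] =
    \bigcup_k \bigcup_(l in [set l | K k l])
      ((N i s @^-1` [set k]) `&` (N i t @^-1` [set l])).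
  apply/seteqP; split => [w Kw|w [k _ [l /= Kkl [/= e1 e2]]]].
    by exists (N i s w) => //; exists (N i t w).
  by rewrite /= e1 e2.
apply: (@bigcupT_measurable _ (g_sigma_algebraType C)) => k.
apply: (@bigcup_measurable _ (g_sigma_algebraType C)) => l _.
by apply: (@measurableI _ (g_sigma_algebraType C)); apply: sub_sigma_algebra;
  [exists s, k|exists t, l].
Qed.

Lemma clock_events_measurable i (D : set R) : clock_events i D `<=` measurable.
Proof.
apply: smallest_sub; first exact: sigma_algebra_measurable.
by move=> _ [t [k [_ ->]]]; rewrite -[X in measurable X]setTI; exact: measurable_funP.
Qed.

Lemma clock_events_sub i (D D' : set R) : D `<=` D' -> clock_events i D `<=` clock_events i D'.
Proof.
move=> DD'; apply: sub_smallest2r; first exact: smallest_sigma_algebra.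
by move=> _ [t [k [Dt ->]]]; exists t, k; split => //; exact: DD'.
Qed.

Lemma clock_eventsI i D : setI_closed (clock_events i D).
Proof.
move=> A B; exact: (@measurableI _ (g_sigma_algebraType
  (count_events (fun r => N i r : Omega -> nat) D))).
Qed.

Lemma clock_eventsT i D : clock_events i D setT.
Proof.
exact: (@measurableT _ (g_sigma_algebraType
  (count_events (fun r => N i r : Omega -> nat) D))).
Qed.

Lemma noise_measurable a : noise a `<=` measurable.
Proof.
case: a => [i|[i n]]; first exact: clock_events_measurable.
by move=> _ [B mB <-]; exact: measurable_funP.
Qed.

Lemma noiseI a : setI_closed (noise a).
Proof.
case: a => [i|[i n]]; first exact: clock_eventsI.
move=> _ _ [A mA <-] [B mB <-]; exists (A `&` B); first exact: measurableI.
by rewrite !setTI preimage_setI.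
Qed.

Lemma noiseT a : noise a setT.
Proof.
case: a => [i|[i n]]; first exact: clock_eventsT.
by exists setT => //; rewrite setTI.
Qed.

Definition rang i s t : set Omega := [set w | (N i s w < N i t w)%N].

Definition rang_twice i s t : set Omega := [set w | ((N i s w).+1 < N i t w)%N].

Lemma rang_clock_events i s t : 0 <= s -> 0 <= t ->
  clock_events i `[0, +oo[ (rang i s t).
Proof.
move=> s0 t0; apply: (@clock_events_pair i _ s t (fun k l => (k < l)%N)) => /=;
by rewrite in_itv/= andbT.
Qed.

Lemma rang_measurable i s t : 0 <= s -> 0 <= t -> measurable (rang i s t).
Proof. by move=> s0 t0; apply: clock_events_measurable; exact: rang_clock_events. Qed.

Lemma rang_twice_measurable i s t : 0 <= s -> 0 <= t -> measurable (rang_twice i s t).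
Proof.
move=> s0 t0; apply: (@clock_events_measurable i `[0, +oo[).
apply: (@clock_events_pair i _ s t (fun k l => (k.+1 < l)%N)) => /=;
by rewrite in_itv/= andbT.
Qed.

Let pc i : poisson_clock (M i) (N i). Proof. by case: mc. Qed.

Let increment_eq i s t k : set Omega := [set w | (N i t w - N i s w)%N = k].

Let rangE i s t : rang i s t = ~` increment_eq i s t 0.
Proof.
apply/seteqP; split => w /=; rewrite /rang /increment_eq /=.
  by rewrite -subn_gt0 => H H0; rewrite H0 in H.
by move=> /eqP; rewrite -lt0n subn_gt0.
Qed.

Let increment_measurable i s t k : 0 <= s -> 0 <= t -> measurable (increment_eq i s t k).
Proof.
move=> s0 t0; apply: (@clock_events_measurable i `[0, +oo[).
apply: (@clock_events_pair i _ s t (fun m l => (l - m)%N = k)) => /=;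
by rewrite in_itv/= andbT.
Qed.

Lemma rang_indep i s t A : 0 <= s -> s < t -> clock_events i `[0, s] A ->
  P (A `&` rang i s t) = (P A * P (rang i s t))%E.
Proof.
move=> s0 st HA; have mA := clock_events_measurable HA.
have t0 : 0 <= t by apply: le_trans (ltW st).
have mI := increment_measurable i 0 s0 t0.
have [_ _ _ _ /(_ s t 0%N A s0 st HA)] := pc i; rewrite -/(increment_eq i s t 0) => H.
rewrite rangE -setDE measureD//; last first.
  by rewrite (le_lt_trans (probability_le1 P _))// ltry.
rewrite [X in (_ - X)%E]H probability_setC// muleBr ?mule1// ?fin_num_measure//.
Qed.

Lemma prob_rang i s t : 0 <= s -> s < t ->
  P (rang i s t) = (1 - expR (- (M i * (t - s))))%:E.
Proof.
move=> s0 st; have t0 : 0 <= t by apply: le_trans (ltW st).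
rewrite rangE probability_setC; last exact: increment_measurable.
have [_ _ _ /(_ s t 0%N s0 st) + _] := pc i; rewrite -/(increment_eq i s t 0) => ->.
rewrite /poisson_pmf mulr_gt0 ?subr_gt0//.
by rewrite expr0 fact0 invr1 !mul1r.
Qed.

Lemma prob_rang_twice i s t : 0 <= s -> s < t ->
  fine (P (rang_twice i s t)) <= (M i * (t - s)) ^+ 2.
Proof.
move=> s0 st; have t0 : 0 <= t by apply: le_trans (ltW st).
have m0 := increment_measurable i 0 s0 t0; have m1 := increment_measurable i 1 s0 t0.
have -> : rang_twice i s t = ~` (increment_eq i s t 0 `|` increment_eq i s t 1).
  apply/seteqP; split => w /=; rewrite /rang_twice /increment_eq /=.
    by move=> H; case=> E; move: H; rewrite -subn_gt0 subnS E.
  move=> H; rewrite ltnNge; apply/negP; rewrite -ltnS => H2; apply: H.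
  have : (N i t w - N i s w < 2)%N by rewrite ltnS leq_subLR addn1 -ltnS.
  by case: (_ - _)%N => [|[|]]//; [left|right].
have l0 : 0 < M i * (t - s) by rewrite mulr_gt0 ?subr_gt0.
have [_ _ _ H _] := pc i.
have H0 : P (increment_eq i s t 0) = _ := H s t 0%N s0 st.
have H1 : P (increment_eq i s t 1) = _ := H s t 1%N s0 st.
have PU : P (increment_eq i s t 0 `|` increment_eq i s t 1) =
    ((poisson_pmf (M i * (t - s)) 0)%:E + (poisson_pmf (M i * (t - s)) 1)%:E)%E.
  rewrite -H0 -H1; apply: measureU => //.
  by apply/seteqP; split => // w [/= ]; rewrite /increment_eq /= => ->.
rewrite probability_setC ?PU; last exact: measurableU.
rewrite /poisson_pmf l0 /= expr0 (_ : 1`! = 1%N)// fact0 !invr1 expr1 !mul1r mulr1.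
(* The probability of at least two rings is [1 - (1 + l) expR (- l)], and [expR (- l) >= 1 - l]
   bounds it by [1 - (1 + l) (1 - l) = l ^ 2]. *)
move: (M i * (t - s)) l0 => l l0; have := expR_ge1Dx (- l).
nra.
Qed.

Lemma rang_pair_indep i j s t : i != j -> 0 <= s -> s < t ->
  P (rang i s t `&` rang j s t) = (P (rang i s t) * P (rang j s t))%E.
Proof.
move=> ij s0 st; have t0 : 0 <= t by apply: le_trans (ltW st).
have [_ _ /(_ [:: inl i; inl j] (fun a => match a with inl k => rang k s t | _ => setT end))] := mc.
rewrite !big_cons big_nil mule1 => <-.
- congr (P _); apply/seteqP; split => [w [wi wj] [k|//] |w H].
    by rewrite /= !inE => /orP[/eqP[->]|/eqP[->]].
  by split; [apply: (H (inl i))|apply: (H (inl j))]; rewrite /= !inE eqxx ?orbT.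
- by rewrite /= inE andbT; apply: contra ij => /eqP[->].
- by move=> [k|kn]; rewrite !inE//= => _; exact: rang_clock_events.
Qed.

(** On the event [N i t = n] the history up to [t] lies in the join of these families: clock [i] up
    to [t], all other clocks at all times, all marks but number [n + 1] at [i]. The join is larger
    than the history, yet still independent of the next increment of clock [i] and of the mark left
    out. *)
Definition past i n t (a : index) : set (set Omega) :=
  match a with
  | inl j => if j == i then clock_events i `[0, t] else noise (inl j)
  | inr jm => if jm == (i, n.+1) then [set setT] else noise (inr jm)
  end.

Lemma past_noise i n t a : past i n t a `<=` noise a.
Proof.
case: a => [j|jm] /=.
  case: (j =P i) => [->|_] //; apply: clock_events_sub => r /=.
  by rewrite !in_itv/= => /andP[-> _].
by case: (jm =P _) => [_ _ ->|_] //; exact: (@noiseT (inr jm)).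
Qed.

Lemma pastT i n t a : past i n t a setT.
Proof.
case: a => [j|jm] /=; case: eqP => // _; [exact: clock_eventsT|exact: clock_eventsT|].
exact: (@noiseT (inr jm)).
Qed.

Lemma pastI i n t a : setI_closed (past i n t a).
Proof.
case: a => [j|jm] /=; case: eqP => _; [exact: clock_eventsI|exact: clock_eventsI| |].
  by move=> A B -> ->; rewrite setTI.
exact: (@noiseI (inr jm)).
Qed.

Lemma past_measurable i n t : finite_meets (past i n t) `<=` measurable.
Proof.
move=> _ [r [A [_ HA ->]]]; rewrite bigcap_seq; apply: bigsetI_measurable => a _.
exact: noise_measurable (past_noise (HA a)).
Qed.

Let mark_measurable i n (V : set R) : measurable V -> measurable (U i n @^-1` V).
Proof. by move=> mV; apply: (@noise_measurable (inr (i, n))); exists V; rewrite ?setTI. Qed.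

(** Events are regrouped by source of noise. Mutual independence separates the sources; within clock
    [i], the past and the next increment are separated by the independence of Poisson increments. *)
Lemma past_meets_indep i n t t' (V : set R) A : 0 <= t -> t < t' -> measurable V ->
  finite_meets (past i n t) A ->
  P (A `&` (rang i t t' `&` (U i n.+1 @^-1` V))) =
  (P A * (P (rang i t t') * P (U i n.+1 @^-1` V)))%E.
Proof.
move=> t0 tt' mV [r [A0 [ur pA ->]]]; set ai : index := inl i; set an : index := inr (i, n.+1).
have t'0 : 0 <= t' by apply: le_trans (ltW tt').
pose B a := if a \in r then A0 a else setT.
have pB a : past i n t a (B a) by rewrite /B; case: ifP => // _; exact: pastT.
have Ban : B an = setT by have := pB an; rewrite /= eqxx.
have Bai : clock_events i `[0, t] (B ai) by have := pB ai; rewrite /= eqxx.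
pose rest := [seq a <- r | (a != ai) && (a != an)].
have ur' : uniq [:: ai, an & rest].
  by rewrite /= inE !mem_filter !eqxx /= ?andbF /= filter_uniq.
have [_ _ indep] := mc.
have E0 : \bigcap_(a in [set` r]) A0 a = \bigcap_(a in [set` [:: ai, an & rest]]) B a.
  apply/seteqP; split => [w H a _|w H a /= ar]; first by
    rewrite /B; case: ifP => // ar; exact: H.
  have := H a; rewrite /B ar; apply; rewrite /= !inE mem_filter ar andbT.
  by case: (a == ai); case: (a == an).
have E1 := indep [:: ai, an & rest] B ur' (fun a _ => past_noise (pB a)).
pose C a := if a == ai then B ai `&` rang i t t' else
            if a == an then U i n.+1 @^-1` V else B a.
have nC a : noise a (C a).
  rewrite /C; case: eqP => [->|_].
    apply: noiseI; first exact: past_noise (pB ai).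
    exact: rang_clock_events.
  case: eqP => [->|_]; last exact: past_noise (pB a).
  by exists V => //; rewrite setTI.
have E2 := indep [:: ai, an & rest] C ur' (fun a _ => nC a).
have E3 : \bigcap_(a in [set` r]) A0 a `&` (rang i t t' `&` (U i n.+1 @^-1` V)) =
    \bigcap_(a in [set` [:: ai, an & rest]]) C a.
  rewrite E0; apply/seteqP; split => [w [H [rw Uw]] a ar|w H].
    rewrite /C; case: eqP => [_|_]; first by split => //; apply: H; rewrite /= inE eqxx.
    by case: eqP => [//|_]; exact: H.
  have Hai := H ai; have Han := H an; rewrite /C /= !eqxx in Hai Han.
  have [|Bw rw] := Hai; first by rewrite inE eqxx.
  have Uw := Han; rewrite /= !inE eqxx orbT in Uw.
  split; last by split => //; apply: Uw.
  move=> a ar; have := H a ar; rewrite /C; case: eqP => [->//|_].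
  by case: eqP => [->|//]; rewrite Ban.
have Er : (\prod_(a <- rest) P (C a) = \prod_(a <- rest) P (B a))%E.
  apply: eq_big_seq => a; rewrite mem_filter => /andP[/andP[/negbTE a1 /negbTE a2] _].
  by rewrite /C a1 a2.
have Cai : C ai = B ai `&` rang i t t' by rewrite /C eqxx.
have Can : C an = U i n.+1 @^-1` V by rewrite /C eqxx.
rewrite E3 E2 E0 E1 !big_cons Er Cai Can Ban probability_setT mul1e.
rewrite (rang_indep t0 tt' Bai).
by rewrite [in LHS](muleC (P (U i n.+1 @^-1` V))) muleACA.
Qed.

Lemma past_indep i n t t' (V : set R) A : 0 <= t -> t < t' -> measurable V ->
  <<s finite_meets (past i n t) >> A ->
  P (A `&` (rang i t t' `&` (U i n.+1 @^-1` V))) =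
  (P A * (P (rang i t t') * P (U i n.+1 @^-1` V)))%E.
Proof.
move=> t0 tt' mV HA; have t'0 : 0 <= t' by apply: le_trans (ltW tt').
have E : P (rang i t t' `&` (U i n.+1 @^-1` V)) = (P (rang i t t') * P (U i n.+1 @^-1` V))%E.
  have := @past_meets_indep i n t t' V setT t0 tt' mV; rewrite setTI probability_setT mul1e.
  by apply; apply: (@finite_meets1 _ _ _ _ (inl i)); [exact: pastT|exact: pastT].
rewrite -E; apply: indep_generated HA.
- by apply: finite_meetsI; [exact: pastI|exact: pastT].
- exact: past_measurable.
- by apply: measurableI; [exact: rang_measurable|exact: mark_measurable].
- by move=> B HB; rewrite E; exact: past_meets_indep.
Qed.

Local Notation hist := (history (fun i t => N i t : Omega -> nat)
          (fun i n => U i n : Omega -> R)).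

Lemma history_past i n t A : 0 <= t -> hist t A ->
  <<s finite_meets (past i n t) >> (A `&` [set w | N i t w = n]).
Proof.
move=> t0; pose T' := g_sigma_algebraType (finite_meets (past i n t)).
have gen a B : past i n t a B -> <<s finite_meets (past i n t) >> B.
  by move=> H; apply: sub_sigma_algebra; apply: finite_meets1 H; exact: pastT.
have tt : `[0, t]%classic t by rewrite /= in_itv/= t0 lexx.
have mE : <<s finite_meets (past i n t) >> [set w | N i t w = n].
  apply: (gen (inl i)); rewrite /= eqxx.
  exact: (@clock_events_pair i _ t t (fun k _ => k = n)).
move: A; apply: smallest_sub.
  split => [|B HB|F HF].
  - rewrite set0I; exact: (@measurable0 _ T').
  - have -> : (setT `\` B) `&` [set w | N i t w = n] =
       [set w | N i t w = n] `\` (B `&` [set w | N i t w = n]).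
      by rewrite setTD setDE setCI setIUr setICr setU0 setIC.
    exact: (@measurableD _ T').
  - rewrite setI_bigcupl; exact: (@bigcupT_measurable _ T').
have cl j (K : nat -> Prop) : past i n t (inl j) [set w | K (N j t w)].
  rewrite /=; case: eqP => [->|_].
    exact: (@clock_events_pair i _ t t (fun k _ => K k)).
  by apply: (@clock_events_pair j _ t t (fun k _ => K k)); rewrite /= in_itv/= t0.
move=> B [[j [s [k [st ->]]]]|[j [m [V [mV ->]]]]].
  apply: (@measurableI _ T') => //; apply: (gen (inl j)).
  rewrite /=; case: eqP => [->|_]; first exact: (@clock_events_pair i _ s s (fun l _ => l = k)).
  apply: (@clock_events_pair j _ s s (fun l _ => l = k)) => /=;
  by move: st; rewrite /= !in_itv/= => /andP[-> _].
(* The omitted mark is visible in the history only after ring [n + 1] of clock [i], which is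
   impossible on [N i t = n]. *)
have [jm|jm] := eqVneq (j, m) (i, n.+1).
  have -> : [set w | (0 < m <= N j t w)%N /\ V (U j m w)] `&` [set w | N i t w = n] = set0.
    case: jm => -> ->; apply/seteqP; split => // w /= [[+ _] e].
    by rewrite e ltnn.
  exact: (@measurable0 _ T').
have -> : [set w | (0 < m <= N j t w)%N /\ V (U j m w)] =
  [set w | (0 < m <= N j t w)%N] `&` (U j m @^-1` V) by [].
apply: (@measurableI _ T') => //; apply: (@measurableI _ T').
  exact: gen (cl j (fun k => (0 < m <= k)%N)).
apply: (gen (inr (j, m))); rewrite /= (negbTE jm).
by exists V => //; rewrite setTI.
Qed.

Lemma history_measurable t A : hist t A -> 0 <= t -> measurable A.
Proof.
move=> HA t0; have -> : A = \bigcup_n (A `&` [set w | N 0 t w = n]).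
  by apply/seteqP; split => [w Aw|w [n _ []]//]; exists (N 0 t w).
apply: bigcupT_measurable => n.
have := @history_past 0 n t A t0 HA; apply: smallest_sub; first exact: sigma_algebra_measurable.
exact: past_measurable.
Qed.

(** The next mark has the random index [N i t + 1]; partitioning by the value of [N i t] reduces to
    a fixed index. *)
Lemma next_mark_indep i t t' (V : set R) A : 0 <= t -> t < t' -> measurable V ->
  hist t A ->
  P (A `&` (rang i t t' `&` [set w | V (U i (N i t w).+1 w)])) =
  (P A * (P (rang i t t') * uniform_prob (@ltr01 R) V))%E.
Proof.
move=> t0 tt' mV HA; have t'0 : 0 <= t' by apply: le_trans (ltW tt').
have mA := history_measurable HA t0.
pose F n := (A `&` [set w | N i t w = n]).
have mEn n : measurable [set w | N i t w = n].
  apply: (@clock_events_measurable i `[0, +oo[).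
  by apply: (@clock_events_pair i _ t t (fun k _ => k = n)); rewrite /= in_itv/= t0.
have mF n : measurable (F n) by exact: measurableI.
have tF : trivIset setT F.
  by move=> k l _ _ [w [[_ /= <-] [_ /= <-]]].
have AF : A = \bigcup_n F n.
  by apply/seteqP; split => [w Aw|w [n _ []]//]; exists (N i t w).
pose E := rang i t t' `&` [set w | V (U i (N i t w).+1 w)]; rewrite -/E.
pose E' n := rang i t t' `&` (U i n.+1 @^-1` V).
have mE' n : measurable (E' n).
  by apply: measurableI; [exact: rang_measurable|exact: mark_measurable].
have FE n : F n `&` E = F n `&` E' n.
  by apply/seteqP; split => w [[Aw e] [rw Vw]]; split => //; split => //; move: Vw; rewrite /= e.
have -> : A `&` E = \bigcup_n (F n `&` E' n).
  rewrite {1}AF setI_bigcupl; apply: eq_bigcupr => n _; exact: FE.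
rewrite measure_bigcup//=; last 2 first.
- by move=> n _; exact: measurableI.
- by move=> k l _ _ [w [[[_ /= <-] _] [[_ /= <-] _]]].
have [_ hU _] := mc.
have H n : (P (F n `&` E' n) = P (F n) * (P (rang i t t') * uniform_prob (@ltr01 R) V))%E.
  by rewrite -(hU i n.+1 V mV); apply: past_indep => //; exact: history_past.
have fc : (P (rang i t t') * uniform_prob (@ltr01 R) V)%E \is a fin_num.
  by rewrite fin_numM// fin_num_measure//; exact: rang_measurable.
rewrite [in RHS]AF measure_bigcup//= muleC -(fineK fc) -nneseriesZl//.
  by apply: eq_eseriesr => n _; rewrite H muleC fineK.
Qed.

End Clocks.

(** * One short step of the dynamics *)

Section Path.
Variables (R : realType) (d : nat).
Local Notation pair := (config d * config d)%type.
Variables (dO : measure_display) (Om : measurableType dO).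
Variables (q : site d -> pair -> bool * bool -> R).
Variables (N : site d -> R -> Om -> nat) (U : site d -> nat -> Om -> R).
Variables (x : pair) (Y : R -> Om -> pair) (w : Om).
Hypothesis N_mono : forall i (s t : R), 0 <= s -> s <= t -> (N i s w <= N i t w)%N.
Hypothesis N_right : forall i (t : R), 0 <= t -> \forall s \near t^'+, N i s w = N i t w.
Hypothesis path : glauber_path q N U x Y w.
Hypothesis ox : ordered x.
Implicit Types (i j : site d) (k : nat) (s t r : R).

(** The infimum of the times at which the count is at least [k] is attained, by right continuity. *)
Lemma first_passage i s t k : 0 <= s -> s <= t -> (N i s w < k <= N i t w)%N ->
  exists tau, [/\ s < tau, tau <= t, (k <= N i tau w)%N &
    forall r, 0 <= r -> r < tau -> (N i r w < k)%N].
Proof.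
move=> s0 st /andP[sk kt]; have t0 : 0 <= t by apply: le_trans st.
pose S := [set r | 0 <= r /\ (k <= N i r w)%N].
have hS : has_inf S by split; [exists t|exists 0 => r [r0 _]].
have i0 : 0 <= inf S by apply: lb_le_inf; [exists t|move=> r []].
have before r : 0 <= r -> r < inf S -> (N i r w < k)%N.
  move=> r0 ri; rewrite ltnNge; apply/negP => kr.
  by have := ge_inf hS.2 (conj r0 kr); rewrite leNgt ri.
have kinf : (k <= N i (inf S) w)%N.
  have /nbhs_ballP[e e0 He] := N_right i i0.
  have [r [r0 kr] re] := inf_adherent e0 hS.
  have := ge_inf hS.2 (conj r0 kr); rewrite le_eqVlt => /orP[/eqP -> //|ir].
  rewrite -(He r)//=; rewrite /ball/= distrC ltr_norml; apply/andP; split; lra.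
exists (inf S); split => //.
- rewrite ltNge; apply/negP => is_; have := N_mono i i0 is_.
  by rewrite leqNgt (leq_trans sk kinf).
- by have := ge_inf hS.2 (conj t0 kt).
Qed.

(** Each site is eventually constant before [t], but no interval serves all sites at once; the limit
    is assembled coordinate by coordinate. *)
Lemma left_limit_exists t : 0 < t -> exists y,
  [/\ left_limit (fun s => Y s w) t y,
      forall i s, 0 <= s -> s < t -> (forall r, s <= r -> r < t -> N i r w = N i s w) ->
        pair_at y i = pair_at (Y s w) i &
      forall i, exists2 s, 0 <= s < t & pair_at y i = pair_at (Y s w) i].
Proof.
move=> t0; have [_ const _] := path.
have H i : exists s, 0 <= s < t /\ forall r, s <= r -> r < t -> N i r w = N i s w.
  (* Take the largest value that the count attains before [t]: the count is constant from then
     on. *)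
  pose V k := `[< exists s, 0 <= s < t /\ N i s w = k >].
  have V0 : exists k, V k by exists (N i 0 w); apply/asboolP; exists 0; rewrite lexx.
  have Vb k : V k -> (k <= N i t w)%N.
    by move=> /asboolP[s [/andP[s0 st] <-]]; apply: N_mono => //; exact: ltW.
  case: (ex_maxnP V0 Vb) => k /asboolP[s [/andP[s0 st] e]] max.
  exists s; rewrite s0 st; split => // r sr rt; apply/eqP; rewrite eqn_leq (N_mono i s0 sr) andbT.
  rewrite e; apply: max; apply/asboolP; exists r; rewrite rt andbT; split => //.
  exact: le_trans sr.
have [S HS] := choice H.
have lim i : \forall s \near t^'-, pair_at (Y s w) i = pair_at (Y (S i) w) i.
  have [/andP[s0 st] e] := HS i; near=> s.
  have Ss : S i < s by near: s; exact: nbhs_left_gt.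
  have ts : s < t by near: s; exact: nbhs_left_lt.
  by apply: const => //; [exact: ltW|rewrite e// ltW].
exists (fun i => (Y (S i) w).1 i, fun i => (Y (S i) w).2 i).
split => [i|i s s0 st e|i]; first exact: lim.
  have [/andP[S0 St] eS] := HS i; rewrite -[LHS]/(pair_at (Y (S i) w) i).
  pose m := Num.max s (S i).
  have ms : s <= m by rewrite le_max lexx.
  have mS : S i <= m by rewrite le_max lexx orbT.
  have mt : m < t by rewrite gt_max st.
  rewrite -(const i s m s0 ms) ?e//.
  by rewrite -(const i (S i) m S0 mS) ?eS.
by exists (S i) => //; have [] := HS i.
Unshelve. all: by end_near.
Qed.

Lemma draw_ordered (p : bool * bool -> R) u : ((draw p u).1 <= (draw p u).2)%O.
Proof. by rewrite /draw; case: ifP => //; case: ifP. Qed.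

(** The pair at a site dates from the start or from the last ring there, and every [draw] yields an
    ordered pair. Hence there is no induction over the rings, which are not well ordered across
    sites. *)
Lemma ordered_path t : 0 <= t -> ordered (Y t w).
Proof.
move=> t0; have [Y0 const jump] := path; move=> i.
have E (y z : pair) : pair_at y i = pair_at z i -> (y.1 i <= y.2 i)%O = (z.1 i <= z.2 i)%O.
  by rewrite /pair_at => -[-> ->].
have := N_mono i (lexx 0) t0; rewrite leq_eqVlt => /orP[/eqP e|lt].
  rewrite (E _ x) ?ox// -Y0; exact: const.
have [|tau [tau0 taut ktau before]] := @first_passage i 0 t (N i t w) (lexx 0) t0.
  by rewrite lt leqnn.
have etau : N i tau w = N i t w.
  by apply/eqP; rewrite eqn_leq ktau andbT N_mono// ltW.
have [y [ly _ _]] := left_limit_exists tau0.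
have rg : rings (N i) tau w by split => // r r0 rt; rewrite etau; exact: before.
rewrite (E _ (Y tau w)); last by apply: const => //; exact: ltW.
have := jump i tau y rg ly; rewrite /pair_at.
by case: (draw _ _) (draw_ordered (q i y) (U i (N i tau w) w)) => ? ? /= ? [-> ->].
Qed.

(** [y] is the left limit at the ring. It agrees with the state at time [t] at [i] and at the silent
    sites; of the others, only that they are ordered is known. *)
Lemma one_ring i t t' : 0 <= t -> t < t' -> N i t' w = (N i t w).+1 -> exists y,
  [/\ ordered y, pair_at y i = pair_at (Y t w) i,
      forall j, N j t' w = N j t w -> pair_at y j = pair_at (Y t w) j &
      pair_at (Y t' w) i = draw (q i y) (U i (N i t w).+1 w)].
Proof.
move=> t0 tt' e; have [Y0 const jump] := path.
have [|tau [ttau taut' ktau before]] := @first_passage i t t' (N i t w).+1 t0 (ltW tt').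
  by rewrite e !leqnn.
have tau0 : 0 < tau by apply: le_lt_trans ttau.
have etau : N i tau w = (N i t w).+1.
  by apply/eqP; rewrite eqn_leq ktau andbT -e N_mono// ltW.
have [y [ly yconst ysome]] := left_limit_exists tau0.
exists y; split.
- move=> j; have [s /andP[s0 _]] := ysome j; rewrite /pair_at => -[-> ->].
  exact: ordered_path.
- apply: yconst => // r tr rtau; apply/eqP; rewrite eqn_leq -ltnS before ?N_mono//.
  exact: le_trans tr.
- move=> j ej; apply: yconst => // r tr rtau; apply/eqP.
  rewrite eqn_leq -{1}ej !N_mono//; first exact: le_trans tr.
  by rewrite ltW// (lt_le_trans rtau).
- have rg : rings (N i) tau w.
    by split => // r r0 rt; rewrite etau ltnS -ltnS; exact: before.
  rewrite -etau -(jump i tau y rg ly); apply: const => //; first exact: ltW.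
  by rewrite etau e.
Qed.

End Path.

(** [c] is the boundary spin: upper bounds go with the boundary +, lower bounds with the boundary -.
    With the sign [sg] for the error terms, both halves are proved at once. *)
Definition lec (R : realType) (c : bool) (x y : R) := if c then x <= y else y <= x.

Definition sg (R : realType) (c : bool) : R := if c then 1 else -1.

Lemma lecP (R : realType) (c : bool) (x y : R) : lec c x y <-> sg R c * x <= sg R c * y.
Proof. by case: c; rewrite /lec /= ?mul1r// !mulN1r lerN2. Qed.

Lemma indic_bool (R : realType) (T : Type) (B : T -> bool) w :
  \1_[set v | B v] w = (B w)%:R :> R.
Proof. by rewrite indicE; congr (_%:R); congr nat_of_bool; apply/idP/idP; rewrite inE. Qed.

Lemma uniform_prob_lt (R : realType) (v : R) : 0 <= v <= 1 ->
  uniform_prob (@ltr01 R) [set u | u < v] = v%:E.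
Proof.
move=> /andP[v0 v1]; rewrite /uniform_prob integral_uniform_pdf.
have -> : [set u : R | u < v] `&` `[0, 1] = `[0, v[%classic.
  apply/seteqP; split => u /=; rewrite !in_itv/=; first by move=> [-> /andP[->]].
  by move=> /andP[u0 uv]; split => //; rewrite u0/=; lra.
rewrite (eq_integral (fun=> 1%:E)); last first.
  move=> u; rewrite inE/= in_itv/= => /andP[u0 uv].
  by rewrite /uniform_pdf u0 /= subr0 invr1 ifT//; lra.
rewrite integral_cst//= lebesgue_measure_itv/= lte_fin mul1e.
case: ifPn => [_|]; first by rewrite sube0.
by rewrite -leNgt => v0'; congr EFin; lra.
Qed.

(** * The one-step estimate for increasing functions *)

Section OneStep.
Variables (R : realType) (d : nat) (dO : measure_display) (Omega : measurableType dO).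
Local Notation pair := (config d * config d)%type.
Variables (P : probability Omega R) (M : site d -> R).
Variables (N : site d -> R -> {RV P >-> nat}) (U : site d -> nat -> {RV P >-> R}).
Variables (a b : site d -> config d -> R) (q : site d -> pair -> bool * bool -> R).
Hypothesis mc : marked_clocks M N U.
Hypothesis M0 : forall i, 0 < M i.
Hypotheses (aA : attractive a) (bA : attractive b) (ab : dominated a b).
Hypothesis q_draw : forall i y u, ordered y -> draw (q i y) u = (u < a i y.1, u < b i y.2).
Variables (x : pair) (Y : R -> Omega -> pair).
Hypothesis ox : ordered x.
Local Notation N' := (fun i t => N i t : Omega -> nat).
Local Notation U' := (fun i n => U i n : Omega -> R).
Hypothesis Y_path : \forall w \ae P, glauber_path q N' U' x Y w.
Hypothesis Y_adapted : forall (t : R) (A : set pair), 0 <= t -> measurable A ->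
  history N' U' t (Y t @^-1` A).
Implicit Types (i j : site d) (t h : R) (L : seq (site d)) (f : pair -> R) (w : Omega).

Let N_mono w i (s t : R) : 0 <= s -> s <= t -> (N i s w <= N i t w)%N.
Proof. by have [/(_ i)[_ H _ _ _] _ _] := mc; exact: H. Qed.

Let N_right w i t : 0 <= t -> \forall s \near t^'+, N i s w = N i t w.
Proof. by have [/(_ i)[_ _ H _ _] _ _] := mc; exact: H. Qed.

Let rung i t t' : Omega -> R := \1_(rang N i t t').

Let mark i t w : R := U i (N i t w).+1 w.

Let drawn L c i t w : bool * bool :=
  (mark i t w < a i (extend L c (Y t w).1), mark i t w < b i (extend L c (Y t w).2)).

Let jump L c f i t w : R := f (set_pair (Y t w) i (drawn L c i t w)) - f (Y t w).

(** A random variable that is at least 1 as soon as two rings occur in [L] between [t] and [t'], and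
    whose mean is of second order in [t' - t]. *)
Let bad L t t' w : R := \sum_(i <- L) \1_(rang_twice N i t t') w +
  \sum_(i <- L) \sum_(j <- L | j != i) rung i t t' w * rung j t t' w.

Let indic_ge0 (A : set Omega) w : 0 <= (\1_A w : R).
Proof. by rewrite indicE; case: (_ \in _). Qed.

Let rungE i t t' w : rung i t t' w = (N i t w < N i t' w)%N%:R.
Proof. by rewrite /rung indicE mem_setE. Qed.

Let bad_terms_ge0 L t t' w :
  0 <= \sum_(i <- L) \1_(rang_twice N i t t') w :> R /\
  0 <= \sum_(i <- L) \sum_(j <- L | j != i) rung i t t' w * rung j t t' w.
Proof.
split; first by apply: sumr_ge0.
by apply: sumr_ge0 => i _; apply: sumr_ge0 => j _; rewrite mulr_ge0.
Qed.

Let bad_twice L t t' w i : i \in L -> ((N i t w).+1 < N i t' w)%N -> 1 <= bad L t t' w.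
Proof.
move=> iL H; have [_ b2] := bad_terms_ge0 L t t' w.
rewrite /bad (big_rem i iL)/= indicE mem_set//=.
have : 0 <= \sum_(y <- rem i L) \1_(rang_twice N y t t') w :> R by apply: sumr_ge0.
lra.
Qed.

Let bad_two L t t' w i j : i \in L -> j \in L -> j != i ->
  (N i t w < N i t' w)%N -> (N j t w < N j t' w)%N -> 1 <= bad L t t' w.
Proof.
move=> iL jL ji Hi Hj; have [b1 _] := bad_terms_ge0 L t t' w.
have : 1 <= \sum_(i <- L) \sum_(j <- L | j != i) rung i t t' w * rung j t t' w.
  rewrite (big_rem i iL)/= (big_rem j jL)/= ji !rungE Hi Hj mulr1.
  rewrite -addrA lerDl addr_ge0//.
    by apply: sumr_ge0 => k _; rewrite mulr_ge0 ?ler0n.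
  by apply: sumr_ge0 => k _; apply: sumr_ge0 => l _; rewrite mulr_ge0.
rewrite /bad; lra.
Qed.

Lemma one_step_path c L f (B : R) t t' w : uniq L -> nondecr f -> cylindric L f ->
  (forall y, ordered y -> `|f y| <= B) -> 0 <= t -> t < t' -> glauber_path q N' U' x Y w ->
  lec c (f (Y t' w)) (f (Y t w) + \sum_(i <- L) rung i t t' w * jump L c f i t w
     + sg R c * ((2 + 2 * (size L)%:R) * B * bad L t t' w)).
Proof.
move=> uL nf cf fB t0 tt' pw; have t'0 : 0 <= t' by apply: le_trans (ltW tt').
have B0 : 0 <= B by apply: le_trans (fB x ox).
have oY := ordered_path (N_mono w) (N_right w) pw ox t0.
have oY' := ordered_path (N_mono w) (N_right w) pw ox t'0.
have Dc i : ((drawn L c i t w).1 <= (drawn L c i t w).2)%O.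
  rewrite /drawn /=; have := ab i (ordered_extend L c oY) => /=.
  by case: (ltP (mark i t w)) => //= lt le; rewrite (lt_le_trans lt le).
(* When [bad] is at least 1 sizes suffice: [2 * B] for the two values of [f], and [2 * B] for each
   of the [size L] jumps. *)
have rough : 1 <= bad L t t' w -> lec c (f (Y t' w)) (f (Y t w) +
     \sum_(i <- L) rung i t t' w * jump L c f i t w
     + sg R c * ((2 + 2 * (size L)%:R) * B * bad L t t' w)).
  move=> b1; have S : `|\sum_(i <- L) rung i t t' w * jump L c f i t w| <= 2 * (size L)%:R * B.
    apply: le_trans (ler_norm_sum _ _ _) _.
    have -> : 2 * (size L)%:R * B = \sum_(i <- L) 2 * B.
      by rewrite big_const_seq count_predT iter_addr_0 -mulr_natr; ring.
    apply: ler_sum => i _; rewrite normrM rungE /jump.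
    have J : `|f (set_pair (Y t w) i (drawn L c i t w)) - f (Y t w)| <= 2 * B.
      by apply: le_trans (ler_normB _ _) _; have := fB _ oY;
         have := fB _ (ordered_set_pair i oY (Dc i)); lra.
    by case: (_ < _)%N; rewrite ?normr1 ?normr0 ?mul1r ?mul0r// mulr_ge0.
  have K : (2 + 2 * (size L)%:R) * B <= (2 + 2 * (size L)%:R) * B * bad L t t' w.
    by rewrite ler_peMr// mulr_ge0// addr_ge0// mulr_ge0.
  have := fB _ oY'; have := fB _ oY; move: S K.
  move: (\sum_(i <- L) _) (bad _ _ _ _) => S b' H1 H2 H3 H4; move: H1 H3 H4.
  rewrite !ler_norml => /andP[? ?] /andP[? ?] /andP[? ?]; rewrite /lec /sg.
  by case: (c); lra.
have [/hasP[i iL Hi]|/hasPn no2] := boolP (has (fun i => (N i t w).+1 < N i t' w)%N L).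
  by apply: rough; exact: bad_twice iL Hi.
have bad0 : 0 <= sg R true * ((2 + 2 * (size L)%:R) * B * bad L t t' w).
  have [b1 b2] := bad_terms_ge0 L t t' w.
  by rewrite mul1r !mulr_ge0// ?addr_ge0// mulr_ge0.
have weaken u v : lec c u v -> lec c u (v + sg R c * ((2 + 2 * (size L)%:R) * B * bad L t t' w)).
  by move: bad0; rewrite /lec /sg; case: (c); lra.
have [/hasP[i iL Hi]|/hasPn no1] := boolP (has (fun i => N i t w < N i t' w)%N L); last first.
  apply: weaken; rewrite big1_seq ?addr0; last first.
    by move=> i /= iL; rewrite rungE (negbTE (no1 i iL)) mul0r.
  have -> : f (Y t' w) = f (Y t w); last by rewrite /lec; case: (c).
  apply: cf; apply/agreeP => i iL.
  have := no1 i iL; rewrite -leqNgt => le; have e : N i t w = N i t' w.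
    by apply/eqP; rewrite eqn_leq le N_mono// ltW.
  have [_ const _] := pw.
  by have := const i t t' t0 (ltW tt') e; rewrite /pair_at => -[-> ->].
have [/hasP[j jL /andP[ji Hj]]|/hasPn other] := boolP (has (fun j => (j != i) && (N j t w < N j t' w)%N) L).
  by apply: rough; exact: bad_two iL jL ji Hi Hj.
apply: weaken.
have -> : \sum_(i <- L) rung i t t' w * jump L c f i t w = jump L c f i t w.
  rewrite (big_rem i iL)/= rungE Hi mul1r big1_seq ?addr0// => j /= jr.
  have jL := mem_rem jr; have ji : j != i by apply: contraTneq jr => ->; rewrite mem_rem_uniqF.
  by have := other j jL; rewrite ji /= rungE => /negbTE ->; rewrite mul0r.
have e : N i t' w = (N i t w).+1.
  by apply/eqP; rewrite eqn_leq Hi leqNgt andbT; have := no2 i iL; rewrite -leqNgt.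
have stay j : j \in L -> j != i -> N j t' w = N j t w.
  move=> jL ji; have := other j jL; rewrite ji /= -leqNgt => le.
  by apply/eqP; rewrite eqn_leq le N_mono// ltW.
(* Exactly one ring in [L], at [i]. The jump is governed by [y], which agrees with the state at time
   [t] on [L] but is unknown outside. *)
have [y [oy yi yj yU]] := one_ring (N_mono w) (N_right w) pw ox t0 tt' e.
have [_ const _] := pw.
have yL : agree L y (Y t w).
  apply/allP => j jL; have [->|ji] := eqVneq j i; first by rewrite yi.
  by rewrite yj// stay.
pose D : bool * bool := (mark i t w < a i y.1, mark i t w < b i y.2).
have E : f (Y t' w) = f (set_pair (Y t w) i D).
  apply: cf; apply/allP => j jL; rewrite {2}/pair_at /set_pair /set_spin /=.
  have [->|ji] := eqVneq j i; first by rewrite yU q_draw.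
  by apply/eqP; apply: (const j t t') => //; [exact: ltW|rewrite stay].
have Do : (D.1 <= D.2)%O.
  rewrite /D /=; have := ab i oy; case: (ltP (mark i t w) (a i y.1)) => //=.
  by move=> lt le; rewrite (lt_le_trans lt le).
rewrite E /jump addrCA subrr addr0.
have ext s s' : {in L, s =1 s'} -> if c then config_le s (extend L c s') else config_le (extend L c s') s.
  by move=> ss'; case: (c) => j; rewrite /extend; case: ifPn => [/ss' <-//|_];
    [exact: lex1|exact: le0x].
have y1 : {in L, y.1 =1 (Y t w).1} by move=> j jL; have [] := agreeP _ _ _ yL j jL.
have y2 : {in L, y.2 =1 (Y t w).2} by move=> j jL; have [] := agreeP _ _ _ yL j jL.
move: (ext _ _ y1) (ext _ _ y2) Do (Dc i); rewrite /D /drawn /lec.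
have imp (u v z : R) : u <= v -> ((z < u) <= (z < v))%O.
  by move=> uv; case: (ltP z u) => //= zu; rewrite (lt_le_trans zu uv).
case: (c) => e1 e2 Do Dci.
  apply: nf; [exact: ordered_set_pair|exact: ordered_set_pair|].
  apply: set_pair_le; first exact: pair_le_refl.
    by apply: imp; exact: aA.2.
  by apply: imp; exact: bA.2.
apply: nf; [exact: ordered_set_pair|exact: ordered_set_pair|].
apply: set_pair_le; first exact: pair_le_refl.
  by apply: imp; exact: aA.2.
by apply: imp; exact: bA.2.
Qed.

Let Y_measurable t : 0 <= t -> measurable_fun setT (Y t).
Proof.
move=> t0 _ A mA; rewrite setTI.
exact: (history_measurable (Y_adapted t0 mA) t0).
Qed.

Lemma bounded_measurable_state L f t : 0 <= t -> cylindric L f ->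
  bounded_measurable (fun w => f (Y t w)).
Proof.
move=> t0 cf; split; last by have [B fB] := cylindric_bounded cf; exists B.
exact: (measurableT_comp (cylindric_measurable cf) (Y_measurable t0)).
Qed.

Let mark_set_measurable i t (V : set R) : 0 <= t -> measurable V ->
  measurable [set w | V (mark i t w)].
Proof.
move=> t0 mV.
have -> : [set w | V (mark i t w)] =
    \bigcup_n ([set w | N i t w = n] `&` (U i n.+1 @^-1` V)).
  apply/seteqP; split => [w Vw|w [n _ [/= e Vw]]]; first by exists (N i t w).
  by rewrite /mark /= e.
apply: bigcupT_measurable => n; apply: measurableI.
  by rewrite -[X in measurable X]setTI; exact: (measurable_funP (N i t) measurableT [set n]).
exact: (@noise_measurable _ _ _ _ _ N U (inr (i, n.+1)) _ (ex_intro2 _ _ V mV (setTI _))).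
Qed.

Let rung_bm i t t' : 0 <= t -> 0 <= t' -> bounded_measurable (rung i t t').
Proof. by move=> t0 t'0; apply: bounded_measurable_indic; exact: rang_measurable. Qed.

Definition ring_prob i t t' : R := fine (P (rang N i t t')).

(* The mark of the next ring is uniform and independent of the state at time
   [t], so a threshold depending on that state integrates to its mean. *)
Let mean_threshold L psi g i t t' : uniq L -> cylindric L psi -> cylindric L g ->
  (forall y, 0 <= g y <= 1) -> 0 <= t -> t < t' ->
  mean P (fun w => rung i t t' w * (psi (Y t w) * (mark i t w < g (Y t w))%R%:R)) =
  ring_prob i t t' * mean P (fun w => psi (Y t w) * g (Y t w)).
Proof.
move=> uL cpsi cg g01 t0 tt'; have t'0 : 0 <= t' by apply: le_trans (ltW tt').
pose A p := [set w | agree L (Y t w) p].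
have hA p : history N' U' t (A p) := Y_adapted t0 (measurable_agree L p).
have mA p : measurable (A p) := history_measurable (hA p) t0.
pose E p := rang N i t t' `&` [set w | mark i t w < g p].
have mV p : measurable [set u : R | u < g p].
  have -> : [set u : R | u < g p] = `]-oo, g p[%classic by apply/seteqP; split => u /=; rewrite in_itv.
  exact: measurable_itv.
have mE p : measurable (E p).
  by apply: measurableI; [exact: rang_measurable|exact: mark_set_measurable (mV p)].
have F1 w : rung i t t' w * (psi (Y t w) * (mark i t w < g (Y t w))%R%:R) =
    \sum_(p <- patterns L) psi p * \1_(A p `&` E p) w.
  have cF : cylindric L (fun y => psi y * (mark i t w < g y)%R%:R).
    by move=> y z yz; rewrite (cpsi _ _ yz) (cg _ _ yz).
  rewrite (patterns_sum (Y t w) uL cF) mulr_sumr; apply: eq_bigr => p _.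
  have -> : \1_(A p `&` E p) w = (agree L (Y t w) p)%:R * (rung i t t' w * (mark i t w < g p)%R%:R) :> R.
    by rewrite /A /E !indicI/= (indic_bool R (fun w => agree L (Y t w) p))
      (indic_bool R (fun w => mark i t w < g p)).
  by ring.
have F2 w : psi (Y t w) * g (Y t w) = \sum_(p <- patterns L) psi p * g p * \1_(A p) w.
  have cF : cylindric L (fun y => psi y * g y) by move=> y z yz; rewrite (cpsi _ _ yz) (cg _ _ yz).
  rewrite (patterns_sum (Y t w) uL cF); apply: eq_bigr => p _.
  by rewrite mulrC /A (indic_bool R (fun w => agree L (Y t w) p)).
under [X in mean P X]funext => w do rewrite F1.
under [X in _ = _ * mean P X]funext => w do rewrite F2.
have bmA p : bounded_measurable (\1_(A p) : Omega -> R) by exact: bounded_measurable_indic.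
have bmAE p : bounded_measurable (\1_(A p `&` E p) : Omega -> R).
  by apply: bounded_measurable_indic; exact: measurableI.
rewrite !mean_sum; last 2 first.
- by move=> p; exact: bounded_measurableZ.
- by move=> p; exact: bounded_measurableZ.
rewrite mulr_sumr; apply: eq_bigr => p _.
rewrite !meanZ// !mean_indic//; last exact: measurableI.
rewrite (next_mark_indep mc i t0 tt' (mV p) (hA p)) uniform_prob_lt//.
have fp : P (A p) \is a fin_num by exact: fin_num_measure.
have fr : P (rang N i t t') \is a fin_num by apply: fin_num_measure; exact: rang_measurable.
rewrite fineM// ?fineM//=; last by rewrite fin_numM.
by rewrite /ring_prob; ring.
Qed.

Let mean_ring L psi i t t' : uniq L -> cylindric L psi -> 0 <= t -> t < t' ->
  mean P (fun w => rung i t t' w * psi (Y t w)) = ring_prob i t t' * mean P (fun w => psi (Y t w)).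
Proof.
move=> uL cpsi t0 tt'; have t'0 : 0 <= t' by apply: le_trans (ltW tt').
pose A p := [set w | agree L (Y t w) p].
have hA p : history N' U' t (A p) := Y_adapted t0 (measurable_agree L p).
have mA p : measurable (A p) := history_measurable (hA p) t0.
have mr := rang_measurable N i t0 t'0.
have F1 w : rung i t t' w * psi (Y t w) =
    \sum_(p <- patterns L) psi p * \1_(A p `&` rang N i t t') w.
  rewrite (patterns_sum (Y t w) uL cpsi) mulr_sumr; apply: eq_bigr => p _.
  have -> : \1_(A p `&` rang N i t t') w = (agree L (Y t w) p)%:R * rung i t t' w :> R.
    by rewrite indicI/= /A (indic_bool R (fun w => agree L (Y t w) p)).
  by ring.
have F2 w : psi (Y t w) = \sum_(p <- patterns L) psi p * \1_(A p) w.
  rewrite (patterns_sum (Y t w) uL cpsi); apply: eq_bigr => p _.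
  by rewrite mulrC /A (indic_bool R (fun w => agree L (Y t w) p)).
under [X in mean P X]funext => w do rewrite F1.
under [X in _ = _ * mean P X]funext => w do rewrite F2.
have bmA p : bounded_measurable (\1_(A p) : Omega -> R) by exact: bounded_measurable_indic.
have bmAE p : bounded_measurable (\1_(A p `&` rang N i t t') : Omega -> R).
  by apply: bounded_measurable_indic; exact: measurableI.
rewrite !mean_sum; last 2 first.
- by move=> p; exact: bounded_measurableZ.
- by move=> p; exact: bounded_measurableZ.
rewrite mulr_sumr; apply: eq_bigr => p _.
rewrite !meanZ// !mean_indic//; last exact: measurableI.
have := next_mark_indep mc i t0 tt' (measurableT : measurable [set: R]) (hA p).
have -> : [set w | [set: R] (U i (N i t w).+1 w)] = setT by [].
rewrite setIT probability_setT mule1 => ->.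
rewrite fineM ?fin_num_measure//.
by rewrite /ring_prob; ring.
Qed.

Let mark_below_bm i t L g : 0 <= t -> cylindric L g ->
  bounded_measurable (fun w => (mark i t w < g (Y t w))%R%:R : R).
Proof.
move=> t0 cg.
have -> : (fun w => (mark i t w < g (Y t w))%R%:R : R) =
    \1_[set w | mark i t w < g (Y t w)].
  by apply/funext => w; rewrite (indic_bool R (fun w => mark i t w < g (Y t w))).
apply: bounded_measurable_indic.
have mm : measurable_fun setT (mark i t).
  by move=> _ V mV; rewrite setTI; exact: mark_set_measurable.
have [mg _] := bounded_measurable_state t0 cg.
by have := measurable_fun_ltr mm mg measurableT (I : measurable [set true]); rewrite setTI.
Qed.

Let ring_prob_bounds i t t' : 0 <= t -> t < t' ->
  `|ring_prob i t t' - M i * (t' - t)| <= (M i * (t' - t)) ^+ 2 /\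
  0 <= ring_prob i t t' <= M i * (t' - t).
Proof.
move=> t0 tt'; rewrite /ring_prob (prob_rang mc M0 i t0 tt') /=.
have l0 : 0 < M i * (t' - t) by rewrite mulr_gt0 ?subr_gt0.
move: (M i * (t' - t)) l0 => l l0; have e1 := expR_ge1Dx (- l); have e2 := expR_ge1Dx l.
have e3 : expR l * expR (- l) = 1 by rewrite expRxMexpNx_1.
have e4 := expR_gt0 (- l); have e5 := expR_gt0 l.
have e6 : expR (- l) <= 1 by rewrite -expR0 ler_expR; lra.
have e7 : expR (- l) * (1 + l) <= 1 by rewrite -[X in _ <= X]e3 [X in _ <= X]mulrC ler_wpM2l// ltW.
split; last by apply/andP; split; lra.
have l1 : 0 < 1 + l by lra.
have e8 : expR (- l) <= 1 - l + l ^+ 2.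
  rewrite -(ler_pM2r l1); apply: le_trans e7 _.
  have -> : (1 - l + l ^+ 2) * (1 + l) = 1 + l ^+ 3 by ring.
  by rewrite lerDl exprn_ge0// ltW.
have l2 : 0 <= l ^+ 2 by rewrite exprn_ge0// ltW.
rewrite ler_norml; apply/andP; split; lra.
Qed.

(** With [S] the total rate of [L] and [h = t' - t], the pathwise error [(2 + 2 * size L) * B] meets
    a mean of [bad] of at most [2 * S ^ 2 * h ^ 2]; replacing ring probabilities by [M i * h] costs
    another [2 * B * S ^ 2 * h ^ 2]. Together they give [6 + 4 * size L]. *)
Lemma one_step c L f (B : R) t t' : uniq L -> nondecr f -> cylindric L f ->
  (forall y, ordered y -> `|f y| <= B) -> 0 <= t -> t < t' ->
  lec c (mean P (fun w => f (Y t' w)))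
    (mean P (fun w => pair_ker a b M L c (t' - t) f (Y t w)) +
     sg R c * ((6 + 4 * (size L)%:R) * B * (\sum_(i <- L) M i) ^+ 2 * (t' - t) ^+ 2)).
Proof.
move=> uL nf cf fB t0 tt'; have t'0 : 0 <= t' by apply: le_trans (ltW tt').
have [N0 [mN0 PN0 subN0]] := Y_path.
pose G := ~` N0; have mG : measurable G by exact: measurableC.
have PG : P G = 1%E by rewrite probability_setC// PN0 sube0.
have Gpath w : G w -> glauber_path q N' U' x Y w.
  by move=> Gw; apply: contrapT => nw; apply: Gw; exact: subN0.
pose al i (y : pair) := a i (extend L c y.1); pose be i (y : pair) := b i (extend L c y.2).
(* Telescoping makes the jump linear in the two indicators of a mark below a threshold, so that
   [mean_threshold] applies to each. This uses that the thresholds are ordered, hence holds on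
   [G]. *)
pose D0 i y := f (set_pair y i (false, false)) - f y.
pose D1 i y := f (set_pair y i (false, true)) - f (set_pair y i (false, false)).
pose D2 i y := f (set_pair y i (true, true)) - f (set_pair y i (false, true)).
have cset i bb : cylindric L (fun y => f (set_pair y i bb)).
  by move=> y z yz; apply: cf; exact: agree_set_pair.
have cD0 i : cylindric L (D0 i) by move=> y z yz; rewrite /D0 (cset _ _ _ _ yz) (cf _ _ yz).
have cD1 i : cylindric L (D1 i) by move=> y z yz; rewrite /D1 !(cset _ _ _ _ yz).
have cD2 i : cylindric L (D2 i) by move=> y z yz; rewrite /D2 !(cset _ _ _ _ yz).
have cal i : cylindric L (al i).
  by move=> y z /agreeP yz; rewrite /al (@extend_eq _ L c y.1 z.1)// => j /yz[].
have cbe i : cylindric L (be i).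
  by move=> y z /agreeP yz; rewrite /be (@extend_eq _ L c y.2 z.2)// => j /yz[].
pose T i w := rung i t t' w * (D0 i (Y t w)
   + D1 i (Y t w) * (mark i t w < be i (Y t w))%R%:R
   + D2 i (Y t w) * (mark i t w < al i (Y t w))%R%:R).
have jumpE w : G w -> forall i, rung i t t' w * jump L c f i t w = T i w.
  move=> /Gpath pw i; rewrite /T /jump /drawn.
  have oY := ordered_path (N_mono w) (N_right w) pw ox t0.
  have := ab i (ordered_extend L c oY); rewrite /= -/(al i (Y t w)) -/(be i (Y t w)) => ale.
  have : (mark i t w < al i (Y t w)) ==> (mark i t w < be i (Y t w)).
    by apply/implyP => lt; rewrite (lt_le_trans lt ale).
  rewrite /D0 /D1 /D2; case: (_ < al _ _); case: (_ < be _ _) => //= _; ring.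
have bT i : bounded_measurable (T i).
  apply: bounded_measurableM; first exact: rung_bm.
  have s0 := bounded_measurable_state t0 (cD0 i).
  have s1 := bounded_measurableM (bounded_measurable_state t0 (cD1 i)) (mark_below_bm i t0 (cbe i)).
  have s2 := bounded_measurableM (bounded_measurable_state t0 (cD2 i)) (mark_below_bm i t0 (cal i)).
  exact: bounded_measurableD (bounded_measurableD s0 s1) s2.
pose m i := mean P (fun w => pair_update i (al i (Y t w)) (be i (Y t w)) f (Y t w) - f (Y t w)).
have mT i : mean P (T i) = ring_prob i t t' * m i.
  have s0 := bounded_measurable_state t0 (cD0 i).
  have r0 := rung_bm i t0 t'0.
  have s1 := bounded_measurableM (bounded_measurable_state t0 (cD1 i)) (mark_below_bm i t0 (cbe i)).
  have s2 := bounded_measurableM (bounded_measurable_state t0 (cD2 i)) (mark_below_bm i t0 (cal i)).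
  have -> : mean P (T i) =
     mean P (fun w => rung i t t' w * D0 i (Y t w))
     + mean P (fun w => rung i t t' w * (D1 i (Y t w) * (mark i t w < be i (Y t w))%R%:R))
     + mean P (fun w => rung i t t' w * (D2 i (Y t w) * (mark i t w < al i (Y t w))%R%:R)).
    have A0 := bounded_measurableM r0 s0; have A1 := bounded_measurableM r0 s1.
    have A2 := bounded_measurableM r0 s2.
    rewrite -(meanD P A0 A1) -(meanD P (bounded_measurableD A0 A1) A2).
    by congr mean; apply/funext => w; rewrite /T; ring.
  rewrite (mean_ring i uL (cD0 i) t0 tt').
  rewrite (mean_threshold i uL (cD1 i) (cbe i) (fun y => bA.1 i _) t0 tt').
  rewrite (mean_threshold i uL (cD2 i) (cal i) (fun y => aA.1 i _) t0 tt').
  have A1 := bounded_measurableM (bounded_measurable_state t0 (cD1 i)) (bounded_measurable_state t0 (cbe i)).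
  have A2 := bounded_measurableM (bounded_measurable_state t0 (cD2 i)) (bounded_measurable_state t0 (cal i)).
  rewrite -!mulrDr; congr (_ * _).
  rewrite -(meanD P s0 A1) -(meanD P (bounded_measurableD s0 A1) A2).
  by congr mean; apply/funext => w; rewrite /pair_update /D0 /D1 /D2; ring.
have bsingle i : bounded_measurable (\1_(rang_twice N i t t') : Omega -> R).
  by apply: bounded_measurable_indic; exact: rang_twice_measurable.
have bpair i j : bounded_measurable (fun w => rung i t t' w * rung j t t' w).
  by apply: bounded_measurableM; exact: rung_bm.
have btwice : bounded_measurable (fun w => \sum_(i <- L) \1_(rang_twice N i t t') w : R).
  exact: bounded_measurable_sum.
have bpairs : bounded_measurable (fun w => \sum_(i <- L) \sum_(j <- L | j != i) rung i t t' w * rung j t t' w).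
  by apply: bounded_measurable_sum => i; exact: bounded_measurable_sum.
have bbad : bounded_measurable (bad L t t') by exact: bounded_measurableD.
set S := \sum_(i <- L) M i; set h := t' - t; have h0 : 0 < h by rewrite subr_gt0.
have S0 : 0 <= S by apply: sumr_ge0 => i _; exact: ltW.
have sq : \sum_(i <- L) M i ^+ 2 <= S ^+ 2.
  rewrite expr2 {1}/S mulr_suml [X in X <= _]big_seq [X in _ <= X]big_seq.
  apply: ler_sum => i iL; rewrite expr2 ler_wpM2l ?(ltW (M0 i))//.
  by rewrite /S (big_rem i iL)/= lerDl sumr_ge0// => j _; exact: ltW.
have badb : mean P (bad L t t') <= 2 * S ^+ 2 * h ^+ 2.
  rewrite meanD//.
  have b1 : mean P (fun w => \sum_(i <- L) \1_(rang_twice N i t t') w) <= S ^+ 2 * h ^+ 2.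
    rewrite mean_sum//.
    apply: (@le_trans _ _ (\sum_(i <- L) M i ^+ 2 * h ^+ 2)).
      apply: ler_sum => i _; rewrite mean_indic; last exact: rang_twice_measurable.
      by have := prob_rang_twice mc M0 i t0 tt'; rewrite exprMn.
    by rewrite -mulr_suml ler_wpM2r// exprn_ge0// ltW.
  have b2 : mean P (fun w => \sum_(i <- L) \sum_(j <- L | j != i) rung i t t' w * rung j t t' w)
      <= S ^+ 2 * h ^+ 2.
    rewrite mean_sum => [|i]; last exact: bounded_measurable_sum.
    have -> : S ^+ 2 * h ^+ 2 = \sum_(i <- L) \sum_(j <- L) M i * h * (M j * h).
      have -> : \sum_(i <- L) \sum_(j <- L) M i * h * (M j * h) = \sum_(i <- L) M i * (h ^+ 2 * S).
        by apply: eq_bigr => i _; rewrite /S !mulr_sumr; apply: eq_bigr => j _; ring.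
      by rewrite -mulr_suml -/S; ring.
    apply: ler_sum => i _.
    rewrite mean_sum//.
    rewrite big_mkcond/=; apply: ler_sum => j _.
    have Mh k : 0 <= M k * h by rewrite mulr_ge0// ltW.
    case: ifPn => ji; last by rewrite mulr_ge0.
    have -> : (fun w => rung i t t' w * rung j t t' w) = \1_(rang N i t t' `&` rang N j t t').
      by apply/funext => w; rewrite indicI.
    rewrite mean_indic; last by apply: measurableI; exact: rang_measurable.
    rewrite (rang_pair_indep mc _ t0 tt') 1?eq_sym// fineM; last 2 first.
    - by apply: fin_num_measure; exact: rang_measurable.
    - by apply: fin_num_measure; exact: rang_measurable.
    have [_ /andP[? ?]] := ring_prob_bounds i t0 tt'.
    have [_ /andP[? ?]] := ring_prob_bounds j t0 tt'.
    exact: ler_pM.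
  by have := lerD b1 b2; rewrite -[in X in _ -> X]mulrA; lra.
have mB i : `|m i| <= 2 * B.
  have bup : bounded_measurable (fun w => pair_update i (al i (Y t w)) (be i (Y t w)) f (Y t w) - f (Y t w)).
    have cU : cylindric L (fun y => pair_update i (al i y) (be i y) f y - f y).
      by move=> y z yz; rewrite /pair_update (cal _ _ _ yz) (cbe _ _ _ yz) !(cset _ _ _ _ yz) (cf _ _ yz).
    exact: bounded_measurable_state cU.
  have H w : G w -> - (2 * B) <= pair_update i (al i (Y t w)) (be i (Y t w)) f (Y t w) - f (Y t w) <= 2 * B.
    move=> /Gpath pw; have oY := ordered_path (N_mono w) (N_right w) pw ox t0.
    have := ab i (ordered_extend L c oY); rewrite /= -/(al i (Y t w)) -/(be i (Y t w)) => ale.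
    have /andP[a0 _] : 0 <= al i (Y t w) <= 1 := aA.1 i _.
    have /andP[_ b1] : 0 <= be i (Y t w) <= 1 := bA.1 i _.
    have := fB _ oY; have := fB _ (@ordered_set_pair _ _ i (false, false) oY erefl).
    have := fB _ (@ordered_set_pair _ _ i (false, true) oY erefl).
    have := fB _ (@ordered_set_pair _ _ i (true, true) oY erefl).
    rewrite !ler_norml /pair_update; move: (al _ _) (be _ _) (f _) (f _) (f _) (f _) ale a0 b1.
    move=> u v f1 f2 f3 f4 ? ? ? /andP[? ?] /andP[? ?] /andP[? ?] /andP[? ?].
    by apply/andP; split; nra.
  rewrite ler_norml -[- (2 * B)](mean_cst P) -{2}[2 * B](mean_cst P).
  by apply/andP; split; apply: (le_mean_on mG PG) => //; try exact: bounded_measurable_cst;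
    move=> w /H/andP[].
pose K := (2 + 2 * (size L)%:R) * B.
have B0 : 0 <= B by apply: le_trans (fB x ox).
have K0 : 0 <= K by rewrite mulr_ge0// addr_ge0// mulr_ge0.
have bf := bounded_measurable_state t0 cf.
have bf' := bounded_measurable_state t'0 cf.
have bsum : bounded_measurable (fun w => \sum_(i <- L) T i w) by exact: bounded_measurable_sum.
pose W w := f (Y t w) + \sum_(i <- L) T i w + (sg R c * K) * bad L t t' w.
have bW : bounded_measurable W.
  by apply: bounded_measurableD; [exact: bounded_measurableD|exact: bounded_measurableZ].
have mW : mean P W = mean P (fun w => f (Y t w)) + \sum_(i <- L) ring_prob i t t' * m i
    + sg R c * K * mean P (bad L t t').
  rewrite /W meanD; [|exact: bounded_measurableD|exact: bounded_measurableZ].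
  rewrite meanD// meanZ// mean_sum//; congr (_ + _ + _).
  by apply: eq_bigr => i _; rewrite mT.
have main : lec c (mean P (fun w => f (Y t' w))) (mean P W).
  have P1 w : G w -> lec c (f (Y t' w)) (W w).
    move=> Gw; have := one_step_path c uL nf cf fB t0 tt' (Gpath w Gw).
    have -> // : W w = f (Y t w) + \sum_(i <- L) rung i t t' w * jump L c f i t w
        + sg R c * (K * bad L t t' w).
      by rewrite /W mulrA; congr (_ + _ + _); apply: eq_bigr => i _; rewrite jumpE.
  by move: P1; rewrite /lec; case: (c) => P1; apply: (le_mean_on mG PG).
have kerE : mean P (fun w => pair_ker a b M L c h f (Y t w)) =
    mean P (fun w => f (Y t w)) + h * \sum_(i <- L) M i * m i.
  have bG : bounded_measurable (fun w => pair_gen a b M L c f (Y t w)).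
    by apply: (@bounded_measurable_state L) => //; exact: cylindric_pair_gen.
  rewrite /pair_ker meanD//; last exact: bounded_measurableZ.
  rewrite meanZ//.
  have cU i : cylindric L (fun y => pair_update i (al i y) (be i y) f y - f y).
    by move=> y z yz; rewrite /pair_update (cal _ _ _ yz) (cbe _ _ _ yz) !(cset _ _ _ _ yz) (cf _ _ yz).
  rewrite /pair_gen mean_sum; last first.
    by move=> i; apply: bounded_measurableZ; exact: bounded_measurable_state (cU i).
  congr (_ + _ * _); apply: eq_bigr => i _.
  by rewrite meanZ//; exact: bounded_measurable_state (cU i).
have diff : `|\sum_(i <- L) ring_prob i t t' * m i - h * \sum_(i <- L) M i * m i| <=
    2 * B * S ^+ 2 * h ^+ 2.
  rewrite mulr_sumr -sumrB; apply: le_trans (ler_norm_sum _ _ _) _.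
  apply: (@le_trans _ _ (\sum_(i <- L) M i ^+ 2 * (2 * B * h ^+ 2))).
    apply: ler_sum => i _.
    have -> : ring_prob i t t' * m i - h * (M i * m i) = (ring_prob i t t' - M i * h) * m i by ring.
    have -> : M i ^+ 2 * (2 * B * h ^+ 2) = (M i * h) ^+ 2 * (2 * B) by ring.
    have [H _] := ring_prob_bounds i t0 tt'.
    by rewrite normrM ler_pM.
  rewrite -mulr_suml; have -> : 2 * B * S ^+ 2 * h ^+ 2 = S ^+ 2 * (2 * B * h ^+ 2) by ring.
  by rewrite ler_wpM2r// !mulr_ge0// ltW.
have Kb := ler_wpM2l K0 badb.
have Kb0 : 0 <= K * mean P (bad L t t').
  rewrite mulr_ge0// /mean; apply: Rintegral_ge0 => w _.
  by have [b1 b2] := bad_terms_ge0 L t t' w; rewrite addr_ge0.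
move: main; rewrite kerE mW.
have -> : (6 + 4 * (size L)%:R) * B * S ^+ 2 * h ^+ 2 = K * (2 * S ^+ 2 * h ^+ 2) + 2 * B * S ^+ 2 * h ^+ 2.
  by rewrite /K; ring.
move: diff Kb Kb0; rewrite ler_norml => /andP[].
by rewrite /lec /sg; case: (c); lra.
Qed.

End OneStep.

(** * Stationary laws *)

Lemma lec_trans (R : realType) c (x y z : R) : lec c x y -> lec c y z -> lec c x z.
Proof. by case: c => /= xy yz; [exact: le_trans yz|exact: le_trans xy]. Qed.

Lemma lec_refl (R : realType) c (x : R) : lec c x x.
Proof. by case: c; exact: lexx. Qed.

Section SpinStationary.
Variables (R : realType) (d : nat).
Implicit Types (L D : seq (site d)) (f g : config d -> R) (m : (config d -> R) -> R).

(** An abstraction that covers both the marginals of a law of pairs and a law of single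
    configurations, in particular a Gibbs measure. *)
Definition positive_mean m :=
  [/\ forall L f g, cylindric1 L f -> cylindric1 L g -> (forall s, f s <= g s) -> m f <= m g,
      forall k, m (fun=> k) = k &
      forall L f g k, cylindric1 L f -> cylindric1 L g ->
        m (fun s => f s + k * g s) = m f + k * m g].

Lemma positive_mean_comp (dT : measure_display) (T : measurableType dT) (P : probability T R)
    (phi : T -> config d) :
  (forall L f, cylindric1 L f -> bounded_measurable (f \o phi)) ->
  positive_mean (fun f => mean P (f \o phi)).
Proof.
move=> bm; split=> [L f g cf cg fg|k|L f g k cf cg].
- by apply: le_mean => [||x]; [exact: bm cf|exact: bm cg|exact: fg].
- exact: mean_cst.
- have bg := bm L g cg; rewrite -[k * _](meanZ _ _ bg) -meanD//; first exact: bm cf.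
  exact: bounded_measurableZ.
Qed.

Definition spin_stationary M p m := forall L f c, uniq L -> nondecr1 f -> cylindric1 L f ->
  lec c 0 (m (spin_gen M p L c f)).

Lemma cylindric1_sub L D f : {subset D <= L} -> cylindric1 D f -> cylindric1 L f.
Proof. by move=> sD cf s t st; apply: cf => i /sD /st. Qed.

Lemma cylindric1_sum_up L D : {subset D <= L} ->
  cylindric1 L (fun s => \sum_(i <- D) up R i s).
Proof.
move=> sD s t st; apply: eq_big_seq => i /sD iL; exact: cylindric_up iL _ _ st.
Qed.

Lemma cylindric1_spin_gen M p L c f : cylindric1 L f -> cylindric1 L (spin_gen M p L c f).
Proof.
move=> cf s t st; have := cylindric1_iter_spin_ker M p c 1 1 cf st.
by rewrite /= /spin_ker (cf _ _ st) !mul1r => /addrI.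
Qed.

Section Iterate.
Variables (p : site d -> config d -> R) (M : site d -> R) (m : (config d -> R) -> R).
Hypotheses (pA : attractive p) (M0 : forall i, 0 < M i).
Hypotheses (pm : positive_mean m) (sm : spin_stationary M p m).

Lemma spin_stationary_iter c L h n f : uniq L -> nondecr1 f -> cylindric1 L f ->
  0 < h -> h * \sum_(i <- L) M i <= 1 ->
  lec c (m f) (m (iter n (spin_ker M p L c h) f)).
Proof.
move=> uL nf cf h0 hM; elim: n => [|n IH]; first exact: lec_refl.
apply: lec_trans IH _; rewrite iterS.
have nK := nondecr_iter_spin_ker c pA M0 h0 hM n nf.
have cK := cylindric1_iter_spin_ker M p c h n cf.
move: (iter n _ f) nK cK => g ng cg.
have [_ _ lin] := pm; rewrite /spin_ker (lin L)//; last exact: cylindric1_spin_gen.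
have := sm c uL ng cg; rewrite /lec; case: (c) => H.
  by rewrite lerDl mulr_ge0// ltW.
by rewrite gerDl mulr_ge0_le0// ltW.
Qed.

End Iterate.

Section Gibbsian.
Variables (beta : R) (J : site d -> site d -> R) (h M : site d -> R) (theta : R).
Hypothesis JI : interaction J.
Hypothesis beta_gt0 : 0 < beta.
Hypothesis M_large : forall i, 2 * expR (beta * (rsum (J i) + `|h i|)) <= M i.
Let p := up_prob beta J h M.

(** For the boundary +: the mean of [f] increases along the iterated kernel, the iterates become
    nearly constant by ergodicity, and the constant is the finite-volume mean, which the kernel
    preserves. *)
Lemma spin_stationary_le m c L f : positive_mean m -> spin_stationary M p m ->
  uniq L -> nondecr1 f -> cylindric1 L f -> lec c (m f) (volume_mean beta J h L c f).
Proof.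
move=> pm sm uL nf cf; set k := (1 + \sum_(i <- L) M i)^-1.
have M0 := M_gt0 M_large; have pA := attractive_up_prob JI beta_gt0 M_large.
have k0 : 0 < k := mesh_gt0 M_large L.
have k1 : k * \sum_(i <- L) M i <= 1 := mesh_le1 M_large L.
have main (eps : R) : 0 < eps -> sg R c * m f <= sg R c * volume_mean beta J h L c f + eps.
  move=> eps0; have [n /(_ n (leqnn n))] := spin_ker_ergodic c pA M0
    k0 k1 (min_prob_gt0 M_large) (up_prob_bounds JI beta_gt0 M_large) eps0 nf cf.
  have /andP[b1 b2] := volume_mean_between JI beta_gt0 M_large uL c n nf.
  have := spin_stationary_iter pA M0 pm sm c n uL nf cf k0 k1.
  have nK := nondecr_iter_spin_ker c pA M0 k0 k1 n nf.
  have cK := cylindric1_iter_spin_ker M p c k n cf.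
  move: b1 b2; rewrite -/p -/k /oscillation.
  move: (iter n _ f) nK cK => g ng cg b1 b2.
  have [le cst _] := pm.
  have m1 : g (@bot d) <= m g.
    by rewrite -[g _]cst; apply: (le L) => // s; apply: ng; exact: bot_le.
  have m2 : m g <= g (@top d).
    by rewrite -[g (@top d)]cst; apply: (le L) => // s; apply: ng; exact: le_top.
  by move: b1 b2 m1 m2; rewrite /lec /sg; case: (c)  => /=; lra.
by apply/lecP/ler_addgt0Pr.
Qed.

Hypothesis theta_lt1 : theta < 1.
Hypothesis J_small : forall i, 4 * beta * rsum (J i) <= theta.

(** Besides [f], the function [k - f] is increasing, with [k] a multiple of the number of + spins;
    so the gap of [f] is at most that of [k]. *)
Lemma volume_gap_bound L D f (B : R) : uniq L -> {subset D <= L} -> nondecr1 f ->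
  cylindric1 D f -> (forall s, `|f s| <= B) ->
  volume_mean beta J h L true f - volume_mean beta J h L false f <=
  2 * B * \sum_(i <- D) gap beta J h L i.
Proof.
move=> uL sD nf cf fB; pose k s : R := 2 * B * \sum_(i <- D) up R i s.
have ng : nondecr1 (fun s => -1 * f s + k s).
  apply: nondecr1_addup; first by move=> s t st; rewrite (cf _ _ st).
  by move=> s; rewrite mulN1r normrN.
have cg : cylindric1 L (fun s => -1 * f s + k s).
  move=> s t st; rewrite (cylindric1_sub sD cf st) /k.
  by rewrite (cylindric1_sum_up sD st).
have := volume_mean_mono JI beta_gt0 M_large uL ng cg.
rewrite !volume_meanD !volume_meanZ !volume_mean_sum /gap sumrB; lra.
Qed.

(** On increasing functions both functionals are squeezed between the two finite-volume means, whose
    difference tends to 0. *)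
Lemma spin_stationary_unique m m' : positive_mean m -> positive_mean m' ->
  spin_stationary M p m -> spin_stationary M p m' ->
  forall D f, cylindric1 D f -> (exists B, forall s, `|f s| <= B) -> m f = m' f.
Proof.
move=> pm pm' sm sm' D.
have one m1 m2 f (B : R) : positive_mean m1 -> positive_mean m2 ->
    spin_stationary M p m1 -> spin_stationary M p m2 -> nondecr1 f -> cylindric1 D f ->
    (forall s, `|f s| <= B) -> m1 f <= m2 f.
  move=> pm1 pm2 sm1 sm2 nf cf fB; apply/ler_addgt0Pr => eps eps0.
  have B0 : 0 <= B by apply: le_trans (fB (@top d)).
  pose e := eps / (2 * B * (size D)%:R + 1).
  have c0 : 0 < 2 * B * (size D)%:R + 1 by rewrite ltr_wpDl// !mulr_ge0.
  have e0 : 0 < e by rewrite divr_gt0.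
  have [L0 uL0 H] := gap_small JI beta_gt0 M_large theta_lt1 J_small D e0.
  pose L := undup (L0 ++ D); have uL : uniq L by exact: undup_uniq.
  have s0 : {subset L0 <= L} by move=> i iL; rewrite mem_undup mem_cat iL.
  have sD : {subset D <= L} by move=> i iD; rewrite mem_undup mem_cat iD orbT.
  have cfL := cylindric1_sub sD cf.
  have u1 := spin_stationary_le true pm1 sm1 uL nf cfL.
  have u2 := spin_stationary_le false pm2 sm2 uL nf cfL.
  have V := volume_gap_bound uL sD nf cf fB.
  have G : \sum_(i <- D) gap beta J h L i <= (size D)%:R * e.
    have -> : (size D)%:R * e = \sum_(i <- D) e.
      by rewrite big_const_seq count_predT iter_addr_0 mulr_natl.
    by rewrite big_seq [X in _ <= X]big_seq; apply: ler_sum => i iD; exact: (H L uL s0 sD i iD).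
  have G2 : 2 * B * \sum_(i <- D) gap beta J h L i <= 2 * B * ((size D)%:R * e).
    by rewrite ler_wpM2l// mulr_ge0.
  have G3 : 2 * B * ((size D)%:R * e) <= eps.
    rewrite mulrA /e mulrA ler_pdivrMr// mulrC ler_wpM2l//; first exact: ltW.
    by rewrite lerDl.
  move: u1 u2; rewrite /lec /=; lra.
have eqn f (B : R) : nondecr1 f -> cylindric1 D f -> (forall s, `|f s| <= B) -> m f = m' f.
  by move=> nf cf fB; apply/eqP; rewrite eq_le; apply/andP; split; exact: (one _ _ _ B).
(* For a general cylindric [f], both [k] and [f + k] are increasing. *)
move=> f cf [B fB]; pose k s : R := 2 * B * \sum_(i <- D) up R i s.
have B0 : 0 <= B by apply: le_trans (fB (@top d)).
have ck : cylindric1 D k by move=> s t st; rewrite /k (cylindric1_sum_up (fun _ => id) st).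
have kB s : `|k s| <= 2 * B * (size D)%:R.
  rewrite /k normrM [X in X * _ <= _]ger0_norm ?mulr_ge0// ler_wpM2l ?mulr_ge0//.
  rewrite ger0_norm; last by apply: sumr_ge0 => i _; case/andP: (up_bound R i s).
  have -> : (size D)%:R = \sum_(i <- D) (1 : R) by rewrite big_const_seq count_predT iter_addr_0.
  by apply: ler_sum => i _; case/andP: (up_bound R i s).
have nk : nondecr1 k.
  move=> s t st; rewrite /k ler_wpM2l ?mulr_ge0//; apply: ler_sum => i _; exact: nondecr_up.
have ek := eqn k _ nk ck kB.
have efk : m (fun s => f s + k s) = m' (fun s => f s + k s).
  apply: (eqn _ (B + 2 * B * (size D)%:R)).
  - exact: nondecr1_addup.
  - by move=> s t st; rewrite (cf _ _ st) (ck _ _ st).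
  - by move=> s; rewrite (le_trans (ler_normD _ _))// lerD.
have E m0 : positive_mean m0 -> m0 (fun s => f s + k s) = m0 f + m0 k.
  move=> [_ _ lin]; rewrite -[m0 k]mul1r -(lin D)//; congr m0.
  by apply/funext => s; rewrite mul1r.
by move: efk; rewrite !E// ek => /addIr.
Qed.

End Gibbsian.
End SpinStationary.

Lemma ler_two_gaps (R : realType) (x y A C x' y' A' C' e : R) :
  x <= A -> C <= y -> x' <= A' -> C' <= y' -> A - C <= e -> A' - C' <= e ->
  x - y + (x' - y') <= 2 * e.
Proof. by lra. Qed.

(** Three errors [e] for each marginal: the oscillation of the + chain, the gap between the
    boundaries, the oscillation of the - chain. *)
Lemma ler_two_gaps3 (R : realType) (x y u v A C x' y' u' v' A' C' e : R) :
  x - u <= e -> v - y <= e -> u <= A -> C <= v -> A - C <= e ->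
  x' - u' <= e -> v' - y' <= e -> u' <= A' -> C' <= v' -> A' - C' <= e ->
  x - y + (x' - y') <= 6 * e.
Proof. by lra. Qed.

(** * Stationary laws of pairs *)

Section PairStationary.
Variables (R : realType) (d : nat).
Local Notation pair := (config d * config d)%type.
Implicit Types (L D : seq (site d)) (f g : pair -> R) (i : site d) (nu : probability pair R).

Lemma positive_mean_fst nu : positive_mean (fun f : config d -> R => mean nu (f \o fst)).
Proof.
by apply: positive_mean_comp => L f cf; exact: cylindric_bounded_measurable (cylindric_fst cf).
Qed.

Lemma positive_mean_snd nu : positive_mean (fun f : config d -> R => mean nu (f \o snd)).
Proof.
by apply: positive_mean_comp => L f cf; exact: cylindric_bounded_measurable (cylindric_snd cf).
Qed.

(** Applying [V] to the increasing function [2 * B * spin_count - f] bounds [V f] by the values of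
    [V] on single coordinates, where only the marginal chains and their explicit finite-volume
    equilibria matter. *)
Lemma width_bound L D (V : (pair -> R) -> R) f (B : R) :
  (forall f g, cylindric L f -> cylindric L g -> V (fun x => f x + g x) = V f + V g) ->
  (forall k f, cylindric L f -> V (fun x => k * f x) = k * V f) ->
  (forall f, nondecr f -> cylindric L f -> 0 <= V f) ->
  {subset D <= L} -> nondecr f -> cylindric D f -> (forall x, `|f x| <= B) ->
  V f <= 2 * B * \sum_(i <- D) (V (up R i \o fst) + V (up R i \o snd)).
Proof.
move=> VD VZ V0 sD nf cf fB.
have cfL := cylindric_sub sD cf.
have cfst i : i \in L -> cylindric L (up R i \o fst).
  by move=> iL; apply: cylindric_fst; exact: cylindric_up.
have csnd i : i \in L -> cylindric L (up R i \o snd).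
  by move=> iL; apply: cylindric_snd; exact: cylindric_up.
have VS (r : seq (site d)) : {subset r <= L} -> cylindric L (spin_count R r) /\
    V (spin_count R r) = \sum_(i <- r) (V (up R i \o fst) + V (up R i \o snd)).
  elim: r => [|i r IH] sr.
    have E : spin_count R [::] = (fun=> 0 : R) :> (pair -> R).
      by apply/funext => x; rewrite /spin_count big_nil.
    split; first by rewrite E.
    rewrite E big_nil; have c0 : cylindric L (fun=> 0 : R) by [].
    have e : (fun x : pair => 0 * (fun=> 0 : R) x) = (fun=> 0) by apply/funext => x; rewrite mul0r.
    by have := VZ 0 _ c0; rewrite e mul0r.
  have [|c1 e1] := IH; first by move=> j jr; apply: sr; rewrite inE jr orbT.
  have iL : i \in L by apply: sr; rewrite inE eqxx.
  have E : spin_count R (i :: r) = (fun x : pair => (up R i \o fst) x + (up R i \o snd) x + spin_count R r x).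
    by apply/funext => x; rewrite /spin_count big_cons.
  have c2 : cylindric L (fun x : pair => (up R i \o fst) x + (up R i \o snd) x).
    by move=> x y xy; rewrite (cfst i iL _ _ xy) (csnd i iL _ _ xy).
  split; first by rewrite E => x y xy; rewrite (c2 _ _ xy) (c1 _ _ xy).
  by rewrite E VD// VD ?e1 ?big_cons//; [exact: cfst|exact: csnd].
have [cc ec] := VS D sD; rewrite -ec -VZ//.
have ng : nondecr (fun x => -1 * f x + 2 * B * spin_count R D x).
  apply: nondecr_addcount; first by move=> x y xy; rewrite (cf _ _ xy).
  by move=> x; rewrite mulN1r normrN.
have c1 : cylindric L (fun x => -1 * f x) by move=> x y xy; rewrite (cfL _ _ xy).
have c2 : cylindric L (fun x => 2 * B * spin_count R D x) by move=> x y xy; rewrite (cc _ _ xy).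
have cg : cylindric L (fun x => -1 * f x + 2 * B * spin_count R D x).
  by move=> x y xy; rewrite (c1 _ _ xy) (c2 _ _ xy).
have := V0 _ ng cg; rewrite (VD _ _ c1 c2) (VZ (-1) _ cfL) mulN1r addrC subr_ge0.
exact.
Qed.

Definition pair_stationary (a b : site d -> config d -> R) M nu := nu (@ordered d) = 1%E /\
  forall L f c, uniq L -> nondecr f -> cylindric L f ->
    lec c 0 (mean nu (pair_gen a b M L c f)).

Lemma pair_stationary_iter (a b : site d -> config d -> R) (M : site d -> R) nu c L (k : R) n f :
  attractive a -> attractive b -> dominated a b -> (forall i, 0 <= M i) ->
  pair_stationary a b M nu -> uniq L -> nondecr f -> cylindric L f ->
  0 < k -> k * \sum_(i <- L) M i <= 1 ->
  lec c (mean nu f) (mean nu (iter n (pair_ker a b M L c k) f)).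
Proof.
move=> aA bA ab M0' [_ H] uL nf cf k0 kM; elim: n => [|n IH]; first exact: lec_refl.
apply: lec_trans IH _; rewrite iterS.
have nK := nondecr_iter_pair_ker aA bA ab c M0' (ltW k0) kM n nf.
have cK := cylindric_iter_pair_ker a b M c k n cf.
move: (iter n _ f) nK cK => g ng cg.
have bG := cylindric_bounded_measurable (cylindric_pair_gen a b M c cg).
rewrite /pair_ker meanD; [|exact: cylindric_bounded_measurable cg|exact: bounded_measurableZ].
rewrite meanZ//.
have := H L g c uL ng cg; rewrite /lec; case: (c) => G0.
  by rewrite lerDl mulr_ge0// ltW.
by rewrite gerDl mulr_ge0_le0// ltW.
Qed.

Variables (beta : R) (J J' : site d -> site d -> R) (h h' M : site d -> R) (theta : R).
Hypotheses (JI : interaction J) (J'I : interaction J') (beta_gt0 : 0 < beta).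
Hypothesis M_large : forall i, 2 * expR (beta * (rsum (J i) + `|h i|)) <= M i.
Hypothesis M_large' : forall i, 2 * expR (beta * (rsum (J' i) + `|h' i|)) <= M i.
Hypothesis theta_lt1 : theta < 1.
Hypothesis J_small : forall i, 4 * beta * rsum (J i) <= theta.
Hypothesis J'_small : forall i, 4 * beta * rsum (J' i) <= theta.
Let a := up_prob beta J h M.
Let b := up_prob beta J' h' M.
Hypothesis ab : dominated a b.
Let aA : attractive a := attractive_up_prob JI beta_gt0 M_large.
Let bA : attractive b := attractive_up_prob J'I beta_gt0 M_large'.
Let M0 := M_gt0 M_large.
Let M0' i : 0 <= M i. Proof. exact: ltW. Qed.

Local Notation stationary := (pair_stationary a b M).

Lemma stationary_fst nu : stationary nu ->
  spin_stationary M a (fun g : config d -> R => mean nu (g \o fst)).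
Proof.
move=> [_ H] L f c uL nf cf; rewrite -(pair_gen_fst a b).
by apply: H => //; [exact: nondecr_fst|exact: cylindric_fst].
Qed.

Lemma stationary_snd nu : stationary nu ->
  spin_stationary M b (fun g : config d -> R => mean nu (g \o snd)).
Proof.
move=> [_ H] L f c uL nf cf; rewrite -(pair_gen_snd a b).
by apply: H => //; [exact: nondecr_snd|exact: cylindric_snd].
Qed.

Let stationary_iter nu c L (k : R) n f : stationary nu -> uniq L -> nondecr f -> cylindric L f ->
  0 < k -> k * \sum_(i <- L) M i <= 1 ->
  lec c (mean nu f) (mean nu (iter n (pair_ker a b M L c k) f)).
Proof. exact: pair_stationary_iter. Qed.

Lemma both_gaps_small D (e : R) : 0 < e -> exists L, [/\ uniq L, {subset D <= L} &
  {in D, forall i, gap beta J h L i <= e /\ gap beta J' h' L i <= e}].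
Proof.
move=> e0.
have [L0 uL0 H] := gap_small JI beta_gt0 M_large theta_lt1 J_small D e0.
have [L1 uL1 H1] := gap_small J'I beta_gt0 M_large' theta_lt1 J'_small D e0.
exists (undup (L0 ++ L1 ++ D)); split; first exact: undup_uniq.
  by move=> i iD; rewrite mem_undup !mem_cat iD !orbT.
move=> i iD; split.
  apply: H => //; first exact: undup_uniq.
  - by move=> j jL; rewrite mem_undup !mem_cat jL.
  - by move=> j jL; rewrite mem_undup !mem_cat jL !orbT.
apply: H1 => //; first exact: undup_uniq.
- by move=> j jL; rewrite mem_undup !mem_cat jL orbT.
- by move=> j jL; rewrite mem_undup !mem_cat jL !orbT.
Qed.

(** The bound is uniform in the mesh and in the number of steps, as the passage to continuous time
    requires: [L] is fixed before the mesh tends to 0. *)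
Lemma stationary_width nu f D (B eps : R) : stationary nu -> nondecr f -> cylindric D f ->
  (forall x, `|f x| <= B) -> 0 < eps -> exists L, [/\ uniq L, {subset D <= L} &
    forall (k : R) n, 0 < k -> k * \sum_(i <- L) M i <= 1 ->
      mean nu (iter n (pair_ker a b M L true k) f) -
      mean nu (iter n (pair_ker a b M L false k) f) <= eps].
Proof.
move=> sn nf cf fB eps0.
have B0 : 0 <= B by apply: le_trans (fB (@bot d, @bot d)).
have c0 : 0 < 4 * B * (size D)%:R + 1 by rewrite ltr_wpDl// !mulr_ge0.
pose e : R := eps / (4 * B * (size D)%:R + 1).
have e0 : 0 < e by rewrite divr_gt0.
have [L [uL sD HL]] := both_gaps_small D e0.
exists L; split => // k n k0 kM.
pose V g := mean nu (iter n (pair_ker a b M L true k) g) -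
            mean nu (iter n (pair_ker a b M L false k) g).
have cI c g : cylindric L g -> bounded_measurable (iter n (pair_ker a b M L c k) g).
  move=> cg; apply: (@cylindric_bounded_measurable _ _ L).
  exact: cylindric_iter_pair_ker.
have VD g g' : cylindric L g -> cylindric L g' -> V (fun x => g x + g' x) = V g + V g'.
  move=> cg cg'; rewrite /V.
  under [X in mean nu X - _]funext => x do rewrite iter_pair_kerD.
  under [X in _ - mean nu X]funext => x do rewrite iter_pair_kerD.
  by rewrite (meanD _ (cI _ _ cg) (cI _ _ cg')) (meanD _ (cI _ _ cg) (cI _ _ cg')) opprD addrACA.
have VZ q g : cylindric L g -> V (fun x => q * g x) = q * V g.
  move=> cg; rewrite /V.
  under [X in mean nu X - _]funext => x do rewrite iter_pair_kerZ.
  under [X in _ - mean nu X]funext => x do rewrite iter_pair_kerZ.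
  by rewrite (meanZ _ _ (cI _ _ cg)) (meanZ _ _ (cI _ _ cg)) mulrBr.
have V0 g : nondecr g -> cylindric L g -> 0 <= V g.
  move=> ng cg; have := stationary_iter true n sn uL ng cg k0 kM.
  have := stationary_iter false n sn uL ng cg k0 kM.
  by rewrite /V /lec subr_ge0 => u v; exact: le_trans u v.
apply: le_trans (width_bound VD VZ V0 sD nf cf fB) _.
have Vup i : i \in D -> V (up R i \o fst) + V (up R i \o snd) <= 2 * e.
  move=> iD; have iL := sD i iD; have [ga gb] := HL i iD.
  have n1 := nondecr_up R i; have c1 := cylindric_up R iL.
  rewrite /V !iter_pair_ker_fst !iter_pair_ker_snd.
  have k0' := ltW k0.
  have A c := spin_stationary_le JI beta_gt0 M_large c (positive_mean_fst nu) (stationary_fst sn)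
    uL (nondecr_iter_spin_ker c aA M0 k0 kM n n1) (cylindric1_iter_spin_ker M a c k n c1).
  have A' c := spin_stationary_le J'I beta_gt0 M_large' c (positive_mean_snd nu) (stationary_snd sn)
    uL (nondecr_iter_spin_ker c bA M0 k0 kM n n1) (cylindric1_iter_spin_ker M b c k n c1).
  move: (A true) (A false) (A' true) (A' false).
  (* The finite-volume means absorb the iterated kernels, whence the uniformity in [n] and [k]. *)
  rewrite !(volume_mean_ker JI M_large uL) !(volume_mean_ker J'I M_large' uL) => v1 v2 v3 v4.
  exact: ler_two_gaps v1 v2 v3 v4 ga gb.
have S : \sum_(i <- D) (V (up R i \o fst) + V (up R i \o snd)) <= (size D)%:R * (2 * e).
  have -> : (size D)%:R * (2 * e) = \sum_(i <- D) 2 * e.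
    by rewrite big_const_seq count_predT iter_addr_0 mulr_natl.
  by rewrite big_seq [X in _ <= X]big_seq; apply: ler_sum.
apply: le_trans (ler_wpM2l _ S) _; first by rewrite mulr_ge0.
have -> : 2 * B * ((size D)%:R * (2 * e)) = 4 * B * (size D)%:R * e by ring.
by rewrite /e mulrA ler_pdivrMr// mulrC ler_wpM2l// ?(ltW eps0)// lerDl.
Qed.

(** Every stationary law gives [f] a mean between the iterates for boundary - at the lowest pair and
    for boundary + at the highest pair. This interval contains both means, and its length is bounded
    through the marginals. *)
Lemma stationary_le nu nu' f D (B : R) : stationary nu -> stationary nu' ->
  nondecr f -> cylindric D f -> (forall x, `|f x| <= B) -> mean nu f <= mean nu' f.
Proof.
move=> sn sn' nf cf fB; suff main (eps : R) : 0 < eps -> mean nu f <= mean nu' f + eps by apply/ler_addgt0Pr.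
move=> eps0.
have B0 : 0 <= B by apply: le_trans (fB (@bot d, @bot d)).
have c0 : 0 < 12 * B * (size D)%:R + 1 by rewrite ltr_wpDl// !mulr_ge0.
pose e : R := eps / (12 * B * (size D)%:R + 1).
have e0 : 0 < e by rewrite divr_gt0.
have [L [uL sD HL]] := both_gaps_small D e0.
pose k : R := (1 + \sum_(i <- L) M i)^-1.
have k0 : 0 < k := mesh_gt0 M_large L.
have kM : k * \sum_(i <- L) M i <= 1 := mesh_le1 M_large L.
(* One number of steps serves all coordinates of [D], both marginals and both boundaries. *)
have nO : exists n, {in D, forall i c,
    oscillation (iter n (spin_ker M a L c k) (up R i)) <= e /\
    oscillation (iter n (spin_ker M b L c k) (up R i)) <= e}.
  suff [n Hn] : exists N, forall n, (N <= n)%N -> {in D, forall i c,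
      oscillation (iter n (spin_ker M a L c k) (up R i)) <= e /\
      oscillation (iter n (spin_ker M b L c k) (up R i)) <= e} by exists n; exact: Hn.
  elim: {nf cf HL c0 e e0} D (e) (e0) sD => [|i D IH] e e0 sD; first by exists 0%N.
  have [|N HN] := IH e e0; first by move=> j jD; apply: sD; rewrite inE jD orbT.
  have iL : i \in L by apply: sD; rewrite inE eqxx.
  have n1 := nondecr_up R i; have c1 := cylindric_up R iL.
  have EA c := spin_ker_ergodic c aA M0 k0 kM (min_prob_gt0 M_large)
    (up_prob_bounds JI beta_gt0 M_large) e0 n1 c1.
  have EB c := spin_ker_ergodic c bA M0 k0 kM (min_prob_gt0 M_large')
    (up_prob_bounds J'I beta_gt0 M_large') e0 n1 c1.
  have [N1 H1] := EA true; have [N2 H2] := EA false.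
  have [N3 H3] := EB true; have [N4 H4] := EB false.
  exists (maxn N (maxn (maxn N1 N2) (maxn N3 N4))) => n.
  rewrite !geq_max => /and3P[nN /andP[nN1 nN2] /andP[nN3 nN4]] j.
  rewrite inE => /orP[/eqP ->|jD] c; last exact: HN.
  by case: c; split; [exact: H1|exact: H3|exact: H2|exact: H4].
have [n Hn] := nO.
pose T : pair := (@top d, @top d); pose O : pair := (@bot d, @bot d).
pose V g := iter n (pair_ker a b M L true k) g T - iter n (pair_ker a b M L false k) g O.
have oT : ordered T by move=> i; exact: lexx.
have oO : ordered O by move=> i; exact: lexx.
have bounds nu1 g : stationary nu1 -> nondecr g -> cylindric L g ->
    iter n (pair_ker a b M L false k) g O <= mean nu1 g <= iter n (pair_ker a b M L true k) g T.
  move=> s1 ng cg; have u1 := stationary_iter true n s1 uL ng cg k0 kM.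
  have u2 := stationary_iter false n s1 uL ng cg k0 kM.
  have [on _] := s1; have mo : measurable (@ordered d) by exact: measurable_ordered.
  have bK c := cylindric_bounded_measurable (cylindric_iter_pair_ker a b M c k n cg).
  have nK c := nondecr_iter_pair_ker aA bA ab c M0' (ltW k0) kM n ng.
  have top1 : mean nu1 (iter n (pair_ker a b M L true k) g) <= iter n (pair_ker a b M L true k) g T.
    rewrite -[X in _ <= X](mean_cst nu1); apply: (le_mean_on mo on) => //.
      exact: bounded_measurable_cst.
    by move=> x ox; apply: nK => //; split; exact: le_top.
  have bot1 : iter n (pair_ker a b M L false k) g O <= mean nu1 (iter n (pair_ker a b M L false k) g).
    rewrite -[X in X <= _](mean_cst nu1); apply: (le_mean_on mo on) => //.
      exact: bounded_measurable_cst.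
    by move=> x ox; apply: nK => //; split; exact: bot_le.
  by apply/andP; split; [exact: le_trans bot1 u2|exact: le_trans u1 top1].
have VD g g' : cylindric L g -> cylindric L g' -> V (fun x => g x + g' x) = V g + V g'.
  by move=> _ _; rewrite /V !iter_pair_kerD opprD addrACA.
have VZ q g : cylindric L g -> V (fun x => q * g x) = q * V g.
  by move=> _; rewrite /V !iter_pair_kerZ mulrBr.
have V0 g : nondecr g -> cylindric L g -> 0 <= V g.
  by move=> ng cg; have /andP[u v] := bounds nu g sn ng cg; rewrite subr_ge0 (le_trans u v).
have cfL := cylindric_sub sD cf.
have Vf := width_bound VD VZ V0 sD nf cf fB.
have Vup i : i \in D -> V (up R i \o fst) + V (up R i \o snd) <= 6 * e.
  move=> iD; have iL := sD i iD; have [ga gb] := HL i iD.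
  have n1 := nondecr_up R i.
  rewrite /V !iter_pair_ker_fst !iter_pair_ker_snd /=.
  have [q1 q3] := Hn i iD true; have [q2 q4] := Hn i iD false.
  have /andP[v1 v2] := volume_mean_between JI beta_gt0 M_large uL true n n1.
  have /andP[v3 v4] := volume_mean_between JI beta_gt0 M_large uL false n n1.
  have /andP[v5 v6] := volume_mean_between J'I beta_gt0 M_large' uL true n n1.
  have /andP[v7 v8] := volume_mean_between J'I beta_gt0 M_large' uL false n n1.
  exact: ler_two_gaps3 q1 q2 v1 v4 ga q3 q4 v5 v8 gb.
have S : \sum_(i <- D) (V (up R i \o fst) + V (up R i \o snd)) <= (size D)%:R * (6 * e).
  have -> : (size D)%:R * (6 * e) = \sum_(i <- D) 6 * e.
    by rewrite big_const_seq count_predT iter_addr_0 mulr_natl.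
  by rewrite big_seq [X in _ <= X]big_seq; apply: ler_sum.
have S2 : 2 * B * ((size D)%:R * (6 * e)) <= eps.
  have -> : 2 * B * ((size D)%:R * (6 * e)) = 12 * B * (size D)%:R * e by ring.
  by rewrite /e mulrA ler_pdivrMr// mulrC ler_wpM2l// ?(ltW eps0)// lerDl.
have S3 := ler_wpM2l (mulr_ge0 (ler0n R 2) B0) S.
have /andP[_ w1] := bounds nu f sn nf cfL; have /andP[w2 _] := bounds nu' f sn' nf cfL.
move: Vf S2 S3 w1 w2; rewrite /V; move: (iter _ _ _ _) (iter _ _ _ _) (\sum_(i <- D) _) => u v w.
by move: (mean nu f) (mean nu' f) (2 * B) ((size D)%:R * (6 * e)) => x y z t; lra.
Qed.

Lemma stationary_unique nu nu' : stationary nu -> stationary nu' ->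
  forall A : set pair, measurable A -> nu A = nu' A.
Proof.
move=> sn sn'; apply: probability_pair_unique => D f cf.
have eqn g (C : R) : nondecr g -> cylindric D g -> (forall x, `|g x| <= C) -> mean nu g = mean nu' g.
  by move=> ng cg gC; apply/eqP; rewrite eq_le; apply/andP; split; exact: (stationary_le _ _ ng cg gC).
have bnd g : cylindric D g -> exists C : R, forall x, `|g x| <= C.
  by move=> /cylindric_bounded[C gC]; exists C.
have [B fB] := bnd f cf.
have B0 : 0 <= B by apply: le_trans (fB (@bot d, @bot d)).
pose k x : R := 2 * B * spin_count R D x.
have ck : cylindric D k by move=> x y xy; rewrite /k (cylindric_spin_count _ xy).
have nk : nondecr k by move=> x y ox oy xy; rewrite /k ler_wpM2l ?mulr_ge0// nondecr_spin_count.
have nfk := nondecr_addcount cf fB.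
have cfk : cylindric D (fun x => f x + k x) by move=> x y xy; rewrite (cf _ _ xy) (ck _ _ xy).
have [C1 kC] := bnd k ck; have [C2 fkC] := bnd _ cfk.
have := eqn _ _ nfk cfk fkC; rewrite !meanD; last 4 first.
- exact: cylindric_bounded_measurable cf.
- exact: cylindric_bounded_measurable ck.
- exact: cylindric_bounded_measurable cf.
- exact: cylindric_bounded_measurable ck.
by rewrite (eqn _ _ nk ck kC) => /addIr.
Qed.

End PairStationary.

(** * Invariant laws *)

Lemma lec_transD (R : realType) c (x y z e1 e2 : R) :
  lec c x (y + sg R c * e1) -> lec c y (z + sg R c * e2) -> lec c x (z + sg R c * (e1 + e2)).
Proof. by rewrite /lec /sg; case: c; lra. Qed.

Lemma lec_refl0 (R : realType) c (x : R) : lec c x (x + sg R c * 0).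
Proof. by rewrite mulr0 addr0; exact: lec_refl. Qed.

Lemma lec_limit (R : realType) c (x y C : R) :
  (forall t : R, 0 < t -> lec c x (y + sg R c * (C * t))) -> lec c x y.
Proof.
move=> H; have main (eps : R) : 0 < eps -> sg R c * x <= sg R c * y + eps.
  move=> e0; have C1 : 0 < `|C| + 1 by rewrite ltr_wpDl.
  have t0 : 0 < eps / (`|C| + 1) by rewrite divr_gt0.
  have le : C * (eps / (`|C| + 1)) <= eps.
    apply: le_trans (ler_wpM2r (ltW t0) (ler_norm C)) _.
    by rewrite mulrA ler_pdivrMr// mulrC ler_wpM2l ?lerDl// ltW.
  have /lecP := H _ t0; rewrite mulrDr mulrA => H1; apply: le_trans H1 _.
  by rewrite lerD2l /sg; case: (c); rewrite ?mulr1 ?mulrNN ?mul1r.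
exact/lecP/ler_addgt0Pr.
Qed.

Section Dynamics.
Variables (R : realType) (d : nat) (dO : measure_display) (Omega : measurableType dO).
Local Notation pair := (config d * config d)%type.
Variables (P : probability Omega R) (M : site d -> R).
Variables (N : site d -> R -> {RV P >-> nat}) (U : site d -> nat -> {RV P >-> R}).
Variables (a b : site d -> config d -> R) (q : site d -> pair -> bool * bool -> R).
Variable X : pair -> R -> Omega -> pair.
Hypothesis XG : glauber_dynamics q M N U X.
Hypothesis M0 : forall i, 0 < M i.
Hypotheses (aA : attractive a) (bA : attractive b) (ab : dominated a b).
Hypothesis q_draw : forall i y u, ordered y -> draw (q i y) u = (u < a i y.1, u < b i y.2).
Implicit Types (i j : site d) (t s h : R) (L : seq (site d)) (f : pair -> R) (w : Omega) (x : pair).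

Let M0' i : 0 <= M i. Proof. exact: ltW. Qed.

Definition semigroup t f x : R := mean P (fun w => f (X x t w)).

Definition step_error L (B : R) : R := (6 + 4 * (size L)%:R) * B * (\sum_(i <- L) M i) ^+ 2.

Lemma bounded_measurable_dynamics x t L f : ordered x -> 0 <= t -> cylindric L f ->
  bounded_measurable (fun w => f (X x t w)).
Proof.
move=> ox t0 cf; have [_ _ XA _] := XG.
exact: (bounded_measurable_state (fun t A => @XA x t A ox) t0 cf).
Qed.

Lemma semigroup0 x L f : ordered x -> cylindric L f -> semigroup 0 f x = f x.
Proof.
move=> ox cf; have [_ /(_ x ox)[N0 [mN0 PN0 subN0]] _ _] := XG.
rewrite /semigroup -[RHS](mean_cst P); apply: (@eq_mean_on _ _ _ _ _ _ (~` N0)).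
- exact: measurableC.
- by rewrite probability_setC// PN0 sube0.
- exact: bounded_measurable_dynamics ox (lexx 0) cf.
- exact: bounded_measurable_cst.
move=> w Nw; suff [-> _ _] : glauber_path q (fun i t => N i t : Omega -> nat)
  (fun i n => U i n : Omega -> R) x (X x) w by [].
by apply: contrapT => nw; apply: Nw; exact: subN0.
Qed.

Lemma dynamics_ordered x t : ordered x -> 0 <= t ->
  \forall w \ae P, ordered (X x t w).
Proof.
move=> ox t0; have [mc XP _ _] := XG; have [cl _ _] := mc.
apply: filterS (XP x ox) => w pw; apply: (ordered_path _ _ pw ox t0).
- by move=> i s t'; have [_ H _ _ _] := cl i; exact: H.
- by move=> i s; have [_ _ H _ _] := cl i; exact: H.
Qed.

Lemma semigroup_step c L f (B : R) x t t' : uniq L -> nondecr f -> cylindric L f ->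
  (forall y, ordered y -> `|f y| <= B) -> ordered x -> 0 <= t -> t < t' ->
  lec c (semigroup t' f x) (semigroup t (pair_ker a b M L c (t' - t) f) x +
    sg R c * (step_error L B * (t' - t) ^+ 2)).
Proof.
move=> uL nf cf fB ox t0 tt'; have [mc XP XA _] := XG.
exact: (one_step mc M0 aA bA ab q_draw ox (XP x ox) (fun t A => @XA x t A ox) c uL nf cf fB t0 tt').
Qed.

(** The induction generalises over the observable: the last step replaces [f] by its image under the
    kernel, which is again increasing and cylindric with the same bound, while the starting pair
    stays fixed. *)
Lemma semigroup_iter c L f (B s : R) n x : uniq L -> nondecr f -> cylindric L f ->
  (forall y, ordered y -> `|f y| <= B) -> 0 < s -> s * \sum_(i <- L) M i <= 1 -> ordered x ->
  lec c (semigroup (n%:R * s) f x) (iter n (pair_ker a b M L c s) f x +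
    sg R c * (n%:R * (step_error L B * s ^+ 2))).
Proof.
move=> uL + + + s0 sM ox; elim: n f => [|n IH] f nf cf fB.
  by rewrite !mul0r (semigroup0 ox cf); exact: lec_refl0.
have n0 : 0 <= n%:R * s by rewrite mulr_ge0// ltW.
have ns : n%:R * s < n.+1%:R * s by rewrite ltr_pM2r// ltr_nat.
have := semigroup_step c uL nf cf fB ox n0 ns.
have -> : n.+1%:R * s - n%:R * s = s by rewrite -mulrBl -natrB// subSnn mul1r.
move=> H; have K1 := nondecr_iter_pair_ker aA bA ab c M0' (ltW s0) sM 1 nf.
have C1 := cylindric_iter_pair_ker a b M c s 1 cf.
have B1 y : ordered y -> `|pair_ker a b M L c s f y| <= B.
  move=> oy; rewrite ler_norml.
  apply: (iter_pair_ker_bounds aA bA ab c M0' (ltW s0) sM 1) => // z oz.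
  by rewrite -ler_norml fB.
have := lec_transD H (IH _ K1 C1 B1); rewrite /= -iterSr.
by congr (lec c _ (_ + _ * _)); rewrite -natr1 mulrDl mul1r addrC.
Qed.

Lemma measurable_dynamics x t (A : set pair) : ordered x -> 0 <= t -> measurable A ->
  measurable (X x t @^-1` A).
Proof.
by move=> ox t0 mA; have [_ _ XA _] := XG; exact: (history_measurable (XA x t A ox t0 mA) t0).
Qed.

(** Set to 0 off the ordered pairs, because the dynamics is specified only when started from an
    ordered pair. *)
Definition transition t (A : set pair) : pair -> R :=
  (fun x => fine (P (X x t @^-1` A))) \_ (@ordered d).

Definition flow t f : pair -> R := (semigroup t f) \_ (@ordered d).

Lemma transition_bounded_measurable t A : 0 <= t -> measurable A ->
  bounded_measurable (transition t A).
Proof.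
move=> t0 mA; have [_ _ _ XM] := XG; split.
  apply/(measurable_restrictT _ _).1; first exact: measurable_ordered.
  apply: measurableT_comp; first exact: fine_measurable.
  exact: XM.
exists 1 => x; rewrite /transition patchE; case: ifPn => [|_]; last by rewrite normr0.
rewrite inE => ox; have mX := measurable_dynamics ox t0 mA.
by rewrite ger0_norm ?fine_ge0// -lee_fin fineK ?fin_num_measure// probability_le1.
Qed.

Lemma integral_transition (nu : probability pair R) t A : 0 <= t -> measurable A ->
  (\int[nu]_(x in @ordered d) P (X x t @^-1` A))%E = (mean nu (transition t A))%:E.
Proof.
move=> t0 mA; rewrite /mean /Rintegral fineK; last first.
  apply: integrable_fin_num => //; apply: bounded_measurable_integrable.
  exact: transition_bounded_measurable.
rewrite [LHS]integral_mkcond; apply: eq_integral => x _.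
rewrite /transition !patchE; case: ifPn => //; rewrite inE => ox.
by rewrite fineK// fin_num_measure//; exact: measurable_dynamics.
Qed.

(** Reduces the action on cylindric functions to finitely many transition probabilities, whose
    measurability and invariance are given for events. *)
Lemma flow_patterns t L f x : 0 <= t -> uniq L -> cylindric L f ->
  flow t f x = \sum_(r <- patterns L) f r * transition t [set y | agree L y r] x.
Proof.
move=> t0 uL cf; rewrite /flow patchE; case: ifPn => [|nx]; last first.
  by rewrite big1// => r _; rewrite /transition patchE (negPf nx) mulr0.
rewrite inE => ox.
have mA r := measurable_dynamics ox t0 (measurable_agree L r).
transitivity (mean P (fun w => \sum_(r <- patterns L) f r * \1_(X x t @^-1` [set y | agree L y r]) w)).
  congr mean; apply/funext => w; rewrite (patterns_sum _ uL cf); apply: eq_bigr => r _.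
  by rewrite mulrC indicE mem_setE.
rewrite mean_sum => [|r]; last by apply: bounded_measurableZ; exact: bounded_measurable_indic.
apply: eq_bigr => r _; rewrite meanZ; last exact: bounded_measurable_indic.
by rewrite mean_indic// /transition patchE mem_set.
Qed.

Lemma flow_bounded_measurable t L f : 0 <= t -> uniq L -> cylindric L f ->
  bounded_measurable (flow t f).
Proof.
move=> t0 uL cf; under [X in bounded_measurable X]funext => x do rewrite (flow_patterns x t0 uL cf).
apply: bounded_measurable_sum => r; apply: bounded_measurableZ.
by apply: transition_bounded_measurable => //; exact: measurable_agree.
Qed.

Lemma invariant_flow (nu : probability pair R) t L f : invariant_law P X nu ->
  0 <= t -> uniq L -> cylindric L f -> mean nu (flow t f) = mean nu f.
Proof.
move=> [_ inv] t0 uL cf; have mA r := measurable_agree L r.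
under [X in mean _ X = _]funext => x do rewrite (flow_patterns x t0 uL cf).
rewrite mean_sum => [|r]; last first.
  by apply: bounded_measurableZ; apply: transition_bounded_measurable.
transitivity (mean nu (fun x => \sum_(r <- patterns L) f r * \1_[set y | agree L y r] x)).
  rewrite mean_sum => [|r]; last first.
    by apply: bounded_measurableZ; exact: bounded_measurable_indic.
  apply: eq_bigr => r _; rewrite !meanZ//; last 2 first.
  - exact: bounded_measurable_indic.
  - exact: transition_bounded_measurable.
  by congr (_ * _); rewrite mean_indic// -(inv t _ t0)// integral_transition.
congr mean; apply/funext => x; rewrite [RHS](patterns_sum _ uL cf).
by apply: eq_bigr => r _; rewrite mulrC indicE mem_setE.
Qed.

(** The events on which the invariance equation holds form a Dynkin system, and cylinder events are
    covered by their indicators. *)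
Lemma flow_invariant (nu : probability pair R) : nu (@ordered d) = 1%E ->
  (forall t L f, 0 <= t -> uniq L -> cylindric L f -> mean nu (flow t f) = mean nu f) ->
  invariant_law P X nu.
Proof.
move=> on H; split=> // t A t0; rewrite (pair_measurableE R d).
have mo : measurable (@ordered d) by exact: measurable_ordered.
move: A; apply: (@dynkin_induction _ pair (cylinder_set (d := d))
  (fun A => (\int[nu]_(x in @ordered d) P (X x t @^-1` A))%E = nu A) (pair_measurableE R d)).
- exact: cylinder_setI.
- rewrite (eq_integral (fun=> 1%:E)) => [|x _]; last by rewrite preimage_setT probability_setT.
  by rewrite integral_cst// mul1e probability_setT; exact: on.
- move=> A cA; have mA := cylinder_measurable R cA.
  have [L cL] := cylinder_indic R cA.
  rewrite integral_transition// -[RHS]fineK ?fin_num_measure// -mean_indic//.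
  congr EFin; rewrite -(H t (undup L) _ t0 (undup_uniq L) (cylindric_uniq cL)).
  congr mean; apply/funext => x; rewrite /transition /flow !patchE; case: ifPn => //.
  by rewrite inE => ox; rewrite -mean_indic//; exact: measurable_dynamics.
- move=> S mS; rewrite !integral_transition// ?probability_setC//; last exact: measurableC.
  move=> /(congr1 fine) /= HS; rewrite -[X in (_ - X)%E]fineK ?fin_num_measure// -HS.
  rewrite -EFinB; congr EFin; rewrite -[1 in RHS](mean_cst nu) -meanB; last 2 first.
  + exact: bounded_measurable_cst.
  + exact: transition_bounded_measurable.
  apply: (eq_mean_on mo on); first by apply: transition_bounded_measurable => //; exact: measurableC.
    apply: (@bounded_measurableB _ _ _ (fun=> 1)); first exact: bounded_measurable_cst.
    exact: transition_bounded_measurable.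
  move=> x ox; rewrite /transition !patchE mem_set// preimage_setC probability_setC; last exact: measurable_dynamics.
  by rewrite fineB// fin_num_measure//; exact: measurable_dynamics.
- move=> F mF tF HF; rewrite measure_bigcup//=.
  rewrite (eq_integral (fun x => \sum_(0 <= k <oo) P (X x t @^-1` F k))%E); last first.
    move=> x; rewrite inE => ox; rewrite preimage_bigcup measure_bigcup//=.
      by apply: eq_eseriesl => k; rewrite mem_set.
    by move=> k _; exact: measurable_dynamics.
    by move=> m n _ _ [w [Fm Fn]]; apply: (tF m n I I); exists (X x t w).
  rewrite integral_nneseries//.
    transitivity (\sum_(0 <= k <oo) nu (F k))%E; first by apply: eq_eseriesr => k _; exact: HF.
    by apply: eq_eseriesl => k; rewrite mem_set.
  by move=> k; have [_ _ _ XM] := XG; exact: XM.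
Qed.


Lemma lec_mean_on (nu : probability pair R) c f g : nu (@ordered d) = 1%E ->
  bounded_measurable f -> bounded_measurable g -> (forall x, ordered x -> lec c (f x) (g x)) ->
  lec c (mean nu f) (mean nu g).
Proof.
have mo : measurable (@ordered d) by exact: measurable_ordered.
by case: c => on mf mg fg; apply: (le_mean_on mo on).
Qed.

(** Integrate the one-step estimate against [nu]: the two means of [f] cancel; divide by [t] and let
    [t] tend to 0. *)
Lemma invariant_stationary (nu : probability pair R) : invariant_law P X nu ->
  pair_stationary a b M nu.
Proof.
move=> inv; have [on _] := inv; split=> // L f c uL nf cf.
have [B fB] : exists B : R, forall x, `|f x| <= B.
  by have [B fB] := cylindric_bounded cf; exists B.
apply: (@lec_limit _ _ _ _ (step_error L B)) => t t0.
have cG := cylindric_pair_gen a b M c cf.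
have bG := cylindric_bounded_measurable cG; have bf := cylindric_bounded_measurable cf.
have bK := cylindric_bounded_measurable (cylindric_iter_pair_ker a b M c t 1 cf).
have bE : bounded_measurable (fun _ : pair => sg R c * (step_error L B * t ^+ 2)).
  exact: bounded_measurable_cst.
have := @lec_mean_on nu c (flow t f) _ on (flow_bounded_measurable (ltW t0) uL cf)
  (bounded_measurableD bK bE).
rewrite (invariant_flow inv (ltW t0) uL cf) meanD// mean_cst.
rewrite /= /pair_ker meanD//; last exact: bounded_measurableZ.
rewrite meanZ// => H.
have : lec c (mean nu f) (mean nu f + t * mean nu (pair_gen a b M L c f) +
    sg R c * (step_error L B * t ^+ 2)).
  apply: H => x ox; rewrite /flow patchE mem_set//.
  have := semigroup_step c uL nf cf (fun y _ => fB y) ox (lexx 0) t0.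
  rewrite subr0 (semigroup0 ox (cylindric_iter_pair_ker a b M c t 1 cf)).
  exact.
move: (mean nu (pair_gen _ _ _ _ _ _)) => m; rewrite -addrA.
have -> : t * m + sg R c * (step_error L B * t ^+ 2) = t * (m + sg R c * (step_error L B * t)) by ring.
by rewrite /lec; case: (c); rewrite ?lerDl ?gerDl ?pmulr_rge0 ?pmulr_rle0.
Qed.

(** For the boundary +: the flow is at most the iterated + kernel up to an error, the + and -
    iterates have close means by the assumed width, and the - iterate has mean at most that of [f].
    The other inequality is symmetric. *)
Lemma stationary_lec_flow (nu : probability pair R) D f (B t : R) c :
  pair_stationary a b M nu -> nondecr f -> cylindric D f -> (forall x, `|f x| <= B) -> 0 < t ->
  (forall eps : R, 0 < eps -> exists L, [/\ uniq L, {subset D <= L} &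
    forall (k : R) n, 0 < k -> k * \sum_(i <- L) M i <= 1 ->
      mean nu (iter n (pair_ker a b M L true k) f) -
      mean nu (iter n (pair_ker a b M L false k) f) <= eps]) ->
  lec c (mean nu (flow t f)) (mean nu f).
Proof.
move=> sn nf cf fB t0 width; apply: (@lec_limit _ _ _ _ 2) => eps eps0.
have [L [uL sD H]] := width eps eps0; have cfL := cylindric_sub sD cf.
have [on _] := sn.
have S0 : 0 <= \sum_(i <- L) M i by apply: sumr_ge0.
set C := step_error L B.
(* The number of steps must exceed both terms: the first makes the Euler step of length [t / n] a
   kernel, the second makes the accumulated error [C * t ^ 2 / n] at most [eps]. *)
pose z : R := t * \sum_(i <- L) M i + `|C| * t ^+ 2 / eps.
have z0 : 0 <= z.
  by rewrite addr_ge0 ?mulr_ge0 ?invr_ge0 ?exprn_ge0// ltW.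
have zn : z <= (Num.bound z).+1%:R.
  by have := archi_boundP z0 => /ltW /le_trans; apply; rewrite ler_nat.
move: (Num.bound z).+1 (ltn0Sn (Num.bound z)) zn => n n0 zn.
have n0' : 0 < n%:R :> R by rewrite ltr0n.
pose s : R := t / n%:R; have s0 : 0 < s by rewrite divr_gt0.
have ns : n%:R * s = t by rewrite /s mulrCA mulfV ?mulr1// gt_eqF.
have sM : s * \sum_(i <- L) M i <= 1.
  rewrite /s mulrAC ler_pdivrMr// mul1r (le_trans _ zn)// lerDl.
  by rewrite !mulr_ge0 ?invr_ge0 ?exprn_ge0// ltW.
have nC : n%:R * (C * s ^+ 2) <= eps.
  have -> : n%:R * (C * s ^+ 2) = C * t ^+ 2 / n%:R.
    by rewrite /s; field; rewrite gt_eqF.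
  rewrite ler_pdivrMr//.
  have : `|C| * t ^+ 2 / eps <= n%:R.
    by apply: le_trans zn; rewrite lerDr mulr_ge0// ltW.
  rewrite ler_pdivrMr// [_ * eps]mulrC; apply: le_trans.
  by rewrite ler_wpM2r ?exprn_ge0 ?ler_norm// ltW.
have bK c' := cylindric_bounded_measurable (cylindric_iter_pair_ker a b M c' s n cfL).
have bE : bounded_measurable (fun _ : pair => sg R c * (n%:R * (C * s ^+ 2))).
  exact: bounded_measurable_cst.
have bF : bounded_measurable (flow t f).
  by apply: flow_bounded_measurable (ltW t0) uL cfL.
have u c' := pair_stationary_iter c' n aA bA ab M0' sn uL nf cfL s0 sM.
have := @lec_mean_on nu c (flow t f) _ on bF (bounded_measurableD (bK c) bE).
rewrite meanD// mean_cst => H1.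
have {}H1 : lec c (mean nu (flow t f))
  (mean nu (iter n (pair_ker a b M L c s) f) + sg R c * (n%:R * (C * s ^+ 2))).
  apply: H1 => x ox; rewrite /flow patchE mem_set// -ns.
  exact: semigroup_iter.
move: nC H1; move: (n%:R * (C * s ^+ 2)) => e nC H1.
move: nC H1 (H s n s0 sM) (u true) (u false); rewrite /lec /sg; case: (c).
all: move: (mean nu f) (mean nu (flow t f)) (mean nu (iter n (pair_ker a b M L true s) f)) => m mf mt.
all: move: (mean nu _) => mm; lra.
Qed.

Lemma flowD (nu : probability pair R) t L f g : nu (@ordered d) = 1%E -> 0 <= t -> uniq L ->
  cylindric L f -> cylindric L g ->
  mean nu (flow t (fun x => f x + g x)) = mean nu (flow t f) + mean nu (flow t g).
Proof.
move=> on t0 uL cf cg.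
have cfg : cylindric L (fun x => f x + g x) by move=> x y xy; rewrite (cf _ _ xy) (cg _ _ xy).
rewrite -meanD; [|exact: flow_bounded_measurable t0 uL cf|exact: flow_bounded_measurable t0 uL cg].
congr mean; apply/funext => x; rewrite /flow !patchE; case: ifPn => [|_]; last by rewrite addr0.
rewrite inE => ox; rewrite /semigroup.
exact: (meanD _ (bounded_measurable_dynamics ox t0 cf) (bounded_measurable_dynamics ox t0 cg)).
Qed.

Lemma stationary_invariant (nu : probability pair R) : pair_stationary a b M nu ->
  (forall D f (B eps : R), nondecr f -> cylindric D f -> (forall x, `|f x| <= B) -> 0 < eps ->
    exists L, [/\ uniq L, {subset D <= L} &
    forall (k : R) n, 0 < k -> k * \sum_(i <- L) M i <= 1 ->
      mean nu (iter n (pair_ker a b M L true k) f) -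
      mean nu (iter n (pair_ker a b M L false k) f) <= eps]) ->
  invariant_law P X nu.
Proof.
move=> sn width; have [on _] := sn; apply: flow_invariant => // t L f t0 uL cf.
have mo : measurable (@ordered d) by exact: measurable_ordered.
have [->|tn0] := eqVneq t 0.
  apply: (eq_mean_on mo on); first exact: flow_bounded_measurable (lexx 0) uL cf.
    exact: cylindric_bounded_measurable cf.
  by move=> x ox; rewrite /flow patchE mem_set// (semigroup0 ox cf).
have {tn0}t0' : 0 < t by rewrite lt_neqAle eq_sym tn0.
have bnd g : cylindric L g -> exists C : R, forall x, `|g x| <= C.
  by move=> /cylindric_bounded[C gC]; exists C.
have eqn g : nondecr g -> cylindric L g -> mean nu (flow t g) = mean nu g.
  move=> ng cg; have [B gB] := bnd g cg.
  have HH c := stationary_lec_flow c sn ng cg gB t0' (fun eps e0 => width L g B eps ng cg gB e0).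
  by apply/eqP; rewrite eq_le; apply/andP; split; [exact: (HH true)|exact: (HH false)].
have [B fB] := bnd f cf; have B0 : 0 <= B by apply: le_trans (fB (@bot d, @bot d)).
pose k x : R := 2 * B * spin_count R L x.
have ck : cylindric L k by move=> x y xy; rewrite /k (cylindric_spin_count _ xy).
have nk : nondecr k by move=> x y ox oy xy; rewrite /k ler_wpM2l ?mulr_ge0// nondecr_spin_count.
have nfk := nondecr_addcount cf fB.
have cfk : cylindric L (fun x => f x + k x) by move=> x y xy; rewrite (cf _ _ xy) (ck _ _ xy).
have := eqn _ nfk cfk; rewrite (flowD on t0 uL cf ck) (eqn k nk ck) meanD.
- exact: addIr.
- exact: cylindric_bounded_measurable cf.
- exact: cylindric_bounded_measurable ck.
Qed.

(** A discrete average over a horizon [n + 1] with spacing [1 / (n + 1)]. The horizon makes the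
    boundary terms negligible, the spacing the errors of the single steps; both end up of order
    [1 / (n + 1)]. *)
Definition time_average n f : R :=
  (n.+1 ^ 2)%:R^-1 * \sum_(k < n.+1 ^ 2) semigroup (k%:R * n.+1%:R^-1) f (@top d, @top d).

Let ordered_top : ordered (@top d, @top d). Proof. by move=> i; exact: lexx. Qed.

Let time_ge0 (n k : nat) : 0 <= k%:R * n.+1%:R^-1 :> R.
Proof. by rewrite mulr_ge0 ?invr_ge0. Qed.

Let semigroup_bm t L f : 0 <= t -> cylindric L f ->
  bounded_measurable (fun w => f (X (@top d, @top d) t w)) :=
  @bounded_measurable_dynamics _ t L f ordered_top.

Lemma time_average_le n L f g : cylindric L f -> cylindric L g ->
  (forall x, ordered x -> f x <= g x) -> time_average n f <= time_average n g.
Proof.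
move=> cf cg fg; rewrite ler_wpM2l ?invr_ge0//; apply: ler_sum => k _.
have t0 := time_ge0 n k; have [N0 [mN0 PN0 subN0]] := dynamics_ordered ordered_top t0.
apply: (@le_mean_on _ _ _ P _ _ (~` N0)).
- exact: measurableC.
- by rewrite probability_setC// PN0 sube0.
- exact: semigroup_bm cf.
- exact: semigroup_bm cg.
by move=> w Nw; apply: fg; apply: contrapT => nw; apply: Nw; exact: subN0.
Qed.

Lemma time_average_cst n k : time_average n (fun=> k) = k.
Proof.
rewrite /time_average (eq_bigr (fun=> k)) => [|j _]; last exact: mean_cst.
by rewrite sumr_const card_ord -[k *+ _]mulr_natl mulrA mulVf ?mul1r// pnatr_eq0 expn_eq0.
Qed.

Lemma time_average_linear n L f g k : cylindric L f -> cylindric L g ->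
  time_average n (fun x => f x + k * g x) = time_average n f + k * time_average n g.
Proof.
move=> cf cg; rewrite /time_average mulrCA -mulrDr; congr (_ * _).
rewrite mulr_sumr -big_split; apply: eq_bigr => j _ /=.
have t0 := time_ge0 n j; have bg := semigroup_bm t0 cg.
by rewrite /semigroup -(meanZ _ _ bg) -(meanD _ (semigroup_bm t0 cf) (bounded_measurableZ _ bg)).
Qed.

(** The [(n + 1) ^ 2] step errors of size [step_error / (n + 1) ^ 2] add up to [step_error], the
    values of [f] at both ends give [2 * B], and the horizon [n + 1] divides the total. *)
Lemma time_average_stationary n c L f (B : R) : uniq L -> nondecr f -> cylindric L f ->
  (forall x, `|f x| <= B) ->
  lec c 0 (time_average n (pair_gen a b M L c f) +
    sg R c * ((step_error L B + 2 * B) * n.+1%:R^-1)).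
Proof.
move=> uL nf cf fB; set s : R := n.+1%:R^-1; set C := step_error L B.
have s0 : 0 < s by rewrite invr_gt0.
pose v k := semigroup (k%:R * s) f (@top d, @top d).
pose g k := semigroup (k%:R * s) (pair_gen a b M L c f) (@top d, @top d).
have cG := cylindric_pair_gen a b M c cf.
have vB k : `|v k| <= B.
  have bf := semigroup_bm (time_ge0 n k) cf.
  rewrite ler_norml -[X in X <= _ <= _](mean_cst P) -[X in _ <= _ <= X](mean_cst P).
  apply/andP; split; apply: le_mean => //; try exact: bounded_measurable_cst.
    by move=> w; have := fB (X (@top d, @top d) (k%:R * s) w); rewrite ler_norml => /andP[].
  by move=> w; have := fB (X (@top d, @top d) (k%:R * s) w); rewrite ler_norml => /andP[].
have step k : lec c (v k.+1) (v k + s * g k + sg R c * (C * s ^+ 2)).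
  have ks : k%:R * s < k.+1%:R * s by rewrite ltr_pM2r// ltr_nat.
  have := semigroup_step c uL nf cf (fun y _ => fB y) ordered_top (time_ge0 n k) ks.
  rewrite -mulrBl -natrB// subSnn mul1r /pair_ker {2}/semigroup.
  rewrite (meanD _ (semigroup_bm (time_ge0 n k) cf)).
    by rewrite (meanZ _ _ (semigroup_bm (time_ge0 n k) cG)).
  exact: bounded_measurableZ (semigroup_bm (time_ge0 n k) cG).
(* The one-step estimates telescope along the grid. *)
have sum K : lec c (v K) (v 0%N + s * \sum_(k < K) g k + sg R c * (K%:R * (C * s ^+ 2))).
  elim: K => [|K IH]; first by rewrite big_ord0 mulr0 addr0 mul0r; exact: lec_refl0.
  move: (step K) IH; rewrite big_ord_recr/= -[K.+1%:R]natr1; move: (C * s ^+ 2) => e.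
  by rewrite /lec /sg; case: (c); lra.
have := sum (n.+1 ^ 2)%N; rewrite /time_average -/(g _) -/s.
have nE : (n.+1 ^ 2)%:R = s^-1 ^+ 2 by rewrite /s invrK natrX.
rewrite nE; have -> : s^-1 ^+ 2 * (C * s ^+ 2) = C by field; rewrite gt_eqF.
have -> : (s^-1 ^+ 2)^-1 = s * s by rewrite exprVn invrK expr2.
rewrite -[s * s * _]mulrA; move: (\sum_(k < n.+1 ^ 2) _) => S.
have := vB 0%N; have := vB (n.+1 ^ 2)%N; rewrite !ler_norml.
move: (v _) (v _) => v1 v0 /andP[v1l v1u] /andP[v0l v0u] H.
have : lec c 0 (s * S + sg R c * (C + 2 * B)) by move: H; rewrite /lec /sg; case: (c); lra.
have -> : s * (s * S) + sg R c * ((C + 2 * B) * s) = s * (s * S + sg R c * (C + 2 * B)) by ring.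
by rewrite /lec; case: (c); rewrite ?pmulr_rge0 ?pmulr_rle0.
Qed.

End Dynamics.

(** * Construction of laws of pairs *)

Section PairMean.
Variables (R : realType) (d : nat).
Local Notation pair := (config d * config d)%type.
Implicit Types (L : seq (site d)) (f g : pair -> R) (x : pair) (l : (pair -> R) -> R).

(** Comparison is asked on ordered pairs only: in this way concentration on [ordered] passes to
    limits and then to [extension]. *)
Definition pair_mean l :=
  [/\ forall L f g, cylindric L f -> cylindric L g -> (forall x, ordered x -> f x <= g x) ->
        l f <= l g,
      forall k, l (fun=> k) = k &
      forall L f g k, cylindric L f -> cylindric L g ->
        l (fun x => f x + k * g x) = l f + k * l g].

Lemma ultra_cvg (G : set_system nat) (u : nat -> R) (B : R) : UltraFilter G ->
  (forall n, `|u n| <= B) -> cvg (u @ G).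
Proof.
move=> GU uB; have uI : (u @ G) `[(- B), B]%classic.
  by change (G (u @^-1` `[(- B), B])); apply: filterE => n; rewrite /= in_itv/= -ler_norml.
have [p [_ clp]] := segment_compact _ uI.
apply/cvg_ex; exists p => A nA.
have [//|GC] := in_ultra_setVsetC (u @^-1` A) GU.
by have [y [/= nAy /nAy]] := clp (~` A) A GC nA.
Qed.

Lemma pair_mean_norm l L f (B : R) : pair_mean l -> cylindric L f -> (forall x, `|f x| <= B) ->
  `|l f| <= B.
Proof.
move=> [le cst _] cf fB; rewrite ler_norml -(cst (- B)) -[X in _ <= _ <= X]cst.
by apply/andP; split; apply: (le L) => // x _; have := fB x; rewrite ler_norml => /andP[].
Qed.

(** Along an ultrafilter finer than the eventuality filter all bounded sequences converge at once,
    so the limit exists for every cylindric function and is linear. *)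
Lemma pair_mean_ultra (e : nat -> (pair -> R) -> R) : (forall n, pair_mean (e n)) ->
  exists2 l, pair_mean l & forall L f c (C : R), cylindric L f ->
    (forall n, lec c 0 (e n f + sg R c * (C * n.+1%:R^-1))) -> lec c 0 (l f).
Proof.
move=> em; have [G [GU oG]] := ultraFilterLemma (eventually_filter : ProperFilter \oo).
have ec L f : cylindric L f -> cvg (e^~ f @ G).
  by move=> cf; have [B fB] := cylindric_bounded cf; apply: ultra_cvg => n; apply: pair_mean_norm cf fB.
exists (fun f => lim (e^~ f @ G)).
  split=> [L f g cf cg fg|k|L f g k cf cg].
  - apply: ler_lim; [exact: ec cf|exact: ec cg|].
    by apply: filterE => n; have [le _ _] := em n; apply: (le L).
  - have -> : e^~ (fun=> k) = (fun=> k) by apply/funext => n; have [_ -> _] := em n.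
    exact: lim_cst.
  - have -> : e^~ (fun x => f x + k * g x) = (fun n => e n f + k * e n g).
      by apply/funext => n; have [_ _ lin] := em n; rewrite (lin L).
    apply: cvg_lim => //; apply: cvgD; first exact: ec cf.
    by apply: cvgZr; exact: ec cg.
move=> L f c C cf H; have z : C * n.+1%:R^-1 @[n --> G] --> C * 0.
  apply: cvgZr; apply: cvg_trans (@cvg_harmonic R).
  exact: cvg_app.
have lf : e n f + sg R c * (C * n.+1%:R^-1) @[n --> G] --> lim (e^~ f @ G) + sg R c * (C * 0).
  by apply: cvgD; [exact: ec cf|exact: cvgZr].
rewrite !mulr0 addr0 in lf.
case: c H lf => H lf.
  by apply: (cvgr_to_ge lf); apply: filterE => n; exact: H.
by apply: (cvgr_to_le lf); apply: filterE => n; exact: H.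
Qed.

Section Extension.
Variable l : (pair -> R) -> R.
Hypothesis lm : pair_mean l.
Implicit Types (w : seq bool) (u : R).
Local Notation key := ('rV[int]_d * bool)%type.

(** Enumerates the spins of both components through a numbering of the countable set of keys; a
    number that codes no key yields a constant bit. *)
Definition bit k x : bool :=
  if @pickle_inv key k is Some (i, e) then (if e then x.2 i else x.1 i) else false.

(* Words list the bits of a pair of configurations from the last one to the first. *)
Fixpoint bits n x := if n is m.+1 then bit m x :: bits m x else [::].

Definition bit_sites n : seq (site d) := pmap (fun k => omap fst (@pickle_inv key k)) (iota 0 n).

Lemma size_bits n x : size (bits n x) = n. Proof. by elim: n => //= n ->. Qed.

Lemma eq_bits n x y : (forall k, (k < n)%N -> bit k x = bit k y) -> bits n x = bits n y.
Proof. by elim: n => //= n IH H; rewrite H// IH// => k kn; apply: H; exact: ltnW. Qed.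

Lemma cylindric_bits n (F : seq bool -> R) : cylindric (bit_sites n) (fun x => F (bits n x)).
Proof.
move=> x y /agreeP xy; congr F; apply: eq_bits => k kn; rewrite /bit.
case E : (pickle_inv k) => [[i e]|//]; have [|e1 e2] := xy i; last by rewrite e1 e2.
by rewrite mem_pmap; apply/mapP; exists k; rewrite ?mem_iota// E.
Qed.

Definition word_weight w : R := l (fun x => (bits (size w) x == w)%:R).

Definition letter b w x : R := (bits (size w).+1 x == b :: w)%:R.

Let cyl_letter b w : cylindric (bit_sites (size w).+1) (letter b w).
Proof. exact: (cylindric_bits (n := (size w).+1) (fun v => (v == b :: w)%:R)). Qed.

Lemma word_weight_split w : word_weight w = word_weight (false :: w) + word_weight (true :: w).
Proof.
have [_ _ lin] := lm; rewrite -[word_weight (true :: w)]mul1r.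
rewrite -(lin _ _ _ _ (@cyl_letter false w) (@cyl_letter true w)); congr l.
apply/funext => x; rewrite /letter /= !eqseq_cons; case: (bit _ x) => /=.
  by rewrite add0r mul1r.
by rewrite mulr0 addr0.
Qed.

Lemma word_weight_ge0 w : 0 <= word_weight w.
Proof.
have [le cst _] := lm; rewrite -[X in X <= _](cst 0); apply: (le (bit_sites (size w))) => //.
  exact: (cylindric_bits (n := size w) (fun v => (v == w)%:R)).
Qed.

Lemma word_weight_nil : word_weight [::] = 1. Proof. by have [_ cst _] := lm; exact: cst. Qed.

(** The unit interval is cut into intervals indexed by words, of length [word_weight]; extending a
    word splits its interval, the part for [false] coming first. This is the left end of the
    interval of [w], and [word] below locates a point among these intervals. *)
Fixpoint left_end w : R :=
  if w is b :: w' then left_end w' + (if b then word_weight (false :: w') else 0) else 0.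

Lemma left_end_bounds w : 0 <= left_end w /\ left_end w + word_weight w <= 1.
Proof.
elim: w => [|b w [IH1 IH2]] /=; first by rewrite add0r word_weight_nil.
have := word_weight_split w; have := word_weight_ge0 (false :: w); have := word_weight_ge0 (true :: w).
by case: b; lra.
Qed.

Fixpoint word n u :=
  if n is m.+1 then (left_end (word m u) + word_weight (false :: word m u) <= u) :: word m u
  else [::].

Definition digit k u : bool := left_end (word k u) + word_weight (false :: word k u) <= u.

Lemma word_interval w u : 0 <= u < 1 ->
  (word (size w) u == w) = (left_end w <= u < left_end w + word_weight w).
Proof.
move=> u01; elim: w => [|b w IH]; first by rewrite /= add0r word_weight_nil u01.
rewrite [word _ _]/= eqseq_cons; have := word_weight_split w.
have := word_weight_ge0 (false :: w); have := word_weight_ge0 (true :: w).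
case: eqVneq IH => [->|_] IH.
  rewrite andbT; move/esym/andP: IH => [h1 h2].
  case: b => /= w1 w0 e; last rewrite eqbF_neg -ltNge addr0 h1//.
  by rewrite eqb_id -addrA -e h2 andbT.
rewrite andbF => w1 w0 e; apply/esym/negP => /andP[h1 h2].
move/esym/negP: IH; apply; apply/andP; split; case: b h1 h2 => /=; lra.
Qed.

Definition decode w : pair :=
  (fun i => nth false (rev w) (@choice.pickle key (i, false)),
   fun i => nth false (rev w) (@choice.pickle key (i, true))).

Lemma nth_bits n k x : (k < n)%N -> nth false (rev (bits n x)) k = bit k x.
Proof.
elim: n => // n IH kn; rewrite /= rev_cons nth_rcons size_rev size_bits.
case: ifPn => [/IH //|]; rewrite -leqNgt => nk.
have -> : k = n by apply/eqP; rewrite eqn_leq nk andbT -ltnS.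
by rewrite eqxx.
Qed.

Lemma cylindric_decode L f : cylindric L f -> exists n, forall x, f x = f (decode (bits n x)).
Proof.
move=> cf; pose top_key (i : site d) := maxn (@choice.pickle key (i, false)) (@choice.pickle key (i, true)).
exists (\max_(i <- L) top_key i).+1 => x; apply: cf; apply/agreeP => i iL.
have : (top_key i <= \max_(i <- L) top_key i)%N by apply: (leq_bigmax_seq _ iL).
move: (\max_(i <- L) _) => m; rewrite geq_max => /andP[].
rewrite -ltnS => k1; rewrite -ltnS => k2.
by rewrite [decode]lock /= -lock /decode [bits]lock /= -lock (nth_bits _ k1) (nth_bits _ k2) /bit !pickleK_inv.
Qed.

Lemma pair_mean_bits n (F : seq bool -> R) :
  l (fun x => F (bits n x)) = \sum_(w : n.-tuple bool) F w * word_weight w.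
Proof.
have [_ cst lin] := lm.
pose T (r : seq (n.-tuple bool)) x : R := \sum_(w <- r) F w * (bits n x == w)%:R.
have S r : cylindric (bit_sites n) (T r) /\ l (T r) = \sum_(w <- r) F w * word_weight w.
  elim: r => [|w r [c1 e1]].
    have -> : T [::] = fun=> 0 by apply/funext => x; rewrite /T big_nil.
    by rewrite cst big_nil.
  have -> : T (w :: r) = fun x => T r x + F w * (bits n x == w)%:R.
    by apply/funext => x; rewrite /T big_cons addrC.
  have c2 : cylindric (bit_sites n) (fun x => (bits n x == w)%:R : R).
    exact: (cylindric_bits (n := n) (fun v => (v == w)%:R)).
  split; first by move=> x y xy; rewrite (c1 _ _ xy) (c2 _ _ xy).
  by rewrite (lin _ _ _ _ c1 c2) e1 big_cons addrC /word_weight size_tuple.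
have [_ <-] := S (index_enum _); congr l; apply/funext => x; rewrite /T.
have sz : size (bits n x) == n by rewrite size_bits.
rewrite (bigD1 (Tuple sz))//= eqxx mulr1 big1 ?addr0// => w.
by rewrite -val_eqE /= eq_sym => /negPf ->; rewrite mulr0.
Qed.

Definition coded u : pair :=
  (fun i => digit (@choice.pickle key (i, false)) u, fun i => digit (@choice.pickle key (i, true)) u).

Lemma size_word n u : size (word n u) = n. Proof. by elim: n => //= n ->. Qed.

Lemma bits_coded n u : 0 <= u < 1 -> bits n (coded u) = word n u.
Proof.
move=> u01; elim: n => //= n ->; congr cons; rewrite /bit.
case E : (pickle_inv n) => [[i e]|].
  have := @pickle_invK key n; rewrite E /= => <-.
  by case: (e).
(* The number [n] codes no key, so the continuation by [true] has weight 0 and the digit read off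
   [u] is [false], as is the constant bit. *)
have w1 : word_weight (true :: word n u) = 0.
  have [_ cst _] := lm; rewrite -(cst 0); congr l; apply/funext => x.
  by rewrite /= eqseq_cons size_word /bit E.
have := word_interval (word n u) u01; rewrite size_word eqxx => /esym/andP[_].
by rewrite word_weight_split w1 addr0 => h; apply/esym/negbTE; rewrite -ltNge.
Qed.

Local Notation lebesgue01 := (uniform_prob (@ltr01 R)).

Lemma measurable_digit k b : measurable [set u | digit k u = b].
Proof.
have half w (e : bool) : measurable [set u | (left_end w + word_weight (false :: w) <= u) = e].
  set v := left_end w + _.
  have -> : [set u | (v <= u) = e] = if e then `[v, +oo[%classic else `]-oo, v[%classic.
    apply/seteqP; split => u; case: e => /=; rewrite in_itv/= ?andbT//.
      by move/negbT; rewrite -ltNge.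
    by rewrite ltNge => /negbTE.
  by case: e; exact: measurable_itv.
have words n w : measurable [set u | word n u = w].
  elim: n w => [|n IH] w /=.
    have [->|w0] := eqVneq w [::]; first by rewrite (_ : [set _ | _] = setT)//; apply/seteqP; split.
    by rewrite (_ : [set _ | _] = set0)//; apply/seteqP; split => // u /= e; rewrite -e eqxx in w0.
  case: w => [|e w]; first by rewrite (_ : [set _ | _] = set0)//; apply/seteqP; split.
  have -> : [set u | (left_end (word n u) + word_weight (false :: word n u) <= u) :: word n u = e :: w] =
      [set u | word n u = w] `&` [set u | (left_end w + word_weight (false :: w) <= u) = e].
    by apply/seteqP; split => u /= [<- <-].
  exact: measurableI.
have -> : [set u | digit k u = b] =
    \bigcup_w ([set u | word k u = w] `&` [set u | (left_end w + word_weight (false :: w) <= u) = b]).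
  by apply/seteqP; split => u /=; [exists (word k u)|move=> [w _ [/= <- <-]]].
by apply: countable_bigcupT_measurable => [|w]; [exact: countableP|exact: measurableI].
Qed.

Lemma measurable_coded : measurable_fun setT (coded : measurableTypeR R -> pair).
Proof.
suff H (s : R -> config d) : (forall i b, measurable [set u | s u i = b]) ->
    measurable_fun setT (s : measurableTypeR R -> config d).
  by apply: measurable_fun_pair; apply: H => i b; exact: measurable_digit.
move=> ms; apply: (@measurability _ _ (measurableTypeR R) (config d) setT s (@cylinders d setT)) => //.
move=> _ [_ [i [b [_ ->]]] <-].
by rewrite setTI; exact: ms.
Qed.

Definition coded_mfun : {mfun measurableTypeR R >-> pair} :=
  @mfun_Sub _ _ (measurableTypeR R) pair coded (mem_set measurable_coded).

Definition extension : probability pair R := @distribution _ _ (measurableTypeR R) pair R lebesgue01 coded_mfun.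

Lemma measurable_bits n w : measurable [set x : pair | bits n x = w].
Proof.
have c := cylindric_bits (n := n) (fun v => (v == w)%:R).
rewrite (_ : [set x | _] = (fun x => (bits n x == w)%:R) @^-1` [set (1 : R)]).
  by rewrite -[X in measurable X]setTI; exact: (cylindric_measurable c measurableT (measurable_set1 _)).
apply/seteqP; split => x /=; first by move=> ->; rewrite eqxx.
by case: eqP => //= _ /eqP; rewrite eq_sym oner_eq0.
Qed.

Lemma extension_bits n w : size w = n -> extension [set x | bits n x = w] = (word_weight w)%:E.
Proof.
move=> sw; rewrite /extension /distribution /pushforward.
have m0 (v : R) : measurable [set u : measurableTypeR R | u < v].
  rewrite (_ : [set _ | _] = `]-oo, v[%classic); first exact: measurable_itv.
  by apply/seteqP; split => u /=; rewrite in_itv.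
have mw := measurable_bits n w.
have mA : measurable (coded_mfun @^-1` [set x : pair | bits n x = w]).
  by rewrite -[X in measurable X]setTI; exact: measurable_coded.
have P0 : lebesgue01 [set u | u < 0] = 0%E by rewrite uniform_prob_lt// lexx ler01.
have P1 : lebesgue01 [set u | u < 1] = 1%E by rewrite uniform_prob_lt// lexx ler01.
(* [D] is the half-open unit interval, of full mass, on which [word_interval] locates [u]. *)
pose D := [set u : measurableTypeR R | u < 1] `\` [set u | u < 0].
have mD : measurable D by exact: measurableD.
have PD : lebesgue01 D = 1%E.
  have -> : lebesgue01 D = (lebesgue01 [set u | (u < 1)%R] -
      lebesgue01 ([set u | (u < 1)%R] `&` [set u | (u < 0)%R]))%E.
    apply: (measureD (mu := lebesgue01)) => //.
    by change (lebesgue01 [set u | (u < 1)%R] < +oo)%E; rewrite P1 ltry.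
  rewrite P1 (_ : [set u | u < 1] `&` [set u | u < 0] = [set u | u < 0]) ?P0 ?sube0//.
  by apply/seteqP; split => u /= => [[]//|u0]; split=> //; exact: lt_trans u0 ltr01.
have [w0 w1] := left_end_bounds w; have w2 := word_weight_ge0 w.
have b1 : 0 <= left_end w + word_weight w <= 1 by rewrite addr_ge0.
have b2 : 0 <= left_end w <= 1 by rewrite w0/=; lra.
apply: fine_eq => //; first exact: fin_num_measure.
change (fine (lebesgue01 (coded_mfun @^-1` [set x : pair | bits n x = w])) = word_weight w).
rewrite -(mean_indic lebesgue01 mA).
transitivity (mean lebesgue01 (fun u => \1_[set u | u < left_end w + word_weight w] u -
    \1_[set u | u < left_end w] u)).
  apply: (eq_mean_on mD PD); first exact: bounded_measurable_indic.
    by apply: bounded_measurableB; exact: bounded_measurable_indic.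
  move=> u [/= u1 /negP]; rewrite -leNgt => u0; have u01 : 0 <= u < 1 by rewrite u0 u1.
  have memE v : (u \in [set u0 : measurableTypeR R | u0 < v]) = (u < v).
    by apply/idP/idP; rewrite inE.
  rewrite !indicE !memE; have := word_interval w u01; rewrite sw => e.
  have -> : (u \in coded_mfun @^-1` [set x | bits n x = w]) = (left_end w <= u < left_end w + word_weight w).
    rewrite -e; apply/idP/idP; first by rewrite inE /= => <-; rewrite bits_coded.
    by rewrite inE /= => /eqP <-; rewrite bits_coded.
  rewrite leNgt; have [h1|h1] := ltP u (left_end w) => /=.
    by rewrite (lt_le_trans h1) ?subrr// lerDl.
  by rewrite subr0.
rewrite meanB; [|exact: bounded_measurable_indic|exact: bounded_measurable_indic].
have mv v : 0 <= v <= 1 -> mean lebesgue01 \1_[set u : measurableTypeR R | u < v] = v.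
  by move=> v01; rewrite mean_indic//; exact: (congr1 fine (uniform_prob_lt v01)).
by rewrite !mv// addrC addKr.
Qed.

Lemma mean_extension L f : cylindric L f -> mean extension f = l f.
Proof.
move=> cf; have [n fE] := cylindric_decode cf.
have -> : f = (fun x => f (decode (bits n x))) by apply/funext.
rewrite (pair_mean_bits n (fun w => f (decode w))).
have mw w := measurable_bits n w.
transitivity (mean extension (fun x =>
    \sum_(w : n.-tuple bool) f (decode w) * \1_[set x | bits n x = w] x)).
  congr mean; apply/funext => x; have sz : size (bits n x) == n by rewrite size_bits.
  rewrite (bigD1 (Tuple sz))//= indicE mem_set// mulr1 big1 ?addr0// => w wn.
  rewrite indicE memNset ?mulr0// => /= e; move/eqP: wn; apply; exact: val_inj.
rewrite mean_sum => [|w]; last by apply: bounded_measurableZ; exact: bounded_measurable_indic.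
apply: eq_bigr => w _; rewrite meanZ; last exact: bounded_measurable_indic.
by rewrite mean_indic// extension_bits ?size_tuple.
Qed.

(** Disorder at one site is a cylinder event, to which [l] gives weight 0 by comparison on ordered
    pairs; there are countably many sites. *)
Lemma extension_ordered : extension (@ordered d) = 1%E.
Proof.
have mo : measurable (@ordered d) by exact: measurable_ordered.
have null i : extension [set x | x.1 i = true /\ x.2 i = false] = 0%E.
  have mA : measurable [set x : pair | x.1 i = true /\ x.2 i = false].
    by apply: measurableI; [exact: measurable_spin1|exact: measurable_spin2].
  apply: fine_eq => //; first exact: fin_num_measure.
  have [le cst _] := lm.
  have [L cA] : exists L, cylindric L (\1_[set x : pair | x.1 i = true /\ x.2 i = false] : pair -> R).
    apply: cylinder_indic; exists [:: i] => x y /agreeP xy /= [<- <-].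
    by have [|-> ->] := xy i; rewrite ?inE.
  rewrite -mean_indic// (mean_extension cA) /=; apply/eqP; rewrite eq_le; apply/andP; split.
    rewrite -[X in _ <= X](cst 0); apply: (le L) => // x ox.
    by rewrite indicE memNset// => -[/= e1 e2]; have := ox i; rewrite e1 e2.
  by rewrite -[X in X <= _](cst 0); apply: (le L).
have : extension.-negligible (~` @ordered d).
  pose Z n := [set x : pair | if @choice.unpickle 'rV[int]_d n is Some i then
    x.1 i = true /\ x.2 i = false else False].
  have sub : ~` @ordered d `<=` \bigcup_n Z n.
    move=> x /= nx; apply: contrapT => H; apply: nx => i.
    case E1 : (x.1 i); case E2 : (x.2 i) => //.
    by case: H; exists (@choice.pickle 'rV[int]_d i) => //; rewrite /Z /= choice.pickleK.
  apply: negligibleS sub _.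
  apply: negligible_bigcup => n.
  rewrite /Z; case: (choice.unpickle n) => [i|]; last first.
    by exists set0; split; [exact: measurable0|exact: measure0|].
  exists [set x | x.1 i = true /\ x.2 i = false]; split => //.
  by apply: measurableI; [exact: measurable_spin1|exact: measurable_spin2].
  exact: null.
move=> /(measure_negligible (measurableC mo)) z.
have e : (1 - extension (@ordered d) = 0)%E by rewrite -(probability_setC extension mo); exact: z.
apply: fine_eq => //; first exact: fin_num_measure.
have := congr1 fine e; rewrite fineB ?fin_num_measure//=; lra.
Qed.

End Extension.
End PairMean.

(** * Subcriticality *)

Section Shells.
Variables (R : realType) (d : nat).
Implicit Types (i j : site d) (k : nat).

Lemma finite_site_ball i k : finite_set (site_ball i k).
Proof.
pose F (g : {ffun 'I_d -> 'I_(2 * k).+1}) : site d := \row_m (i ord0 m + (g m : nat)%:Z - k%:Z).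
apply: (@sub_finite_set _ _ (F @` setT)); last exact: finite_image.
move=> j jk; have le m : (absz (j ord0 m - i ord0 m) <= k)%N.
  apply: leq_trans jk; rewrite /site_norm (bigD1 m)//= !mxE.
  by rewrite leq_addr.
exists [ffun m => inord (absz (j ord0 m - i ord0 m + k%:Z))] => //.
apply/rowP => m; rewrite !mxE ffunE.
have := le m; move: (j ord0 m) (i ord0 m) => u v uv.
rewrite inordK; lia.
Qed.

Lemma card_site_ball i k : (0 < d)%N -> (0 < k)%N -> (2 <= #|` fset_set (site_ball i k)|)%N.
Proof.
move=> d0 k0; pose m0 : 'I_d := Ordinal d0.
pose j : site d := i + delta_mx ord0 m0.
have ij : i != j.
  apply/eqP => /rowP /(_ m0); rewrite !mxE !eqxx /=.
  by move/eqP; rewrite -subr_eq0 opprD addrA subrr add0r oppr_eq0 oner_eq0.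
have fB := finite_site_ball i k.
have c2 : #|` [fset i; j]%fset| = 2%N by rewrite cardfs2 ij.
rewrite -[X in (X <= _)%N]c2; apply: fsubset_leq_card; apply/fsubsetP => v; rewrite !inE in_fset_set// => /orP[]/eqP ->.
  rewrite inE /site_ball /= subrr /site_norm big1// => m _; by rewrite mxE.
rewrite inE /site_ball /= /j addrC addKr /site_norm (bigD1 m0)//= mxE !eqxx.
rewrite big1 ?addn0// => m /negPf mm; by rewrite mxE mm andbF.
Qed.

Lemma esum_shells (f : site d -> R) i : (0 < d)%N -> (forall j, 0 <= f j) -> f i = 0 ->
  (2%:E * (\esum_(j in [set: site d]) (f j)%:E) <=
   \sum_(1 <= k <oo) ((#|` fset_set (site_ball i k)|)%:R%:E *
     \esum_(j in site_shell i k) (f j)%:E))%E.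
Proof.
move=> d0 f0 fi; have f0' j : (0 <= (f j)%:E)%E by rewrite lee_fin.
have s0 k : (0 <= \esum_(j in site_shell i k) (f j)%:E)%E by exact: esum_ge0.
have -> : [set: site d] = \bigcup_k site_shell i k.
  by apply/seteqP; split => j // _; exists (site_norm (j - i)).
rewrite nneseries_sum_bigcup//; last first.
  by move=> m n _ _ [j [/= <- <-]].
(* Shell 0 is the site [i] alone, where [f] vanishes; the ball bound is needed from [k = 1] on. *)
rewrite nneseries_recl// esum1 => [|j]; last first.
  rewrite /site_shell /= /site_norm => /eqP; rewrite sum_nat_eq0 => /forallP H.
  congr EFin; rewrite -fi; congr f; apply/rowP => m; apply/eqP.
  by have := H m; rewrite /= absz_eq0 !mxE subr_eq0.
rewrite add0e -nneseriesZl// [X in (X <= _)%E]eseries_cond [X in (_ <= X)%E]eseries_cond.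
apply: lee_nneseries => k; first by rewrite mule_ge0.
move=> k1; rewrite lee_wpmul2r// lee_fin ler_nat card_site_ball//.
Qed.

End Shells.

Section Subcritical.
Variables (R : realType) (d : nat).
Local Notation pair := (config d * config d)%type.
Variables (J J' : site d -> site d -> R) (h h' : site d -> R) (beta betac : R).
Hypotheses (d_gt0 : (0 < d)%N) (J_inter : interaction J) (J'_inter : interaction J').
Hypothesis J_le : forall i j, J i j <= J' i j.
Hypotheses (h_gt0 : forall i, 0 < h i) (h'_gt0 : forall i, 0 < h' i).
Hypothesis h_le : forall i, h i <= h' i.
Hypothesis Jh_le : forall i : site d,
  (\esum_(j in [set: site d]) (J' i j - J i j)%:E <= (h' i - h i)%:E)%E.
Hypothesis betacE : ((2 * betac)%:E * ereal_sup (range (fun i : site d =>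
  (\sum_(1 <= k <oo) shell_weight J' i k)%E)) = 1)%E.
Hypotheses (beta_gt0 : 0 < beta) (beta_lt : beta < betac).

Let M := clock_rate beta J' h'.
Let a := up_prob beta J h M.
Let b := up_prob beta J' h' M.

Lemma rsum_interaction_le i : rsum (J i) <= rsum (J' i).
Proof. by apply: ler_rsum => //; exact: interaction_summable. Qed.

Lemma clock_rate_large i : 2 * expR (beta * (rsum (J i) + `|h i|)) <= M i.
Proof.
rewrite ler_pM2l// ler_expR ler_pM2l// gtr0_norm// lerD//; exact: rsum_interaction_le.
Qed.

Lemma clock_rate_large' i : 2 * expR (beta * (rsum (J' i) + `|h' i|)) <= M i.
Proof. by rewrite gtr0_norm. Qed.

(** Larger couplings may lower the field where spins are -, but by at most the sum of
    [J' i j - J i j], which the increase of the external field compensates. *)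
Lemma local_field_dominated i s t : config_le s t ->
  local_field J h i s <= local_field J' h' i t.
Proof.
move=> st; have J0 j : 0 <= J' i j - J i j by rewrite subr_ge0.
have [sD le] := rsum_le_esum J0 (Jh_le i).
apply: le_trans (local_field_le h J_inter i st) _.
have s1 := spin_summable J_inter i t; have s2 := spin_summable J'_inter i t.
have : - rsum (fun j => J' i j - J i j) <=
    rsum (fun j => J' i j * spin R (t j)) - rsum (fun j => J i j * spin R (t j)).
  rewrite -!rsumN// -rsumD//; last exact: rsummableN.
  apply: ler_rsum; [exact: rsummableN|by apply: rsummableD => //; exact: rsummableN|] => j.
  by have := J0 j; case: (t j) => /=; lra.
by rewrite /local_field; move: le; lra.
Qed.

Lemma up_prob_dominated : dominated a b.
Proof.
move=> i x ox; apply: up_prob_le => //.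
- exact: clock_rate_large.
- exact: clock_rate_large'.
- exact: local_field_dominated.
Qed.

(** The cumulative thresholds of [draw] are the two probabilities of refreshing to +, so one mark
    performs both single updates. *)
Lemma draw_coupled_prob i y (u : R) : ordered y ->
  draw (coupled_prob (flip_rate beta J h) (flip_rate beta J' h') M i y) u =
  (u < a i y.1, u < b i y.2).
Proof.
move=> oy; have ab := up_prob_dominated i oy.
have uf (c : site d -> config d -> R) s : update_prob c M i false s = 1 - update_prob c M i true s.
  by rewrite /update_prob; case: (s i) => //=; lra.
rewrite /draw /= !uf -/(a i y.1) -/(b i y.2).
have -> : a i y.1 + (1 - a i y.1 - (1 - b i y.2)) = b i y.2 by ring.
case: ltP => [ua|_]; first by rewrite (lt_le_trans ua ab).
by case: ltP.
Qed.

Lemma subcritical i : 4 * beta * rsum (J' i) <= beta / betac.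
Proof.
have bc0 : 0 < betac by exact: lt_trans beta_lt.
have := betacE; set S := ereal_sup _ => SE0.
(* The defining equation of [betac] forces the supremum to be finite: a positive number times an
   infinite value is not 1. *)
have SE : S = ((2 * betac)^-1)%:E.
  move: SE0; case: S => [s||].
  - by move=> -[e]; congr EFin; apply: (mulfI (x := 2 * betac)); rewrite ?e ?mulfV ?mulf_neq0// ?gt_eqF.
  - by rewrite gt0_muley ?lte_fin ?mulr_gt0.
  - by rewrite gt0_muleNy ?lte_fin ?mulr_gt0.
have J0 j := interaction_ge0 J'_inter i j; have [_ Jii _ _] := J'_inter.
have := esum_shells d_gt0 J0 (Jii i).
have sJ := interaction_summable J'_inter i.
rewrite -[X in (2%:E * X)%E]fineK ?rsummable_fin// -rsum_ge0E// => H.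
have {}H : ((2 * rsum (J' i))%:E <= S)%E.
  by apply: le_trans H _; apply: ereal_sup_ubound; exists i.
rewrite SE lee_fin in H.
rewrite ler_pdivlMr//.
have : 2 * betac * (2 * rsum (J' i)) <= 2 * betac * (2 * betac)^-1 by rewrite ler_wpM2l ?mulr_ge0// ltW.
rewrite mulfV ?mulf_neq0 ?gt_eqF// => H2.
have -> : 4 * beta * rsum (J' i) * betac = beta * (2 * betac * (2 * rsum (J' i))) by ring.
by rewrite -[X in _ <= X]mulr1 ler_wpM2l// ltW.
Qed.

Lemma subcritical_lt1 : beta / betac < 1.
Proof. by rewrite ltr_pdivrMr ?mul1r// (lt_trans beta_gt0). Qed.

Lemma subcritical_le i : 4 * beta * rsum (J i) <= beta / betac.
Proof.
apply: le_trans (subcritical i); apply: ler_wpM2l.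
  by rewrite mulr_ge0// ltW.
exact: rsum_interaction_le.
Qed.

End Subcritical.

(** * Gibbs measures are stationary *)

Section GibbsStationary.
Variables (R : realType) (d : nat) (mu : probability (config d) R).
Local Notation pair := (config d * config d)%type.
Implicit Types (s t : config d) (L : seq (site d)) (i j : site d) (f g : config d -> R) (c b : bool).

(** The diagonal embedding transfers measurability, pattern sums and uniqueness from pairs to single
    configurations. *)
Definition diag_pair s : pair := (s, s).

Lemma measurable_diag_pair : measurable_fun setT diag_pair.
Proof. by apply: measurable_fun_pair; exact: measurable_id. Qed.

Lemma cylindric1_bounded_measurable L f : cylindric1 L f -> bounded_measurable f.
Proof.
move=> cf; have cF := cylindric_fst cf.
split; last by have [B fB] := cylindric_bounded cF; exists B => s; exact: (fB (s, s)).
exact: (measurableT_comp (cylindric_measurable cF) measurable_diag_pair).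
Qed.

Lemma positive_mean_mean : positive_mean (mean mu).
Proof.
by apply: (@positive_mean_comp _ _ _ _ mu id) => L f cf; exact: cylindric1_bounded_measurable cf.
Qed.

Lemma sub_cylinders_measurable (D : set (site d)) (A : set (config d)) :
  <<s cylinders D >> A -> measurable A.
Proof.
apply: smallest_sub; first exact: sigma_algebra_measurable.
move=> _ [i [b [_ ->]]]; apply: sub_sigma_algebra; exists i, b; by split.
Qed.

Lemma sub_cylinders_agree L (D : set (site d)) r : (forall i, i \in L -> D i) ->
  <<s cylinders D >> [set s | agree L (diag_pair s) r].
Proof.
pose T' := g_sigma_algebraType (cylinders D).
elim: L => [|i L IH] LD.
  rewrite (_ : [set s | _] = setT); last by apply/seteqP; split.
  exact: (@measurableT _ T').
have Di : D i by apply: LD; rewrite inE eqxx.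
have mi b : <<s cylinders D >> [set s : config d | s i = b].
  by apply: sub_sigma_algebra; exists i, b.
rewrite (_ : [set s | _] = ([set s : config d | s i = r.1 i] `&` [set s : config d | s i = r.2 i]) `&`
    [set s | agree L (diag_pair s) r]).
  apply: (@measurableI _ T'); last by apply: IH => j jL; apply: LD; rewrite inE jL orbT.
  exact: (@measurableI _ T' _ _ (mi _) (mi _)).
apply/seteqP; split => s /=; rewrite /pair_at /= xpair_eqE.
  by move=> /andP[/andP[/eqP e1 /eqP e2] H].
by move=> [[-> ->] ->]; rewrite !eqxx.
Qed.

Variables (beta : R) (J : site d -> site d -> R) (h M : site d -> R).
Hypothesis JI : interaction J.
Hypothesis beta_gt0 : 0 < beta.
Hypothesis M0 : forall i, 0 < M i.
Hypothesis mu_gibbs : gibbs beta J h mu.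
Let p := up_prob beta J h M.

Let kernel i b s : R := (1 + expR (- (2 * beta * energy J h i (set_spin s i b))))^-1.

Let kernelE i b s : kernel i b s = (1 + expR (- (2 * beta * (spin R b * local_field J h i s))))^-1.
Proof. by rewrite /kernel energyE// local_field_set_spin// /set_spin eqxx. Qed.

Let kernel_bm i b : bounded_measurable (kernel i b).
Proof.
have [km _] := mu_gibbs i b; split.
  by move=> _ B mB; rewrite setTI; exact: sub_cylinders_measurable (km B mB).
exists 1 => s; have e0 := expR_gt0 (- (2 * beta * energy J h i (set_spin s i b))).
rewrite /kernel; move: (expR _) e0 => u u0; have u1 : 0 < 1 + u by rewrite addr_gt0.
by rewrite gtr0_norm ?invr_gt0// invf_le1// lerDl ltW.
Qed.

Let spin_bm i b : bounded_measurable (\1_[set s : config d | s i = b] : config d -> R).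
Proof. by apply: bounded_measurable_indic; apply: sub_sigma_algebra; exists i, b. Qed.

(** Extends the conditional probability at [i] from events to cylindric functions of the other
    spins, pattern by pattern. *)
Lemma gibbs_mean i b L f : uniq L -> i \notin L -> cylindric1 L f ->
  mean mu (fun s => \1_[set s : config d | s i = b] s * f s) = mean mu (fun s => kernel i b s * f s).
Proof.
move=> uL iL cf; have [_ dlr] := mu_gibbs i b.
pose A r := [set s | agree L (diag_pair s) r].
have GA r : <<s cylinders [set~ i] >> (A r).
  by apply: sub_cylinders_agree => j jL /= ji; rewrite -ji jL in iL.
have mA r : measurable (A r) by exact: sub_cylinders_measurable (GA r).
have mE : measurable [set s : config d | s i = b] by apply: sub_sigma_algebra; exists i, b.
have fE s : f s = \sum_(r <- patterns L) f r.1 * \1_(A r) s.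
  have -> := patterns_sum (diag_pair s) uL (cylindric_fst cf) : f s = _.
  apply: eq_bigr => r _.
  by rewrite mulrC indicE /A mem_setE.
have expand (g : config d -> R) : bounded_measurable g ->
    mean mu (fun s => g s * f s) = \sum_(r <- patterns L) f r.1 * mean mu (fun s => g s * \1_(A r) s).
  move=> bg; have bgA r : bounded_measurable (fun s => g s * \1_(A r) s).
    by apply: bounded_measurableM => //; exact: bounded_measurable_indic.
  transitivity (mean mu (fun s => \sum_(r <- patterns L) f r.1 * (g s * \1_(A r) s))).
    congr mean; apply/funext => s; rewrite fE mulr_sumr; apply: eq_bigr => r _.
    by rewrite mulrCA.
  rewrite mean_sum => [|r]; last exact: bounded_measurableZ.
  by apply: eq_bigr => r _; rewrite meanZ.
rewrite (expand _ (spin_bm i b)) (expand _ (kernel_bm i b)).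
apply: eq_bigr => r _; congr (_ * _).
transitivity (fine (mu ([set s : config d | s i = b] `&` A r))).
  rewrite -mean_indic; last exact: measurableI.
  by congr mean; apply/funext => s; rewrite indicI.
rewrite dlr// /mean /Rintegral; congr fine.
rewrite [LHS]integral_mkcond; apply: eq_integral => s _.
by rewrite patchE indicE; case: ifP => _; rewrite ?mulr1 ?mulr0.
Qed.

Let slope i f s : R := f (set_spin s i true) - f (set_spin s i false).

(** The clock rate [M i] cancels the denominators of the refresh probabilities, leaving the Glauber
    flip rates times the effect of the flip. *)
Lemma spin_gen_slope L c f s : spin_gen M p L c f s = \sum_(i <- L)
  (\1_[set s : config d | s i = false] s *
     (slope i f s * expR (beta * local_field J h i (extend L c s))) -
   \1_[set s : config d | s i = true] s *
     (slope i f s * expR (- (beta * local_field J h i (extend L c s))))).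
Proof.
apply: eq_big_seq => i iL; have Mi := M0 i.
have fs : f s = f (set_spin s i (s i)).
  by congr f; apply/funext => j; rewrite /set_spin; case: eqP => // ->.
have eL : extend L c s i = s i by rewrite /extend iL.
rewrite /spin_update /p up_probE// eL fs /slope !indicE.
have memE b : (s \in [set s : config d | s i = b]) = (s i == b).
  by apply/idP/idP; [rewrite inE => /= ->|move=> /eqP e; rewrite inE].
rewrite !memE; case: (s i) => /=.
  by rewrite mul0r mul1r; field; rewrite gt_eqF.
by rewrite mul0r mul1r; field; rewrite gt_eqF.
Qed.

(** With [u] the true local field this is detailed balance and the difference vanishes. With the
    field of a frozen boundary it has the sign of the error in the field, as the factor [y - x]
    below shows. *)
Lemma kernel_balance i c s (u : R) :
  lec c (local_field J h i s) u ->
  lec c 0 (kernel i false s * expR (beta * u) - kernel i true s * expR (- (beta * u))).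
Proof.
rewrite !kernelE /= !mul1r mulN1r mulrN opprK; set H := local_field _ _ _ _ => Hu.
have -> : 2 * beta * H = beta * H + beta * H by ring.
rewrite opprD !expRD [expR (- (beta * H))]expRN [expR (- (beta * u))]expRN.
have : lec c (expR (beta * H)) (expR (beta * u)).
  by move: Hu; rewrite /lec; case: (c); rewrite ler_expR ler_pM2l.
have := expR_gt0 (beta * H); have := expR_gt0 (beta * u).
move: (expR (beta * H)) (expR (beta * u)) => x y y0 x0 xy.
have -> : (1 + x * x)^-1 * y - (1 + x^-1 * x^-1)^-1 * y^-1 =
    (y - x) * ((y + x) / ((1 + x * x) * y)).
  by field; rewrite !gt_eqF//=; nra.
have k0 : 0 <= (y + x) / ((1 + x * x) * y) by rewrite divr_ge0//; nra.
move: xy; rewrite /lec; case: (c) => xy; first by rewrite mulr_ge0// subr_ge0.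
by rewrite mulr_le0_ge0// subr_le0.
Qed.

(** Site by site, the indicator of the spin is replaced by its conditional probability; the
    remaining integrand has a definite sign by [kernel_balance] and monotonicity of [f]. *)
Lemma gibbs_stationary : spin_stationary M p (mean mu).
Proof.
move=> L f c uL nf cf.
pose e (b : bool) i s : R := slope i f s *
  expR ((if b then -1 else 1) * (beta * local_field J h i (extend L c s))).
(* Neither the slope nor the local field at [i] depends on the spin at [i] itself, so [gibbs_mean]
   applies over the other sites of [L]. *)
pose L' i := [seq j <- L | j != i].
have ce b i : cylindric1 (L' i) (e b i).
  move=> s t st; have st' j : j \in L -> j != i -> s j = t j.
    by move=> jL ji; apply: st; rewrite mem_filter ji.
  rewrite /e /slope; congr ((_ - _) * expR (_ * (_ * _))).
  - by apply: cf => j jL; rewrite /set_spin; case: eqVneq => // ji; exact: st'.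
  - by apply: cf => j jL; rewrite /set_spin; case: eqVneq => // ji; exact: st'.
  rewrite -(local_field_set_spin h JI i (extend L c s) true).
  rewrite -(local_field_set_spin h JI i (extend L c t) true).
  congr local_field; apply/funext => j; rewrite /set_spin /extend.
  by case: eqVneq => // ji; case: ifP => // jL; exact: st'.
have be b i := cylindric1_bounded_measurable (ce b i).
have -> : mean mu (spin_gen M p L c f) =
    \sum_(i <- L) mean mu (fun s => kernel i false s * e false i s - kernel i true s * e true i s).
  transitivity (mean mu (fun s => \sum_(i <- L)
    (\1_[set s : config d | s i = false] s * e false i s - \1_[set s : config d | s i = true] s * e true i s))).
    congr mean; apply/funext => s; rewrite spin_gen_slope; apply: eq_bigr => i _.
    by rewrite /e mul1r mulN1r.
  have bm i b : bounded_measurable (fun s => \1_[set s : config d | s i = b] s * e b i s).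
    exact: bounded_measurableM.
  have bk i b : bounded_measurable (fun s => kernel i b s * e b i s).
    exact: bounded_measurableM.
  rewrite mean_sum => [|i]; last first.
    exact: bounded_measurableB.
  apply: eq_bigr => i _; rewrite !meanB//.
  have iL' : i \notin L' i by rewrite mem_filter eqxx.
  by rewrite !(gibbs_mean _ (filter_uniq _ uL) iL' (ce _ i)).
have key i : lec c 0 (mean mu (fun s => kernel i false s * e false i s - kernel i true s * e true i s)).
  have bk : bounded_measurable (fun s => kernel i false s * e false i s - kernel i true s * e true i s).
    by apply: bounded_measurableB; exact: bounded_measurableM.
  have b0 : bounded_measurable (fun _ : config d => 0 : R) by exact: bounded_measurable_cst.
  have pt s : lec c 0 (kernel i false s * e false i s - kernel i true s * e true i s).
    have sl : 0 <= slope i f s.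
      rewrite subr_ge0; apply: nf => j; rewrite /set_spin; case: eqP => // _; exact: lexx.
    have Hc : lec c (local_field J h i s) (local_field J h i (extend L c s)).
      rewrite /lec; case: (c); apply: local_field_le => // j; rewrite /extend; case: ifP => // _.
        exact: lex1.
    have := kernel_balance Hc; rewrite /e mul1r mulN1r.
    move: (local_field _ _ _ (extend _ _ _)) => u.
    have -> : kernel i false s * (slope i f s * expR (beta * u)) -
      kernel i true s * (slope i f s * expR (- (beta * u))) = slope i f s *
      (kernel i false s * expR (beta * u) - kernel i true s * expR (- (beta * u))) by ring.
    by rewrite /lec; case: (c) => H; [rewrite mulr_ge0|rewrite mulr_ge0_le0].
  rewrite -[X in lec c X _](mean_cst mu); move: pt; rewrite /lec; case: (c) => pt; exact: le_mean.
by move: key; rewrite /lec; case: (c) => key; [apply: sumr_ge0|apply: sumr_le0].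
Qed.

End GibbsStationary.

(** * Couplings *)

Section Couplings.
Variables (R : realType) (d : nat).
Local Notation pair := (config d * config d)%type.
Implicit Types (nu : probability pair R) (mu : probability (config d) R).

(** Both laws are pushed to the diagonal, where uniqueness for laws of pairs applies. *)
Lemma marginal_unique nu (phi : pair -> config d) mu : measurable_fun setT phi ->
  (forall D f, cylindric1 D f -> mean nu (f \o phi) = mean mu f) ->
  forall A : set (config d), measurable A -> nu (phi @^-1` A) = mu A.
Proof.
move=> mphi H A mA.
have md := @measurable_diag_pair d; have mdp := measurableT_comp md mphi.
pose F : {mfun pair >-> pair} := mfun_Sub (mem_set mdp).
pose G : {mfun config d >-> pair} := mfun_Sub (mem_set md).
pose nu1 : probability pair R := distribution nu F.
pose nu2 : probability pair R := distribution mu G.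
suff E : forall B : set pair, measurable B -> nu1 B = nu2 B.
  have mA' : measurable (fst @^-1` A : set pair).
    by rewrite -[X in measurable X]setTI; exact: measurable_fst.
  exact: (E _ mA').
apply: probability_cylinder_unique => B cB; have mB := cylinder_measurable R cB.
have [L cL] := cylinder_indic R cB.
have mB1 : measurable (F @^-1` B).
  by rewrite -[X in measurable X]setTI; exact: (mdp measurableT _ mB).
have mB2 : measurable (G @^-1` B).
  by rewrite -[X in measurable X]setTI; exact: (md measurableT _ mB).
have c1 : cylindric1 L (\1_(G @^-1` B) : config d -> R).
  move=> s t st; have := cL (s, s) (t, t); rewrite !indicE => e; apply: e.
  by apply/agreeP => i iL /=; rewrite (st i iL).
change (nu (F @^-1` B) = mu (G @^-1` B)).
apply: fine_eq; [exact: fin_num_measure|exact: fin_num_measure|].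
by rewrite -!mean_indic// -(H _ _ c1).
Qed.

Let disagreement (i : site d) : set pair := [set x | x.1 i != x.2 i].

Let measurable_disagreement i : measurable (disagreement i).
Proof.
have -> : disagreement i = ([set x : pair | x.1 i = true] `&` [set x : pair | x.2 i = false]) `|`
    ([set x : pair | x.1 i = false] `&` [set x : pair | x.2 i = true]).
  apply/seteqP; split => x; rewrite /disagreement /=.
    by case: (x.1 i); case: (x.2 i) => //= _; [left|right].
  by move=> [[-> ->]|[-> ->]].
by apply: measurableU; apply: measurableI; (exact: measurable_spin1 || exact: measurable_spin2).
Qed.

Lemma coupling_magnetization nu mu mu' i : coupling mu mu' nu ->
  fine (mu' [set s | s i = true]) - fine (mu [set s | s i = true]) =
  mean nu (fun x => \1_[set x : pair | x.2 i = true] x - \1_[set x : pair | x.1 i = true] x).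
Proof.
move=> cp; have mA : measurable [set s : config d | s i = true].
  by apply: sub_sigma_algebra; exists i, true.
have [e1 e2] := cp _ mA.
have m1 : measurable [set x : pair | x.1 i = true] by exact: measurable_spin1.
have m2 : measurable [set x : pair | x.2 i = true] by exact: measurable_spin2.
rewrite meanB; [|exact: bounded_measurable_indic|exact: bounded_measurable_indic].
by rewrite !mean_indic// -e1 -e2.
Qed.

Let gap_bm i : bounded_measurable (fun x =>
  \1_[set x : pair | x.2 i = true] x - \1_[set x : pair | x.1 i = true] x : R).
Proof.
by apply: bounded_measurableB; apply: bounded_measurable_indic;
  [exact: measurable_spin2|exact: measurable_spin1].
Qed.

Let gapE i (x : pair) : \1_[set x : pair | x.2 i = true] x - \1_[set x : pair | x.1 i = true] x =
  (x.2 i)%:R - (x.1 i)%:R :> R.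
Proof.
by rewrite !indicE; congr (_%:R - _%:R); congr nat_of_bool; apply/idP/idP; rewrite inE.
Qed.

Let disagreementE i (x : pair) : \1_(disagreement i) x = (x.1 i != x.2 i)%:R :> R.
Proof. by rewrite indicE; congr (_%:R); congr nat_of_bool; apply/idP/idP; rewrite inE. Qed.

Lemma disagreement_ge nu mu mu' i : coupling mu mu' nu ->
  fine (mu' [set s | s i = true]) - fine (mu [set s | s i = true]) <= fine (nu (disagreement i)).
Proof.
move=> /(coupling_magnetization i) ->; rewrite -mean_indic//.
apply: le_mean => [||x]; [exact: gap_bm|exact: bounded_measurable_indic|].
by rewrite gapE disagreementE; case: (x.1 i); case: (x.2 i) => /=; lra.
Qed.

Lemma ordered_disagreement nu mu mu' i : coupling mu mu' nu -> nu (@ordered d) = 1%E ->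
  fine (nu (disagreement i)) = fine (mu' [set s | s i = true]) - fine (mu [set s | s i = true]).
Proof.
move=> /(coupling_magnetization i) -> on; rewrite -mean_indic//.
have mo : measurable (@ordered d) by exact: measurable_ordered.
apply: (eq_mean_on mo on); [exact: bounded_measurable_indic|exact: gap_bm|move=> x /(_ i)].
by rewrite gapE disagreementE; case: (x.1 i); case: (x.2 i) => //= _; rewrite ?subrr ?subr0.
Qed.

Lemma ordered_coupling_optimal nu mu mu' : coupling mu mu' nu -> nu (@ordered d) = 1%E ->
  sup_disagreement nu = dbar mu mu'.
Proof.
move=> cp on; apply/eqP; rewrite eq_le; apply/andP; split; last first.
  by apply: ereal_inf_lbound; exists nu.
apply: le_ereal_inf_tmp => _ [nu' cp' <-].
apply: ge_ereal_sup => _ [i _ <-].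
apply: (@le_trans _ _ (nu' (disagreement i))); last first.
  by apply: ereal_sup_ubound; exists i.
change (nu (disagreement i) <= nu' (disagreement i))%E.
have md := measurable_disagreement i.
rewrite -[X in (X <= _)%E]fineK ?fin_num_measure// -[X in (_ <= X)%E]fineK ?fin_num_measure//.
by rewrite lee_fin (ordered_disagreement i cp on) disagreement_ge.
Qed.

End Couplings.


Theorem mainTheorem5 (R : realType) (d : nat) (d_gt0 : (0 < d)%N)
  (J J' : site d -> site d -> R) (h h' : site d -> R) (beta betac : R)
  (J_inter : interaction J) (J'_inter : interaction J')
  (J_le : forall i j, J i j <= J' i j)
  (h_gt0 : forall i, 0 < h i) (h'_gt0 : forall i, 0 < h' i)
  (h_le : forall i, h i <= h' i) (h'_bounded : has_ubound (range h'))
  (Jh_le : forall i : site d,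
     (\esum_(j in [set: site d]) (J' i j - J i j)%:E <= (h' i - h i)%:E)%E)
  (J'_range : (ereal_sup (range (fun i : site d =>
     (\sum_(0 <= k <oo) shell_weight J' i k)%E)) < +oo)%E)
  (betacE : ((2 * betac)%:E * ereal_sup (range (fun i : site d =>
     (\sum_(1 <= k <oo) shell_weight J' i k)%E)) = 1)%E)
  (beta_gt0 : 0 < beta) (beta_lt : beta < betac)
  (mu mu' : probability (config d) R)
  (mu_gibbs : gibbs beta J h mu) (mu'_gibbs : gibbs beta J' h' mu')
  (dO : measure_display) (Omega : measurableType dO) (P : probability Omega R)
  (N : site d -> R -> {RV P >-> nat}) (U : site d -> nat -> {RV P >-> R})
  (X : config d * config d -> R -> Omega -> config d * config d)
  (X_glauber : glauber_dynamics
     (coupled_prob (flip_rate beta J h) (flip_rate beta J' h')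
        (clock_rate beta J' h'))
     (clock_rate beta J' h') N U X) :
  exists nu : probability (config d * config d)%type R,
    [/\ invariant_law P X nu,
        forall nu' : probability (config d * config d)%type R,
          invariant_law P X nu' ->
          forall A : set (config d * config d), measurable A -> nu' A = nu A,
        coupling mu mu' nu,
        nu (@ordered d) = 1%E
      & sup_disagreement nu = dbar mu mu'].

Proof.
pose M := clock_rate beta J' h'; pose a := up_prob beta J h M; pose b := up_prob beta J' h' M.
have ML := clock_rate_large J_inter J'_inter J_le h_gt0 h_le beta_gt0.
have ML' := clock_rate_large' J' beta h'_gt0.
have th1 := subcritical_lt1 beta_gt0 beta_lt.
have sJ' := subcritical d_gt0 J'_inter betacE beta_gt0 beta_lt.
have sJ := subcritical_le d_gt0 J_inter J'_inter J_le betacE beta_gt0 beta_lt.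
have ab : dominated a b by exact: up_prob_dominated.
have aA : attractive a := attractive_up_prob J_inter beta_gt0 ML.
have bA : attractive b := attractive_up_prob J'_inter beta_gt0 ML'.
have M0 := M_gt0 ML.
have qd i y (u : R) : ordered y ->
    draw (coupled_prob (flip_rate beta J h) (flip_rate beta J' h') M i y) u = (u < a i y.1, u < b i y.2).
  by move=> oy; exact: draw_coupled_prob.
have bound (L : seq (site d)) (f : config d * config d -> R) : cylindric L f -> exists B : R, forall x, `|f x| <= B.
  by move=> /cylindric_bounded[B fB]; exists B.
(* The limit functional of the time averages started from the highest pair; [lH] lets their
   approximate stationarity, with error of order [1 / (n + 1)], become exact. *)
have [l lm lH] : exists2 l : (config d * config d -> R) -> R, pair_mean l &
    forall (L : seq (site d)) f c (C : R), cylindric L f ->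
    (forall n, lec c 0 (time_average P X n f + sg R c * (C * n.+1%:R^-1))) -> lec c 0 (l f).
  apply: pair_mean_ultra => n; split.
  - exact: (time_average_le X_glauber).
  - by move=> k; exact: time_average_cst.
  - exact: (time_average_linear X_glauber).
pose nu := extension l.
have on : nu (@ordered d) = 1%E by exact: extension_ordered.
have sn : pair_stationary a b M nu.
  split=> // L f c uL nf cf; have cG := cylindric_pair_gen a b M c cf.
  rewrite (mean_extension lm cG); have [B fB] := bound L f cf.
  apply: (lH _ _ _ (step_error M L B + 2 * B) cG) => n.
  exact: (time_average_stationary X_glauber M0 aA bA ab qd).
have inv : invariant_law P X nu.
  apply: (stationary_invariant X_glauber M0 aA bA ab qd sn) => D f B eps nf cf fB e0.
  exact: (stationary_width J_inter J'_inter beta_gt0 ML ML' th1 sJ sJ' ab sn nf cf fB e0).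
have cp : coupling mu mu' nu.
  move=> A mA; split; apply: marginal_unique => // D f cf.
    apply: (spin_stationary_unique J_inter beta_gt0 ML th1 sJ (positive_mean_fst nu)
      (positive_mean_mean mu) (stationary_fst sn) (gibbs_stationary J_inter beta_gt0 M0 mu_gibbs) cf).
    by have [B fB] := bound D _ (cylindric_fst cf); exists B => s; exact: (fB (s, s)).
  apply: (spin_stationary_unique J'_inter beta_gt0 ML' th1 sJ' (positive_mean_snd nu)
    (positive_mean_mean mu') (stationary_snd sn) (gibbs_stationary J'_inter beta_gt0 M0 mu'_gibbs) cf).
  by have [B fB] := bound D _ (cylindric_snd cf); exists B => s; exact: (fB (s, s)).
exists nu; split=> //; last exact: ordered_coupling_optimal.
move=> nu' inv'; have sn' := invariant_stationary X_glauber M0 aA bA ab qd inv'.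
exact: (stationary_unique J_inter J'_inter beta_gt0 ML ML' th1 sJ sJ' ab sn' sn).
Qed.
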